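(* Let $k\ge1$ and let $F=\sum_{(x_1,\ldots,x_k)\in\eta^k_{\neq}}f(x_1,\ldots,x_k)$ with $f\in L^1_s(X^k)$ be a $U$-statistic of order $k$ with $F\in L^2(\mathbb{P})$. Then the kernels $f_i$ of the Wiener--Itô chaos expansion of $F$ have the form $$f_i(y_1,\ldots,y_i)=\begin{cases}\displaystyle\binom{k}{i}\int_{X^{k-i}}f(y_1,\ldots,y_i,x_1,\ldots,x_{k-i})\,d\mu(x_1,\ldots,x_{k-i}), & i\le k,\\ 0,& i>k,\end{cases}$$ and $F$ has the variance $$\operatorname{Var}F=\sum_{i=1}^k i!\binom{k}{i}^2\int_{X^i}\left(\int_{X^{k-i}}f(y_1,\ldots,y_i,x_1,\ldots,x_{k-i})\,d\mu(x_1,\ldots,x_{k-i})\right)^2 d\mu(y_1,\ldots,y_i).$$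
   Context: Poisson process: $X$ is a Borel space (a measurable space isomorphic to a Borel subset of $[0,1]$) and $\mu$ is a $\sigma$-finite nonatomic measure on $X$. $\eta$ is a Poisson point process on $X$ with intensity measure $\mu$, i.e. a random element of the space $N(X)$ of integer-valued $\sigma$-finite measures such that $\eta(A)$ is Poisson distributed with parameter $\mu(A)$ and $\eta(A_1),\ldots,\eta(A_m)$ are independent for pairwise disjoint measurable sets. It is almost surely simple and identified with its random set of points; $\eta^k_{\neq}$ is the set of $k$-tuples of pairwise distinct points of $\eta$. $L^p(\mathbb{P})$ is the set of measurable $F:N(X)\to\mathbb{R}\cup\{\pm\infty\}$ with $\mathbb{E}|F(\eta)|^p<\infty$. $L^p_s(X^k)$ is the set of $\mu^k$-a.e. symmetric functions in $L^p(X^k,\mu^k)$, and $d\mu(x_1,\ldots,x_m)$ means $d\mu(x_1)\cdots d\mu(x_m)$. Multiple Wiener--Itô integrals: for a simple function $f_0$ on $X^n$ (symmetric, constant on finitely many Cartesian products $B_1\times\cdots\times B_n$ and zero elsewhere, vanishing on diagonals, square integrable), $I_n(f_0)=\sum f_0^{B_1\times\cdots\times B_n}(\eta-\mu)(B_1)\cdots(\eta-\mu)(B_n)$, the sum over these products with $f_0^{B_1\times\cdots\times B_n}$ the value there; $I_n$ extends to $L^2_s(X^n)$ by the isometry $\mathbb{E}I_n(f_0)^2=n!\|f_0\|^2$; $I_0(c)=c$. Chaos expansion: every $F\in L^2(\mathbb{P})$ can be written as $F=\sum_{i=0}^\infty I_i(f_i)$ in $L^2(\mathbb{P})$ with $f_0=\mathbb{E}F$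 and $\mu^i$-a.e. unique $f_i\in L^2_s(X^i)$; these $f_i$ are the kernels of the Wiener--Itô chaos expansion of $F$. *)

(* Defs.v *)
From HB Require Import structures.
From mathcomp Require Import all_boot all_order all_algebra all_fingroup.
From mathcomp Require Import all_classical all_reals all_analysis.
From mathcomp Require Import measurable_realfun.

Set Implicit Arguments.
Unset Strict Implicit.
Unset Printing Implicit Defensive.

Import Order.TTheory GRing.Theory Num.Theory.
Import numFieldNormedType.Exports.

Local Open Scope classical_set_scope.
Local Open Scope ring_scope.
Local Open Scope ereal_scope.

(* Isomorphic, as a measurable space, to a Borel subset [B] of [0, 1]. *)
Definition borel_space (R : realType) (d : measure_display)
    (X : measurableType d) : Prop :=
  exists (B : set R) (phi : X -> R) (psi : R -> X),
    [/\ measurable B, B `<=` `[0%R, 1%R], measurable_fun setT phi,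
        measurable_fun B psi &
        [/\ forall x, B (phi x), cancel phi psi &
            forall r, B r -> phi (psi r) = r]].

Definition nonatomic (R : realType) (d : measure_display)
    (X : measurableType d) (mu : set X -> \bar R) : Prop :=
  forall A, measurable A -> 0 < mu A ->
    exists B, [/\ measurable B, B `<=` A, 0 < mu B & mu B < mu A].

(* One step of the product measure on [n.-tuple X]: [mu \x nu] transported along
   [cons]. *)
Section product_step.
Context (R : realType) (d : measure_display) (X : measurableType d).
Context (n : nat) (mu : {sigma_finite_measure set X -> \bar R}).
Context (nu : {sigma_finite_measure set (n.-tuple X) -> \bar R}).

Definition pair_cons (z : X * n.-tuple X) : n.+1.-tuple X :=
  [the n.+1.-tuple X of z.1 :: z.2].

Lemma measurable_pair_cons : measurable_fun [set: X * n.-tuple X] pair_cons.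
Proof. exact: measurable_cons. Qed.

Definition product_step : set (n.+1.-tuple X) -> \bar R :=
  pushforward (mu \x nu) pair_cons.

Let product_step0 : product_step set0 = 0.
Proof. by rewrite /product_step /pushforward preimage_set0 measure0. Qed.

Let product_step_ge0 A : 0 <= product_step A.
Proof. exact: integral_ge0. Qed.

Let product_step_sigma_additive : semi_sigma_additive product_step.
Proof.
have mpre A : measurable A -> measurable (pair_cons @^-1` A).
  by move=> mA; rewrite -[X in measurable X]setTI; exact: measurable_pair_cons.
move=> F mF tF mUF; rewrite /product_step /pushforward preimage_bigcup.
apply: measure_semi_sigma_additive.
- by move=> n0; exact: mpre.
- apply/trivIsetP => /= i j _ _ ij; rewrite -preimage_setI.
  by move/trivIsetP : tF => /(_ _ _ _ _ ij) ->//; rewrite preimage_set0.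
- by rewrite -preimage_bigcup; exact: mpre.
Qed.

HB.instance Definition _ := isMeasure.Build _ _ _ product_step
  product_step0 product_step_ge0 product_step_sigma_additive.

Let product_step_sigma_finite : sigma_finite setT product_step.
Proof.
have /sigma_finiteP[F [TF ndF Foo]] := sigma_finiteT mu.
have /sigma_finiteP[G [TG ndG Goo]] := sigma_finiteT nu.
pose uncons (t : n.+1.-tuple X) := (thead t, [tuple of behead t]).
have consK (z : X * n.-tuple X) : uncons (pair_cons z) = z.
  by case: z => x t; congr pair => //; apply: val_inj.
have m_uncons : measurable_fun [set: n.+1.-tuple X] uncons.
  by apply: measurable_fun_pair; [exact: measurable_tnth|
    exact: measurable_behead].
exists (fun i => uncons @^-1` (F i `*` G i)).
  rewrite -preimage_bigcup [X in _ @^-1` X](_ : _ = setT) ?preimage_setT//.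
  apply/seteqP; split => // -[x t] _.
  have [i _ Fix] : (\bigcup_i F i) x by rewrite -TF.
  have [j _ Gjt] : (\bigcup_i G i) t by rewrite -TG.
  exists (maxn i j) => //; split.
  - by move: x Fix; exact/subsetPset/ndF/leq_maxl.
  - by move: t Gjt; exact/subsetPset/ndG/leq_maxr.
move=> i; have [mFi Fi_oo] := Foo i; have [mGi Gi_oo] := Goo i; split.
  rewrite -[X in measurable X]setTI; apply: m_uncons => //.
  exact: measurableX.
rewrite /product_step /pushforward.
rewrite [X in (_ \x _) X](_ : _ = F i `*` G i); last first.
  by apply/funext => z; rewrite -[in RHS](consK z).
by rewrite product_measure1E// lte_mul_pinfty// ge0_fin_numE.
Qed.

HB.instance Definition _ := Measure_isSigmaFinite.Build _ _ _ product_step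
  product_step_sigma_finite.

End product_step.

Fixpoint power_measure (R : realType) (d : measure_display)
    (X : measurableType d) (mu : {sigma_finite_measure set X -> \bar R})
    (n : nat) : {sigma_finite_measure set (n.-tuple X) -> \bar R} :=
  match n with
  | 0%N => \d_([tuple] : 0.-tuple X)
  | m.+1 => product_step mu (power_measure mu m)
  end.

Definition permute_tuple (T : Type) (n : nat) (s : 'S_n) (x : n.-tuple T) :
    n.-tuple T :=
  [tuple tnth x (s i) | i < n].

(* [L^p_s(X^n)]: a.e. symmetric functions in [L^p(X^n, mu^n)]. *)
Definition in_Lps (R : realType) (d : measure_display) (X : measurableType d)
    (mu : {sigma_finite_measure set X -> \bar R}) (p : R) (n : nat)
    (f : n.-tuple X -> R) : Prop :=
  f \in Lfun (power_measure mu n) p%:E /\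
  forall s : 'S_n, \forall x \ae power_measure mu n,
    f (permute_tuple s x) = f x.

Definition L2_cvg (R : realType) (d : measure_display) (T : measurableType d)
    (mu : {measure set T -> \bar R}) (u : nat -> T -> \bar R)
    (v : T -> \bar R) : Prop :=
  'N[mu]_2%:E[u m \- v] @[m --> \oo] --> 0.

(* [N(X)]: integer-valued is understood as valued in [{0, 1, .., +oo}]. *)
Record point_measure (R : realType) (d : measure_display)
    (X : measurableType d) := PointMeasure {
  point_measure_val :> {sigma_finite_measure set X -> \bar R};
  point_measure_integer : forall A, measurable A ->
    point_measure_val A = +oo \/ exists n : nat, point_measure_val A = n%:R%:E }.
Arguments point_measure : clear implicits.
Arguments point_measure R {d} X.

Section point_measure_measurable.
Context (R : realType) (d : measure_display) (X : measurableType d).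
Local Notation N := (point_measure R X).

HB.instance Definition _ := gen_eqMixin N.
HB.instance Definition _ := gen_choiceMixin N.

Let mzero_integer (A : set X) : measurable A ->
  @mzero d X R A = +oo \/ exists n : nat, @mzero d X R A = n%:R%:E.
Proof. by move=> _; right; exists 0%N. Qed.

HB.instance Definition _ := isPointed.Build N
  (@PointMeasure R d X (@mzero d X R) mzero_integer).

Definition point_measure_measurable : set (set N) :=
  <<s \bigcup_(A in measurable)
        preimage_set_system [set: N] (fun xi : N => xi A)
          (@measurable _ (\bar R)) >>.

Definition point_measure_display : measure_display.
Proof. by constructor. Qed.

HB.instance Definition _ := @isMeasurable.Build point_measure_display N
  point_measure_measurable (@sigma_algebra0 _ _ _)
  (@sigma_algebraC _ _) (@sigma_algebra_bigcup _ _ _).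

End point_measure_measurable.

Section poisson.
Context (R : realType) (dX dO : measure_display) (X : measurableType dX).
Context (Omega : measurableType dO).
Context (mu : {sigma_finite_measure set X -> \bar R}).
Context (P : probability Omega R) (eta : {RV P >-> point_measure R X}).

(* The second argument of [poisson_prob] is a dummy one; [poisson_prob 0 _] is
   the Dirac measure at 0. The Poisson law of infinite parameter is, as usual,
   the Dirac measure at infinity. *)
Definition poisson_marginals : Prop :=
  forall A, measurable A ->
    (mu A < +oo -> forall n : nat,
       P [set w | eta w A = n%:R%:E] =
         poisson_prob (fine (mu A)) 0%N [set n]) /\
    (mu A = +oo -> \forall w \ae P, eta w A = +oo).

Definition independent_increments : Prop :=
  forall (m : nat) (A : 'I_m -> set X) (B : 'I_m -> set (\bar R)),
    (forall i, measurable (A i)) -> trivIset setT A ->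
    (forall i, measurable (B i)) ->
    P [set w | forall i, B i (eta w (A i))] =
    \prod_(i < m) P [set w | B i (eta w (A i))].

Definition poisson_process : Prop :=
  poisson_marginals /\ independent_increments.

End poisson.

(* [eta^k_{<>}]: the [k]-tuples of pairwise distinct points of [xi]. *)
Definition distinct_tuples (R : realType) (d : measure_display)
    (X : measurableType d) (k : nat) (xi : point_measure R X) :
    set (k.-tuple X) :=
  [set t : k.-tuple X | uniq t /\ forall i, 0 < xi [set tnth t i]].

(* [esum] is only meaningful for nonnegative families, whence the splitting.
   For integrable [f], the sum over [distinct_tuples (eta w)] is absolutely
   convergent for almost all [w]. *)
Definition U_sum (R : realType) (d : measure_display) (X : measurableType d)
    (k : nat) (f : k.-tuple X -> R) (xi : point_measure R X) : \bar R :=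
  \esum_(t in distinct_tuples xi) (EFin \o f)^\+ t -
  \esum_(t in distinct_tuples xi) (EFin \o f)^\- t.

(* A finite family of boxes [B_1 x ... x B_n] with a value on each of them. *)
Record step_function (R : realType) (d : measure_display)
    (X : measurableType d) (n : nat) := StepFunction {
  step_size : nat;
  step_value : 'I_step_size -> R;
  step_side : 'I_step_size -> 'I_n -> set X }.

Section wiener_ito.
Context (R : realType) (dX dO : measure_display) (X : measurableType dX).
Context (Omega : measurableType dO).
Context (mu : {sigma_finite_measure set X -> \bar R}).
Context (P : probability Omega R) (eta : {RV P >-> point_measure R X}).

Definition box (n : nat) (B : 'I_n -> set X) : set (n.-tuple X) :=
  [set x | forall i, B i (tnth x i)].

Definition step_fun (n : nat) (s : step_function R X n) (x : n.-tuple X) : R :=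
  (\sum_(j < step_size s) step_value j * \1_(box (step_side j)) x)%R.

(* The sides have finite measure, so that [(eta - mu)(B_i)] makes sense. *)
Definition simple_step (n : nat) (s : step_function R X n) : Prop :=
  [/\ forall j i, measurable (step_side (s := s) j i) /\
        mu (step_side (s := s) j i) < +oo,
      trivIset setT (fun j => box (step_side (s := s) j)),
      forall (sigma : 'S_n) x, step_fun s (permute_tuple sigma x) = step_fun s x,
      forall x : n.-tuple X, ~~ uniq x -> step_fun s x = 0%R &
      step_fun s \in Lfun (power_measure mu n) 2%:E].

(* [fine] is harmless: almost surely [xi = eta w] is finite on the sides.
   For [n = 0] the product is empty, and the integral of [c] is [c]. *)
Definition step_integral (n : nat) (s : step_function R X n)
    (xi : point_measure R X) : R :=
  (\sum_(j < step_size s) step_value j *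
     \prod_(i < n) (fine (xi (step_side j i)) - fine (mu (step_side j i))))%R.

(* [I_n(g) = Y] almost surely: since [I_n] is an isometry up to [n!] on the
   simple functions, its extension is computed along any approximating
   sequence of simple functions. *)
Definition wiener_ito_integral (n : nat) (g : n.-tuple X -> R)
    (Y : Omega -> R) : Prop :=
  Y \in Lfun P 2%:E /\
  exists s : nat -> step_function R X n,
    [/\ forall m, simple_step (s m),
        L2_cvg (power_measure mu n) (fun m => EFin \o step_fun (s m))
          (EFin \o g) &
        L2_cvg P (fun m w => (step_integral (s m) (eta w))%:E) (EFin \o Y)].

Definition in_L2P (F : point_measure R X -> \bar R) : Prop :=
  measurable_fun setT F /\ \int[P]_w (`|F (eta w)| ^+ 2) < +oo.

Definition chaos_kernels (F : point_measure R X -> \bar R)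
    (g : forall i : nat, i.-tuple X -> R) : Prop :=
  [/\ forall i, in_Lps mu 2 (g i),
      \int[P]_w F (eta w) = (g 0%N [tuple])%:E &
      exists I : nat -> Omega -> R,
        (forall i, wiener_ito_integral (g i) (I i)) /\
        L2_cvg P (fun m w => (\sum_(i < m) I i w)%R%:E) (F \o eta)].

End wiener_ito.

(* The integral over [X^(k - i)] of [f(y_1, .., y_i, x_1, .., x_(k-i))] with
   respect to the last [k - i] variables. *)
Definition partial_integral (R : realType) (d : measure_display)
    (X : measurableType d) (mu : {sigma_finite_measure set X -> \bar R})
    (k : nat) (f : k.-tuple X -> R) (i : 'I_k.+1) (y : i.-tuple X) : \bar R :=
  \int[power_measure mu (k - i)]_x
    (f (tcast (subnKC (leq_ord i)) [tuple of y ++ x]))%:E.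

(* Main.v *)
From HB Require Import structures.
Require Import Defs.
From mathcomp Require Import all_boot all_order all_algebra all_fingroup.
From mathcomp Require Import all_classical all_reals all_analysis.
From mathcomp Require Import measurable_realfun ring lra.
Set Implicit Arguments.
Unset Strict Implicit.
Unset Printing Implicit Defensive.
Import Order.TTheory GRing.Theory Num.Theory.
Import numFieldNormedType.Exports.
Local Open Scope classical_set_scope.
Local Open Scope ring_scope.
Local Open Scope ereal_scope.

(* Write [T_n(h)] for the multiple integral of order [n] of a step function [h].
   For a symmetric step function [h] of order [k] vanishing on the diagonals,
   substituting [eta = (eta - mu) + mu] in each factor of the sum of [h] over
   the distinct points of [eta] gives the sum over [n <= k] of [T_n(h_n)], where
   [h_n] is ['C(k, n)] times the integral of [h] over the last [k - n] variables.
   The Poisson moments give the isometry for step functions and the estimates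
   [E |T_n(h)| <= 2 ^ n |h|_1] and [E |U(f) - U(h)| <= C |f - h|_1], the latter
   even under a weight [expR (eta B)]. Hence [E (F T_n(t)) = n! <f_n, t>] for all
   step functions [t], where [f_n] is the claimed kernel. As [F] is square
   integrable, testing against truncations of [f_n] shows that [f_n] is square
   integrable too, so its multiple integral exists, and the [L^1] estimates give
   [F = \sum_(n <= k) I_n(f_n)]. Uniqueness and the variance follow from the
   isometry and from orthogonality. *)

(** * Real-valued integrals *)

(** Approximating [f] by step functions in [L^1] gives no direct control of sums over points, and
    [U_sum f (eta w)] is not known to be measurable in [w]. The substitute for a multivariate Mecke
    formula is a countable majorant by boxes with pairwise disjoint sides ([cov]): it bounds the
    integral and the sum over distinct points at the same time, and density of step functions is
    proved in this stronger sense. Nonatomicity enters twice: the diagonals are null, and almost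
    surely [eta] has no multiple points in a set of finite mass, so that counts really are numbers
    of points. The exponential weight is needed because [f] is only integrable: [F - U(h)] is small
    only in [L^1], while the multiple integral that multiplies it is unbounded. Powers of counts are
    dominated by an exponential, under which Poisson counts remain Poisson. Square integrability of
    the kernels cannot be inherited from [f], which need not be square integrable; it has to come
    from [F] by duality. *)

Section real_integrals.
Context (R : realType) (d : measure_display) (T : measurableType d).
Context (m : {measure set T -> \bar R}).
Implicit Types f g : T -> R.

(** Reals instead of extended reals, so that [ring], [lra] and [nra] apply to integrals. As [rint]
    sends an infinite integral to 0, integrability is carried along separately. *)
Definition rintegrable f := m.-integrable setT (EFin \o f).
Definition rint f : R := Rintegral m setT f.

Lemma rintE f : rintegrable f -> \int[m]_x (f x)%:E = (rint f)%:E.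
Proof. by move=> fi; rewrite /rint /Rintegral fineK//; exact: integrable_fin_num. Qed.

Lemma rintegrable_meas f : rintegrable f -> measurable_fun setT f.
Proof. by move=> /integrableP[/measurable_EFinP]. Qed.

Lemma rintegrableP f : measurable_fun setT f ->
  \int[m]_x `|f x|%:E < +oo -> rintegrable f.
Proof. by move=> mf h; apply/integrableP; split => //; exact/measurable_EFinP. Qed.

Lemma rintegrable_lty f : rintegrable f -> \int[m]_x `|f x|%:E < +oo.
Proof. by move=> /integrableP[]. Qed.

Lemma rintegrable0 : rintegrable (fun=> 0%R).
Proof. exact: integrable0. Qed.

Lemma rint0 : rint (fun=> 0%R) = 0%R.
Proof. by rewrite /rint /Rintegral integral0. Qed.

Lemma rintegrableD f g : rintegrable f -> rintegrable g ->
  rintegrable (fun x => f x + g x)%R.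
Proof. by move=> fi gi; exact: (integrableD measurableT fi gi). Qed.

Lemma rintegrableB f g : rintegrable f -> rintegrable g ->
  rintegrable (fun x => f x - g x)%R.
Proof. by move=> fi gi; exact: (integrableB measurableT fi gi). Qed.

Lemma rintegrableZ c f : rintegrable f -> rintegrable (fun x => c * f x)%R.
Proof. by move=> fi; exact: (integrableZl measurableT c fi). Qed.

Lemma rintegrable_norm f : rintegrable f -> rintegrable (fun x => `|f x|)%R.
Proof. exact: integrable_norm. Qed.

Lemma rintD f g : rintegrable f -> rintegrable g ->
  rint (fun x => f x + g x)%R = (rint f + rint g)%R.
Proof. exact: RintegralD. Qed.

Lemma rintB f g : rintegrable f -> rintegrable g ->
  rint (fun x => f x - g x)%R = (rint f - rint g)%R.
Proof. exact: RintegralB. Qed.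

Lemma rintZ c f : rintegrable f -> rint (fun x => c * f x)%R = (c * rint f)%R.
Proof. by move=> fi; exact: RintegralZl. Qed.

Lemma eq_rint f g : f =1 g -> rint f = rint g.
Proof. by move=> fg; apply: eq_Rintegral => x _. Qed.

Lemma rint_ge0 f : (forall x, 0 <= f x)%R -> (0 <= rint f)%R.
Proof. by move=> f0; apply: Rintegral_ge0. Qed.

Lemma le_rint f g : rintegrable f -> rintegrable g -> (forall x, f x <= g x)%R ->
  (rint f <= rint g)%R.
Proof. by move=> fi gi fg; apply: le_Rintegral => // x _. Qed.

Lemma ler_norm_rint f : rintegrable f -> (`|rint f| <= rint (fun x => `|f x|))%R.
Proof. by move=> fi; exact: le_normr_Rintegral. Qed.

Lemma le_rintegrable f g : measurable_fun setT f -> rintegrable g ->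
  (forall x, `|f x| <= g x)%R -> rintegrable f.
Proof.
move=> mf gi fg; apply: (le_integrable _ _ _ gi) => //; first exact/measurable_EFinP.
by move=> x _ /=; rewrite lee_fin (le_trans (fg x))// ler_norm.
Qed.

Lemma rintegrable_sum (I : Type) (s : seq I) (a : I -> R) (F : I -> T -> R) :
  (forall i, rintegrable (F i)) ->
  rintegrable (fun x => \sum_(i <- s) a i * F i x)%R.
Proof.
move=> Fi; elim: s => [|i s IH].
  by apply: eq_integrable rintegrable0 => // x _ /=; rewrite big_nil.
apply: eq_integrable (rintegrableD (rintegrableZ (a i) (Fi i)) IH) => // x _ /=.
by rewrite big_cons.
Qed.

Lemma rint_sum (I : Type) (s : seq I) (a : I -> R) (F : I -> T -> R) :
  (forall i, rintegrable (F i)) ->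
  rint (fun x => \sum_(i <- s) a i * F i x)%R = (\sum_(i <- s) a i * rint (F i))%R.
Proof.
move=> Fi; elim: s => [|i s IH].
  by rewrite big_nil -[RHS]rint0; apply: eq_rint => x; rewrite big_nil.
rewrite big_cons -IH -rintZ// -rintD; [|exact: rintegrableZ|exact: rintegrable_sum].
by apply: eq_rint => x; rewrite big_cons.
Qed.

Lemma rintegrable_ae f g : measurable_fun setT g -> rintegrable f ->
  (\forall x \ae m, f x = g x) -> rintegrable g.
Proof.
move=> mg fi fg; have mf := rintegrable_meas fi.
apply: rintegrableP => //; apply: le_lt_trans (rintegrable_lty fi).
rewrite le_eqVlt; apply/orP; left; apply/eqP; apply: ge0_ae_eq_integral => //.
- by apply/measurable_EFinP; exact: measurableT_comp.
- by apply/measurable_EFinP; exact: measurableT_comp.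
- by apply: filterS fg => x /= -> _.
Qed.

Lemma rint_ae f g : measurable_fun setT f -> measurable_fun setT g ->
  (\forall x \ae m, f x = g x) -> rint f = rint g.
Proof.
move=> mf mg fg; rewrite /rint /Rintegral; congr fine; apply: ae_eq_integral => //.
- exact/measurable_EFinP.
- exact/measurable_EFinP.
- by apply: filterS fg => x /= -> _.
Qed.

End real_integrals.

(** * Powers of a measure *)

Section power.
Context (R : realType) (d : measure_display) (X : measurableType d).
Context (mu : {sigma_finite_measure set X -> \bar R}).

Lemma boxE n (B : 'I_n -> set X) :
  box B = \big[setI/setT]_(i < n) ((@tnth n X ^~ i) @^-1` B i).
Proof.
rewrite -bigcap_seq; apply/seteqP; split=> x /= h i; first by move=> _; exact: h.
by apply: h; rewrite /= mem_index_enum.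
Qed.

Lemma measurable_box n (B : 'I_n -> set X) :
  (forall i, measurable (B i)) -> measurable (box B).
Proof.
move=> mB; rewrite boxE; apply: bigsetI_measurable => i _.
by rewrite -[X in measurable X]setTI; exact: measurable_tnth.
Qed.

Lemma boxI n (A B : 'I_n -> set X) :
  box A `&` box B = box (fun i => A i `&` B i).
Proof.
apply/seteqP; split=> x; first by move=> [h1 h2] i; split.
by move=> h; split=> i; have [] := h i.
Qed.

Lemma indic_box n (B : 'I_n -> set X) (x : n.-tuple X) :
  \1_(box B) x = (\prod_(i < n) \1_(B i) (tnth x i))%R :> R.
Proof.
rewrite indicE; case: (pselect (box B x)) => h.
  rewrite mem_set// big1// => i _; rewrite indicE mem_set//; exact: h.
rewrite memNset//; have /existsNP[i hi] := h.
by rewrite (bigD1 i)//= indicE memNset// mul0r.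
Qed.

Lemma power_measure_box n (B : 'I_n -> set X) : (forall i, measurable (B i)) ->
  power_measure mu n (box B) = \prod_(i < n) mu (B i).
Proof.
elim: n B => [|n IH] B mB.
  rewrite big_ord0 /= diracE mem_set//.
  by move=> -[].
rewrite big_ord_recl /= /product_step /pushforward.
rewrite [X in (_ \x _) X](_ : _ = B ord0 `*` box (fun i => B (lift ord0 i))).
  rewrite product_measure1E//; last exact: measurable_box.
  by rewrite IH.
apply/seteqP; split=> -[x t] /=.
  move=> h; split; first by have := h ord0.
  move=> i; have := h (lift ord0 i).
  by rewrite /pair_cons tnthS.
move=> [h1 h2] i; case: (unliftP ord0 i) => [j ->|->]//.
by rewrite /pair_cons tnthS.
Qed.

(** Coordinate cylinders are boxes with all other sides equal to [setT]. Boxes are preferred as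
    generators because they are stable under intersection, as uniqueness of measures requires. *)
Lemma box_generates n : @measurable _ (n.-tuple X) =
  <<s [set A | exists2 B : 'I_n -> set X, (forall i, measurable (B i)) &
       A = box B] >>.
Proof.
apply/seteqP; split; last first.
  apply: smallest_sub; first exact: sigma_algebra_measurable.
  by move=> _ [B mB ->]; exact: measurable_box.
rewrite {1}/measurable/= /g_sigma_preimage; apply: smallest_sub.
  exact: smallest_sigma_algebra.
rewrite -bigcup_seq => _ [i /= _ [B mB <-]]; apply: sub_sigma_algebra.
exists (fun j => if j == i then B else setT).
  by move=> j; case: ifP.
rewrite setTI; apply/seteqP; split=> x /=.
  by move=> h j; case: eqP => // ->.
by move=> /(_ i); rewrite eqxx.
Qed.

(** Uniqueness on a stable generator, with the powers of an exhausting sequence of [mu] as sets of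
    finite mass. It yields invariance under permutations and compatibility with every splitting of
    the coordinates. *)
Lemma power_measure_unique n (m : {measure set (n.-tuple X) -> \bar R}) :
  (forall B : 'I_n -> set X, (forall i, measurable (B i)) ->
    m (box B) = \prod_(i < n) mu (B i)) ->
  forall A, measurable A -> m A = power_measure mu n A.
Proof.
move=> mE.
have /sigma_finiteP[E [TE ndE Eoo]] := sigma_finiteT mu.
have mEi i : measurable (E i) by have [] := Eoo i.
apply: (measure_unique _ (fun i => box (fun _ : 'I_n => E i)) (box_generates n)).
- move=> _ _ [A mA ->] [B mB ->]; exists (fun i => A i `&` B i).
    by move=> i; exact: measurableI.
  by rewrite boxI.
- by move=> i; exists (fun _ => E i).
- apply/seteqP; split=> // x _.
  have /choice[N hN] : forall i, exists N, E N (tnth x i).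
    move=> i; have : [set: X] (tnth x i) by [].
    by rewrite TE => -[N _ h]; exists N.
  (* The sequence [E] increases, so the largest index serves all coordinates. *)
  exists (\max_(i < n) N i)%N => // i.
  move: (tnth x i) (hN i); exact/subsetPset/ndE/leq_bigmax.
- by move=> _ [B mB ->]; rewrite mE//; apply/esym; exact: power_measure_box.
- move=> k; rewrite mE//.
  have -> : \prod_(i < n) mu (E k) = (\prod_(i < n) fine (mu (E k)))%:E.
    rewrite -prodEFin; apply: eq_bigr => i _; rewrite fineK// ge0_fin_numE//.
    by have [] := Eoo k.
  exact: ltry.
Qed.

Lemma measurable_permute n (s : 'S_n) :
  measurable_fun [set: n.-tuple X] (permute_tuple s).
Proof.
apply/measurable_fun_tnthP => i.
rewrite (_ : _ \o _ = @tnth n X ^~ (s i)); first exact: measurable_tnth.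
by apply/funext => x /=; rewrite tnth_mktuple.
Qed.

Lemma box_permute n (s : 'S_n) (B : 'I_n -> set X) :
  permute_tuple s @^-1` box B = box (fun i => B (s^-1%g i)).
Proof.
apply/seteqP; split=> x /= h i.
  by have := h (s^-1%g i); rewrite tnth_mktuple permKV.
by have := h (s i); rewrite tnth_mktuple permK.
Qed.

Lemma power_measure_permute n (s : 'S_n) A : measurable A ->
  power_measure mu n (permute_tuple s @^-1` A) = power_measure mu n A.
Proof.
pose m := pushforward (power_measure mu n) (permute_tuple s).
have mm := @measurable_permute n s.
pose m' := measure_function_pushforward__canonical__measure_function_Measure
  (power_measure mu n) mm.
have -> : power_measure mu n (permute_tuple s @^-1` A) = m' A by [].
apply: power_measure_unique => B mB; rewrite /m' /= /pushforward box_permute.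
rewrite power_measure_box//.
by rewrite [RHS](reindex_perm s^-1%g).
Qed.

(** The equation [e] is an argument because the splittings in use have the form [i + (k - i) = k],
    which is not a conversion; eliminating [e] reduces each proof to plain concatenation. *)
Definition cat_cast n m k (e : (n + m)%N = k)
  (z : n.-tuple X * m.-tuple X) : k.-tuple X := tcast e [tuple of z.1 ++ z.2].

Lemma cat_castE n m (z : n.-tuple X * m.-tuple X) :
  cat_cast erefl z = [tuple of z.1 ++ z.2].
Proof. by rewrite /cat_cast tcast_id. Qed.

Lemma tnth_cat n m (z : n.-tuple X * m.-tuple X) (i : 'I_(n + m)) :
  tnth [tuple of z.1 ++ z.2] i = match fintype.split i with
    | inl j => tnth z.1 j | inr j => tnth z.2 j end.
Proof.
by rewrite -{1}(splitK i); case: (fintype.split i) => j /=;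
  rewrite ?tnth_lshift ?tnth_rshift.
Qed.

Lemma measurable_cat_cast n m k (e : (n + m)%N = k) :
  measurable_fun [set: n.-tuple X * m.-tuple X] (cat_cast e).
Proof.
case: k / e; apply/measurable_fun_tnthP => i.
rewrite (_ : _ \o _ = fun z => match fintype.split i with
    | inl j => tnth z.1 j | inr j => tnth z.2 j end); last first.
  by apply/funext => z; exact: tnth_cat.
case: fintype.split => j.
  exact: (measurableT_comp (@measurable_tnth _ X n j)).
exact: (measurableT_comp (@measurable_tnth _ X m j)).
Qed.

(** [power_measure] peels off one coordinate at a time. Both sides agree on boxes, so
    [power_measure_unique] replaces an induction that would reassociate products. *)
Lemma power_measure_cat n m k (e : (n + m)%N = k) A : measurable A ->
  (power_measure mu n \x power_measure mu m) (cat_cast e @^-1` A) =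
  power_measure mu k A.
Proof.
case: k / e A => A mA.
pose m' := measure_function_pushforward__canonical__measure_function_Measure
  (power_measure mu n \x power_measure mu m) (@measurable_cat_cast n m _ erefl).
have -> : (power_measure mu n \x power_measure mu m)
  (cat_cast erefl @^-1` A) = m' A by [].
apply: power_measure_unique mA => B mB; rewrite /m' /= /pushforward.
rewrite [X in (_ \x _) X](_ : _ = box (fun i => B (lshift m i)) `*`
   box (fun i => B (rshift n i))).
  rewrite product_measure1E; [|exact: measurable_box..].
  by rewrite big_split_ord/= !power_measure_box.
apply/seteqP; split=> -[x y] /=.
  move=> h; split=> i.
    by have := h (lshift m i); rewrite tnth_lshift.
  by have := h (rshift n i); rewrite tnth_rshift.
move=> [h1 h2] i; rewrite -(splitK i).
by case: (fintype.split i) => j /=; rewrite ?tnth_lshift ?tnth_rshift; 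
  [exact: h1|exact: h2].
Qed.

Lemma ge0_integral_permute n (s : 'S_n) (f : n.-tuple X -> \bar R) :
  measurable_fun setT f -> (forall x, 0 <= f x) ->
  \int[power_measure mu n]_x f (permute_tuple s x) =
  \int[power_measure mu n]_x f x.
Proof.
move=> mf f0; rewrite -[LHS](@ge0_integral_pushforward _ _ _ _ _ _
  (@measurable_permute n s) (power_measure mu n) setT f)//.
apply: (@eq_measure_integral _ _ _ setT (power_measure mu n)
  (measure_function_pushforward__canonical__measure_function_Measure
    (power_measure mu n) (@measurable_permute n s))).
by move=> A mA _; exact: power_measure_permute.
Qed.

Lemma ge0_integral_cat n m k (e : (n + m)%N = k) (f : k.-tuple X -> \bar R) :
  measurable_fun setT f -> (forall x, 0 <= f x) ->
  \int[power_measure mu k]_x f x =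
  \int[power_measure mu n \x power_measure mu m]_z f (cat_cast e z).
Proof.
move=> mf f0; rewrite -[RHS](@ge0_integral_pushforward _ _ _ _ _ _
  (@measurable_cat_cast n m k e) _ setT f)//.
apply: (@eq_measure_integral _ _ _ setT
  (measure_function_pushforward__canonical__measure_function_Measure
    _ (@measurable_cat_cast n m k e)) (power_measure mu k)).
by move=> A mA _; apply/esym; exact: power_measure_cat.
Qed.

Lemma integral_cat n m k (e : (n + m)%N = k) (f : k.-tuple X -> \bar R) :
  (power_measure mu k).-integrable setT f ->
  (power_measure mu n \x power_measure mu m).-integrable setT
    (f \o cat_cast e) /\
  \int[power_measure mu k]_x f x =
  \int[power_measure mu n \x power_measure mu m]_z f (cat_cast e z).
Proof.
move=> /integrableP[mf foo].
have fi : (power_measure mu n \x power_measure mu m).-integrable setT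
    (f \o cat_cast e).
  apply/integrableP; split.
    by apply: measurableT_comp => //; exact: measurable_cat_cast.
  move: foo; rewrite (ge0_integral_cat e)//.
  exact: measurableT_comp.
split => //; rewrite -[RHS](@integral_pushforward _ _ _ _ _ _
  (@measurable_cat_cast n m k e) _ setT f)//.
apply: (@eq_measure_integral _ _ _ setT
  (measure_function_pushforward__canonical__measure_function_Measure
    _ (@measurable_cat_cast n m k e)) (power_measure mu k)).
by move=> A mA _; apply/esym; exact: power_measure_cat.
Qed.

End power.

(** * Counts of a Poisson process *)

Section poisson_counts.
Context (R : realType) (dX dO : measure_display) (X : measurableType dX).
Context (Omega : measurableType dO).
Context (mu : {sigma_finite_measure set X -> \bar R}).
Context (P : probability Omega R) (eta : {RV P >-> point_measure R X}).

(** [fine] sends an infinite count to 0. This is harmless for sets of finite mass, whose count is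
    almost surely finite ([count_nat_ae]). *)
Definition count_in (A : set X) (w : Omega) : R := fine (eta w A).
Local Notation num := count_in.

Lemma measurable_count (A : set X) : measurable A ->
  measurable_fun [set: Omega] (fun w => eta w A : \bar R).
Proof.
move=> mA; rewrite (_ : (fun w => _) =
  (fun xi : point_measure R X => xi A : \bar R) \o eta)//.
apply: measurableT_comp; last exact: measurable_funPT.
move=> _ B mB; apply: sub_sigma_algebra; exists A => //; exists B => //.
Qed.

Lemma measurable_num (A : set X) : measurable A ->
  measurable_fun [set: Omega] (num A).
Proof. by move=> mA; apply: measurableT_comp => //; exact: measurable_count. Qed.

Lemma integral_prob_cst (r : R) : \int[P]_w r%:E = r%:E.
Proof.
by have := @expectation_cst _ _ _ P r; rewrite unlock.
Qed.

Hypothesis eta_poisson : poisson_process mu eta.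

Definition pois (l : R) (n : nat) : R := (l ^+ n / n`!%:R * expR (- l))%R.

Lemma pois_ge0 l n : (0 <= l)%R -> (0 <= pois l n)%R.
Proof. by move=> l0; rewrite /pois !mulr_ge0// ?exprn_ge0// ?expR_ge0// invr_ge0. Qed.

(** [poisson_prob] is a Dirac mass at parameter 0; the formula for [pois] covers this case because
    [0 ^+ 0 = 1]. *)
Lemma poisson_prob1 l n : (0 <= l)%R ->
  poisson_prob l 0%N [set n] = (pois l n)%:E.
Proof.
move=> l0; rewrite /poisson_prob; case: ifPn => [lp|].
  by rewrite esum_set1 ?lee_fin ?poisson_pmf_ge0// /poisson_pmf lp.
rewrite -leNgt => l0'; have -> : l = 0%R by apply/eqP; rewrite eq_le l0 l0'.
rewrite diracE /pois oppr0 expR0 mulr1 expr0n.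
case: n => [|n]; first by rewrite mem_set//= divr1.
by rewrite memNset//= mul0r.
Qed.

Lemma pois_sum l : (0 <= l)%R -> \sum_(n <oo) (pois l n)%:E = 1.
Proof.
move=> l0; have := @probability_setT _ _ _ (poisson_prob l 0%N : probability nat R).
have -> : [set: nat] = \bigcup_n [set n].
  by apply/seteqP; split=> // n _; exists n.
rewrite measure_semi_bigcup//.
  by move=> <-; apply: eq_eseriesr => n _; exact/esym/poisson_prob1.
by apply/trivIsetP => i j _ _ ij; apply/seteqP; split=> // n [/= -> ji];
  rewrite ji eqxx in ij.
Qed.

Definition fmeas (A : set X) := measurable A /\ mu A < +oo.

Lemma fmeas_ge0 A : (0 <= fine (mu A))%R. Proof. exact: fine_ge0. Qed.

Lemma fmeasE A : fmeas A -> mu A = (fine (mu A))%:E.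
Proof. by move=> [mA Aoo]; rewrite fineK// ge0_fin_numE. Qed.

Lemma prob_count A n : fmeas A ->
  P [set w | eta w A = n%:R%:E] = (pois (fine (mu A)) n)%:E.
Proof.
move=> [mA Aoo]; have [h _] := eta_poisson.1 A mA.
by rewrite h// poisson_prob1// fmeas_ge0.
Qed.

Lemma measurable_count_eq A n : measurable A ->
  measurable [set w | eta w A = n%:R%:E].
Proof.
move=> mA; rewrite -[X in measurable X]setTI.
exact: (measurable_count mA measurableT (emeasurable_set1 n%:R%:E)).
Qed.

(** The Poisson weights sum to 1, so the disjoint events that the count equals [n] exhaust the
    probability. *)
Lemma count_nat_ae A : fmeas A -> \forall w \ae P, exists n, eta w A = n%:R%:E.
Proof.
move=> fA; pose E n := [set w | eta w A = n%:R%:E].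
have mE n : measurable (E n) by exact/measurable_count_eq/fA.1.
have mUE : measurable (\bigcup_n E n) by exact: bigcup_measurable.
exists (~` \bigcup_n E n); split.
- exact: measurableC.
- rewrite probability_setC// measure_semi_bigcup//; last first.
    apply/trivIsetP => i j _ _ /eqP ij; apply/seteqP; split=> // w [].
    by rewrite /E/= => -> [] /eqP; rewrite eqr_nat => /eqP.
  rewrite (eq_eseriesr (fun n _ => prob_count n fA)).
  by rewrite pois_sum ?fmeas_ge0// subee.
- by move=> w /=; apply: contra_not => -[n _ h]; exists n.
Qed.

Lemma num_nat_ae A : fmeas A ->
  \forall w \ae P, exists n, eta w A = n%:R%:E /\ num A w = n%:R.
Proof.
by move=> fA; apply: filterS (count_nat_ae fA) => w [n h]; exists n; rewrite /num h.
Qed.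

Lemma measurable_indic_num A (B : set R) : measurable A -> measurable B ->
  measurable_fun setT (fun w => \1_B (num A w) : R).
Proof.
move=> mA mB; have h := measurable_num mA.
have h2 : measurable_fun setT (\1_B : R -> R) by apply: measurable_indic.
apply: (measurableT_comp h2 h).
Qed.

(** Integration over the events that the count equals [n]. The extra factor [Z] allows one factor of
    a product to be expanded while the others stay untouched. *)
Lemma integral_num_series A (Z : Omega -> R) (phi : R -> R) : fmeas A ->
  measurable_fun setT Z -> (forall w, 0 <= Z w)%R ->
  measurable_fun setT phi -> (forall x, 0 <= phi x)%R ->
  \int[P]_w (phi (num A w) * Z w)%:E = \sum_(n <oo) (phi n%:R)%:E *
    \int[P]_w (\1_[set n%:R] (num A w) * Z w)%:E.
Proof.
move=> fA mZ Z0 mphi phi0.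
have mN := measurable_num fA.1.
have mI n : measurable_fun setT (fun w => \1_[set n%:R : R] (num A w) * Z w)%R.
  apply: measurable_funM => //; exact: measurable_indic_num fA.1 _.
transitivity (\sum_(n <oo) \int[P]_w ((phi n%:R)%:E *
    (\1_[set n%:R] (num A w) * Z w)%:E)); last first.
  apply: eq_eseriesr => n _; rewrite ge0_integralZl_EFin//.
    by move=> w _; rewrite lee_fin mulr_ge0.
  exact/measurable_EFinP.
rewrite -integral_nneseries//; last 2 first.
  by move=> n; apply/measurable_funeM/measurable_EFinP.
  by move=> n w _; rewrite mule_ge0// lee_fin// mulr_ge0.
apply: ge0_ae_eq_integral => //.
- by apply/measurable_EFinP; apply: measurable_funM => //; exact: measurableT_comp.
- apply: ge0_emeasurable_sum => //.
    by move=> n w _ _; rewrite mule_ge0// lee_fin// mulr_ge0.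
  by move=> n _; apply/measurable_funeM/measurable_EFinP.
- by move=> w _; rewrite lee_fin mulr_ge0.
- by move=> w _; apply: nneseries_ge0 => n _ _; rewrite mule_ge0// lee_fin// mulr_ge0.
- apply: filterS (num_nat_ae fA) => w [m [_ wm]] _.
  rewrite (@nneseriesD1 _ _ m)//; last first.
    by move=> n _; rewrite mule_ge0// lee_fin// mulr_ge0.
  rewrite eseries0 ?adde0; last first.
    move=> n _ /= nm; rewrite indicE memNset ?mul0r ?mule0//= wm => /eqP.
    by rewrite eqr_nat eq_sym (negPf nm).
  by rewrite indicE wm mem_set// mul1r EFinM.
Qed.

Lemma integral_num_eq A n : fmeas A ->
  \int[P]_w (\1_[set n%:R : R] (num A w))%:E = (pois (fine (mu A)) n)%:E.
Proof.
move=> fA; have mN := measurable_num fA.1.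
rewrite -prob_count// -[in RHS](setIT [set w | _]) -integral_indic//; last first.
  exact/measurable_count_eq/fA.1.
apply: ge0_ae_eq_integral => //.
- by apply/measurable_EFinP; exact: measurable_indic_num fA.1 _.
- by apply/measurable_EFinP; exact/measurable_indic/measurable_count_eq/fA.1.
- apply: filterS (num_nat_ae fA) => w [m [wm wm']] _; congr EFin.
  rewrite !indicE; congr ((nat_of_bool _)%:R); rewrite wm'.
  by apply/idP/idP; rewrite !inE/= wm => -[->].
Qed.

Lemma integral_num A (phi : R -> R) : fmeas A ->
  measurable_fun setT phi -> (forall x, 0 <= phi x)%R ->
  \int[P]_w (phi (num A w))%:E =
  \sum_(n <oo) (phi n%:R * pois (fine (mu A)) n)%:E.
Proof.
move=> fA mphi phi0.
under eq_integral => w _ do rewrite -(mulr1 (phi _)).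
rewrite (@integral_num_series A (cst 1%R))//.
apply: eq_eseriesr => n _; rewrite EFinM -integral_num_eq//.
by congr (_ * _); apply: eq_integral => w _; rewrite mulr1.
Qed.

Lemma pois_recl l n : (0 <= l)%R -> (n.+1%:R * pois l n.+1 = l * pois l n)%R.
Proof.
move=> l0; rewrite /pois exprS factS natrM.
have n0 : (n.+1%:R : R) != 0%R by rewrite pnatr_eq0.
have f0 : (n`!%:R : R) != 0%R by rewrite pnatr_eq0 -lt0n fact_gt0.
move: (n.+1%:R : R) n0 => N n0; by field; rewrite n0 f0.
Qed.

(* The Poisson case of Mecke's formula. *)
Lemma integral_num_shift A (phi : R -> R) : fmeas A ->
  measurable_fun setT phi -> (forall x, 0 <= phi x)%R ->
  \int[P]_w (`|num A w| * phi (num A w))%:E =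
  mu A * \int[P]_w (phi (num A w + 1)%R)%:E.
Proof.
move=> fA mphi phi0; have l0 := fmeas_ge0 A.
rewrite (@integral_num A (fun x => `|x| * phi x)%R)//; last 2 first.
- by apply: measurable_funM.
- by move=> x; rewrite mulr_ge0.
rewrite (@integral_num A (fun x => phi (x + 1)%R))//; last first.
  by apply: measurableT_comp => //; exact: measurable_funD.
rewrite nneseries_recl//; last first.
  by move=> n _; rewrite lee_fin mulr_ge0 ?pois_ge0// mulr_ge0.
rewrite normr0 !mul0r add0e -nneseries_addn; last first.
  by move=> n; rewrite lee_fin mulr_ge0 ?pois_ge0// mulr_ge0.
rewrite fmeasE// -nneseriesZl; last first.
  by move=> n _; rewrite lee_fin mulr_ge0 ?pois_ge0.
apply: eq_eseriesr => n _; rewrite -EFinM; congr EFin.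
rewrite addn1 normr_nat mulrAC pois_recl// -natr1.
by ring.
Qed.

Lemma integral_num1 A : fmeas A -> \int[P]_w (`|num A w|)%:E = mu A.
Proof.
move=> fA.
under eq_integral => w _ do rewrite -(mulr1 `|_|%R).
rewrite (@integral_num_shift A (cst 1%R))//.
by rewrite /= integral_prob_cst mule1.
Qed.

Lemma integral_num2 A : fmeas A ->
  \int[P]_w (`|num A w| ^+ 2)%:E = mu A + mu A * mu A.
Proof.
move=> fA; have mN := measurable_num fA.1.
under eq_integral => w _ do rewrite expr2.
rewrite (@integral_num_shift A (fun x => `|x|)%R)//.
suff -> : \int[P]_w `|num A w + 1|%:E = 1 + mu A.
  by rewrite ge0_muleDr// mule1.
rewrite -[in RHS](integral_num1 fA) -(integral_prob_cst 1) -ge0_integralD//; last first.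
  by apply/measurable_EFinP; exact: measurableT_comp.
apply: ge0_ae_eq_integral => //.
- apply/measurable_EFinP; apply: measurableT_comp => //.
  exact: measurable_funD.
- by apply/emeasurable_funD => //; apply/measurable_EFinP; exact: measurableT_comp.
- by move=> w _; rewrite lee_fin.
- apply: filterS (num_nat_ae fA) => w [m [_ ->]] _.
  by rewrite !ger0_norm ?addr_ge0// EFinD addeC.
Qed.

(** Multiplying the Poisson weights of parameter [l] by [expR n] gives those of parameter
    [l * expR 1], up to the constant [expR (l * (expR 1 - 1))]. *)
Lemma integral_expR_num A : fmeas A ->
  \int[P]_w (expR (num A w))%:E = (expR (fine (mu A) * (expR 1 - 1)))%:E.
Proof.
move=> fA; have l0 := fmeas_ge0 A.
rewrite (@integral_num A expR)//.
set l := fine _ in l0 *.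
transitivity (\sum_(n <oo) (expR (l * (expR 1 - 1)))%:E * (pois (l * expR 1) n)%:E).
  apply: eq_eseriesr => n _; rewrite -EFinM; congr EFin.
  rewrite /pois exprMn -expRM_natl mulr1 mulrBr mulr1 expRD (expRN (l * _)).
  have e0 : (expR (l * expR 1) != 0 :> R)%R by rewrite gt_eqF ?expR_gt0.
  have f0 : (n`!%:R : R) != 0%R by rewrite pnatr_eq0 -lt0n fact_gt0.
  by field; rewrite e0 f0.
rewrite nneseriesZl ?pois_sum ?mule1// ?mulr_ge0 ?expR_ge0//.
by move=> n _; rewrite lee_fin pois_ge0// mulr_ge0 ?expR_ge0.
Qed.

Section disjoint_family.
Context (K : finType) (C : K -> set X).
Hypothesis fC : forall c, fmeas (C c).
Hypothesis tC : trivIset setT C.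

Lemma prod_indic_num (B : K -> set R) w :
  (\prod_c \1_(B c) (num (C c) w) = \1_[set w | forall c, B c (num (C c) w)] w :> R)%R.
Proof.
rewrite indicE; case: (pselect (forall c, B c (num (C c) w))) => h.
  rewrite mem_set// big1// => i _; rewrite indicE mem_set//; exact: h.
rewrite memNset//; have /existsNP[i hi] := h.
by rewrite (bigD1 i)//= indicE memNset// mul0r.
Qed.

Lemma integral_prod_indic (B : K -> set R) : (forall c, measurable (B c)) ->
  \int[P]_w (\prod_c \1_(B c) (num (C c) w))%:E =
  \prod_c \int[P]_w (\1_(B c) (num (C c) w))%:E.
Proof.
move=> mB.
have mE c : measurable [set w | B c (num (C c) w)].
  by rewrite -[X in measurable X]setTI; exact: (measurable_num (fC c).1).
have intE E : measurable E -> \int[P]_w (\1_E w)%:E = P E.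
  by move=> mE'; rewrite integral_indic// setIT.
transitivity (P [set w | forall c, B c (num (C c) w)]).
  rewrite -intE; last first.
    rewrite [X in measurable X](_ : _ = \big[setI/setT]_c [set w | B c (num (C c) w)]).
      by apply: bigsetI_measurable.
    rewrite -bigcap_seq; apply/seteqP; split=> w /= h c; first by move=> _; exact: h.
    by apply: h; rewrite /= mem_index_enum.
  by apply: eq_integral => w _; rewrite prod_indic_num.
pose A (i : 'I_#|K|) := C (enum_val i).
pose D (i : 'I_#|K|) : set (\bar R) := fine @^-1` B (enum_val i).
have mD i : measurable (D i).
  by rewrite -[X in measurable X]setTI; apply: fine_measurable.
have := eta_poisson.2 _ A D (fun i => (fC (enum_val i)).1) _ mD.
have tA : trivIset setT A.
  apply/trivIsetP => i j _ _ ij; move/trivIsetP : tC; apply => //.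
  by apply: contra ij => /eqP /enum_val_inj ->.
move=> /(_ tA) h; rewrite (reindex (@enum_val K (mem K)))/=; last first.
  by exists enum_rank => x _; rewrite ?enum_valK ?enum_rankK.
transitivity (P [set w | forall i, D i (eta w (A i))]).
  congr (P _); apply/seteqP; split=> w /= hw c; first exact: hw.
  by have := hw (enum_rank c); rewrite /D/A/= enum_rankK.
rewrite h; apply: eq_bigr => i _; rewrite -intE; last exact: mE.
by apply: eq_integral.
Qed.

(** Independence is given for events only, hence for indicators. The list [s] in the induction
    contains the indices whose factor may still be arbitrary; one step expands such a factor over
    the values of its count and leaves indicators of single values. *)
Lemma integral_prod_num (phi : K -> R -> R) :
  (forall c, measurable_fun setT (phi c)) -> (forall c x, 0 <= phi c x)%R ->
  (forall c, \int[P]_w (phi c (num (C c) w))%:E < +oo) ->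
  \int[P]_w (\prod_c phi c (num (C c) w))%:E =
  \prod_c \int[P]_w (phi c (num (C c) w))%:E.
Proof.
have H (s : seq K) : forall phi : K -> R -> R,
    (forall c, measurable_fun setT (phi c)) -> (forall c x, 0 <= phi c x)%R ->
    (forall c, \int[P]_w (phi c (num (C c) w))%:E < +oo) ->
    (forall c, c \notin s -> exists2 B, measurable B & phi c = \1_B) ->
  \int[P]_w (\prod_c phi c (num (C c) w))%:E =
  \prod_c \int[P]_w (phi c (num (C c) w))%:E.
  elim: s => [|c0 s IH] {}phi mphi phi0 phioo phi1.
    have /choice[B hB] : forall c, exists B, measurable B /\ phi c = \1_B.
      by move=> c; have [//|B mB e] := phi1 c; exists B.
    have phiE c : phi c = \1_(B c) by have [] := hB c.
    under eq_integral => w _.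
      under eq_bigr => c _ do rewrite phiE.
      over.
    rewrite integral_prod_indic; last by move=> c; have [] := hB c.
    by apply: eq_bigr => c _; rewrite phiE.
  pose phin n c := if c == c0 then (\1_[set n%:R] : R -> R) else phi c.
  have IHn n := IH (phin n).
  have mnum c : measurable_fun setT (fun w => phi c (num (C c) w)).
    by apply: measurableT_comp => //; exact: (measurable_num (fC c).1).
  under eq_integral => w _ do rewrite (bigD1 c0)//=.
  rewrite (@integral_num_series _ (fun w => \prod_(i | i != c0) phi i (num (C i) w))%R)//;
    last 2 first.
  - rewrite (_ : (fun w => _) = (fun w =>
        \prod_(i <- [seq i <- index_enum K | i != c0]) phi i (num (C i) w))%R).
      by apply: measurable_prod => c _.
    by apply/funext => w; rewrite big_filter.
  - by move=> w; apply: prodr_ge0.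
  rewrite (bigD1 c0)//=.
  set q := \prod_(i | i != c0) _.
  have qfin : q \is a fin_num.
    by apply: prode_fin_num => c _; rewrite ge0_fin_numE// integral_ge0// => w _; rewrite lee_fin.
  have step n : \int[P]_w (\1_[set n%:R] (num (C c0) w) *
      \prod_(i | i != c0) phi i (num (C i) w))%:E =
      (pois (fine (mu (C c0))) n)%:E * q.
    have := IHn n; rewrite (bigD1 c0)//= => IHn'.
    transitivity (\int[P]_w (\prod_c phin n c (num (C c) w))%:E).
      apply: eq_integral => w _; rewrite [in RHS](bigD1 c0)//= {1}/phin eqxx.
      by congr ((_ * _)%R%:E); apply: eq_bigr => i /negPf ic; rewrite /phin ic.
    rewrite IHn'; last 4 first.
    - by move=> c; rewrite /phin; case: ifP => // _; apply: measurable_indic.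
    - by move=> c x; rewrite /phin; case: ifP.
    - move=> c; rewrite /phin; case: ifP => // /eqP ->.
      by rewrite integral_num_eq// ltry.
    - move=> c cs; rewrite /phin; case: ifP => [_|/negbT cc0].
        by exists [set n%:R].
      by apply: phi1; rewrite inE negb_or cc0.
    rewrite {1}/phin eqxx integral_num_eq//; congr (_ * _).
    by apply: eq_bigr => i /negPf ic; rewrite /phin ic.
  rewrite (eq_eseriesr (fun n _ => congr1 (fun z => (phi c0 n%:R)%:E * z) (step n))).
  rewrite integral_num// -(fineK qfin) muleC -nneseriesZl; last first.
    by move=> n _; rewrite lee_fin mulr_ge0 ?pois_ge0 ?fmeas_ge0.
  by apply: eq_eseriesr => n _; rewrite muleA muleC EFinM.
move=> mphi phi0 phioo; apply: (H (enum K)) => // c.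
by rewrite mem_enum.
Qed.

Lemma rint_prod_num (phi : K -> R -> R) :
  (forall c, measurable_fun setT (phi c)) ->
  (forall c, rintegrable P (fun w => phi c (num (C c) w))) ->
  rintegrable P (fun w => \prod_c phi c (num (C c) w))%R /\
  rint P (fun w => \prod_c phi c (num (C c) w))%R =
  (\prod_c rint P (fun w => phi c (num (C c) w)))%R.
Proof.
move=> mphi iphi.
have pos (psi : K -> R -> R) : (forall c, measurable_fun setT (psi c)) ->
    (forall c x, 0 <= psi c x)%R ->
    (forall c, rintegrable P (fun w => psi c (num (C c) w))) ->
    rintegrable P (fun w => \prod_c psi c (num (C c) w))%R /\
    rint P (fun w => \prod_c psi c (num (C c) w))%R =
    (\prod_c rint P (fun w => psi c (num (C c) w)))%R.
  move=> mpsi psi0 ipsi.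
  have h : \int[P]_w (\prod_c psi c (num (C c) w))%:E =
      (\prod_c rint P (fun w => psi c (num (C c) w)))%:E.
    rewrite integral_prod_num//.
      by rewrite -prodEFin; apply: eq_bigr => c _; rewrite rintE.
    by move=> c; rewrite rintE// ltry.
  split; last by rewrite [LHS]/rint /Rintegral h.
  apply: rintegrableP; first by apply: measurable_prod => c _; exact: rintegrable_meas.
  under eq_integral => w _ do rewrite ger0_norm ?prodr_ge0//.
  by rewrite h ltry.
(* Each factor is split into positive and negative part; distributing the product gives one term for
   each set [J] of indices that take the positive part, with sign [a J]. *)
pose s (b : bool) (x : R) := Num.max (if b then x else - x)%R 0%R.
have sE x : (x = s true x - s false x)%R.
  rewrite /s /Num.max; case: ltgtP => [x0|x0|->]; case: ltgtP => //; lra.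
have ms b c : measurable_fun setT (fun x => s b (phi c x)).
  by apply: measurable_maxr => //; case: b => //; exact: measurableT_comp.
have is' b c : rintegrable P (fun w => s b (phi c (num (C c) w))).
  apply: (le_rintegrable _ (rintegrable_norm (iphi c))) => [|w].
    apply: (measurableT_comp (ms b c)); exact: (measurable_num (fC c).1).
  rewrite /s; case: b; rewrite /Num.max; case: ltP => h; rewrite ?normr0//.
  by rewrite normrN.
pose psi (J : {set K}) c x := s (c \in J) (phi c x).
have psiP J := pos (psi J) (fun c => ms _ c) (fun c x => _) (fun c => is' _ c).
have {}psiP := psiP (fun J c x => ltac:(rewrite /psi/s le_max lexx orbT//)).
pose a (J : {set K}) := (\prod_c if c \in J then 1 else -1 : R)%R.
have E w : (\prod_c phi c (num (C c) w) =
    \sum_(J <- enum {set K}) a J * \prod_c psi J c (num (C c) w))%R.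
  under eq_bigr => c _ do rewrite [phi _ _]sE.
  rewrite bigA_distr big_enum/=; apply: eq_bigr => J _.
  rewrite /a -big_split/=; apply: eq_bigr => c _; rewrite /psi.
  by case: ifP => _; rewrite ?mul1r// mulN1r.
have -> : (fun w => \prod_c phi c (num (C c) w))%R = 
   (fun w => \sum_(J <- enum {set K}) a J * \prod_c psi J c (num (C c) w))%R.
  by apply/funext.
split; first by apply: rintegrable_sum => J; have [] := psiP J.
rewrite rint_sum; last by move=> J; have [] := psiP J.
transitivity (\prod_c (rint P (fun w => s true (phi c (num (C c) w))) -
   rint P (fun w => s false (phi c (num (C c) w)))))%R.
  rewrite bigA_distr big_enum/=; apply: eq_bigr => J _.
  have [_ ->] := psiP J.
  rewrite /a -big_split/=; apply: eq_bigr => c _; rewrite /psi.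
  by case: ifP => _; rewrite ?mul1r// mulN1r.
apply: eq_bigr => c _; rewrite -rintB//; apply: eq_rint => w.
by rewrite -sE.
Qed.

End disjoint_family.

End poisson_counts.

(** * Step functions *)

Section boxes.
Context (R : realType) (dX : measure_display) (X : measurableType dX).
Context (mu : {sigma_finite_measure set X -> \bar R}).
Local Notation fmeas := (fmeas mu).

(* A weighted box; a list of them stands for the sum [ev] of its indicators. *)
Definition bx (n : nat) := (R * ('I_n -> set X))%type.

Definition ev n (s : seq (bx n)) (x : n.-tuple X) : R :=
  (\sum_(b <- s) b.1 * \1_(box b.2) x)%R.

(* With [z i B] the indicator of [B] at the [i]-th point this is [ev]; with counts
   it is the sum of [ev s] over the points of [eta], if [ev s] vanishes on the
   diagonals; with centered counts, the multiple integral of [ev s]. *)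
Definition Zint n (z : 'I_n -> set X -> R) (s : seq (bx n)) : R :=
  (\sum_(b <- s) b.1 * \prod_(i < n) z i (b.2 i))%R.

Definition fsides n (s : seq (bx n)) := forall b, b \in s -> forall i, fmeas (b.2 i).

Definition offdiag n (g : n.-tuple X -> R) :=
  forall x : n.-tuple X, ~~ uniq x -> g x = 0%R.

Definition symfun n (g : n.-tuple X -> R) :=
  forall (sigma : 'S_n) x, g (permute_tuple sigma x) = g x.

Lemma ev_Zint n (s : seq (bx n)) x :
  ev s x = Zint (fun i B => \1_B (tnth x i)) s.
Proof. by apply: eq_bigr => b _; rewrite indic_box. Qed.

Lemma ev_cat n (s t : seq (bx n)) x : ev (s ++ t) x = (ev s x + ev t x)%R.
Proof. by rewrite /ev big_cat. Qed.

Lemma Zint_cat n z (s t : seq (bx n)) : Zint z (s ++ t) = (Zint z s + Zint z t)%R.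
Proof. by rewrite /Zint big_cat. Qed.

Definition scale_bx n (a : R) (s : seq (bx n)) := [seq ((a * b.1)%R, b.2) | b <- s].

Lemma ev_scale n a (s : seq (bx n)) x : ev (scale_bx a s) x = (a * ev s x)%R.
Proof. by rewrite /ev big_map mulr_sumr; apply: eq_bigr => b _; rewrite mulrA. Qed.

Lemma Zint_scale n z a (s : seq (bx n)) : Zint z (scale_bx a s) = (a * Zint z s)%R.
Proof. by rewrite /Zint big_map mulr_sumr; apply: eq_bigr => b _; rewrite mulrA. Qed.

Lemma fsides_cat n (s t : seq (bx n)) : fsides s -> fsides t -> fsides (s ++ t).
Proof. by move=> hs ht b; rewrite mem_cat => /orP[/hs|/ht]. Qed.

Lemma fsides_scale n a (s : seq (bx n)) : fsides s -> fsides (scale_bx a s).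
Proof. by move=> hs b /mapP[b' /hs h ->]. Qed.

Section atoms.
Context (K : finType) (C : K -> set X).

(** A pointwise form of being a union of some of the [C c]; [adaptedE] recovers the union. *)
Definition adapted (B : set X) := forall x, B x -> exists c, C c x /\ C c `<=` B.

(** Unrelated to [nonatomic]: the [C c] play the role of the atoms of a finite algebra of sets, and
    may be empty. *)
Definition atomic := (forall c, fmeas (C c)) /\ trivIset setT C.

Hypothesis aC : atomic.

Lemma atom_inj x c c' : C c x -> C c' x -> c = c'.
Proof.
move=> h h'; apply/eqP; case: (eqVneq c c') => // cc'.
have /trivIsetP/(_ c c' I I cc') := aC.2.
by move=> /seteqP[/(_ x)]; rewrite /= => /(_ (conj h h')).
Qed.

Lemma adaptedE B : adapted B ->
  B = \bigcup_c (if `[< C c `<=` B >] then C c else set0).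
Proof.
move=> aB; apply/seteqP; split=> x.
  by move=> /aB[c [cx cB]]; exists c => //; case: asboolP.
by move=> [c _]; case: asboolP => // + cx; exact.
Qed.

(** Stated for any measure, since it is applied to [mu] and to the realizations [eta w]. *)
Lemma fine_measure_adapted (m : {measure set X -> \bar R}) B :
  (forall c, m (C c) < +oo) -> adapted B ->
  fine (m B) = (\sum_(c | `[< C c `<=` B >]) fine (m (C c)))%R.
Proof.
move=> moo aB; rewrite {1}(adaptedE aB) measure_fin_bigcup//; last 3 first.
- exact: finite_finset.
- apply/trivIsetP => i j _ _ ij; case: ifP => _; last by rewrite set0I.
  case: ifP => _; last by rewrite setI0.
  by move/trivIsetP : aC.2; exact.
- by move=> c _; case: ifP => // _; exact: (aC.1 c).1.
have -> : [set: K] = [set` enum K].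
  by apply/seteqP; split=> c //= _; rewrite mem_enum.
rewrite -fsbig_seq ?enum_uniq// big_enum [X in fine X](_ : _ =
   (\sum_(c | `[< C c `<=` B >]) fine (m (C c)))%:E)//.
rewrite -sumEFin [RHS]big_mkcond; apply: eq_bigr => c _.
case: ifP => _; last by rewrite measure0.
by rewrite fineK// ge0_fin_numE.
Qed.

Context (n : nat).
Implicit Types (g : n.-tuple X -> R) (j : {ffun 'I_n -> K}).

Definition cell j : set (n.-tuple X) := box (fun i => C (j i)).

Definition pt j : n.-tuple X := [tuple xget point (C (j i)) | i < n].

(** The value is read at a sample point of the cell. If some side is empty, [xget] returns a default
    outside the cell, hence the test. *)
Definition coef g j : R :=
  if [forall i, `[< C (j i) !=set0 >]] then g (pt j) else 0%R.

Definition simple_on g :=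
  (forall j x y, cell j x -> cell j y -> g x = g y) /\
  (forall x, (forall j, ~ cell j x) -> g x = 0%R).

Definition aseq (a : {ffun 'I_n -> K} -> R) : seq (bx n) :=
  [seq (a j, fun i => C (j i)) | j <- enum {ffun 'I_n -> K}].

Lemma cell_pt j : [forall i, `[< C (j i) !=set0 >]] -> cell j (pt j).
Proof.
move=> /forallP h i; rewrite tnth_mktuple; have /asboolP[x cx] := h i.
exact: xgetI cx.
Qed.

Lemma cell_nonempty j x : cell j x -> [forall i, `[< C (j i) !=set0 >]].
Proof. by move=> h; apply/forallP => i; apply/asboolP; exists (tnth x i). Qed.

Lemma cell_inj j j' x : cell j x -> cell j' x -> j = j'.
Proof. by move=> h h'; apply/ffunP => i; exact: atom_inj (h i) (h' i). Qed.

Lemma coef_at g j x : simple_on g -> cell j x -> coef g j = g x.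
Proof.
move=> [h _] jx; have ne := cell_nonempty jx.
by rewrite /coef ne; apply: (h j) => //; exact: cell_pt.
Qed.

Lemma ev_aseq a x : ev (aseq a) x = (\sum_j a j * \1_(cell j) x)%R.
Proof. by rewrite /ev big_map big_enum. Qed.

Lemma Zint_aseq z a : Zint z (aseq a) = (\sum_j a j * \prod_i z i (C (j i)))%R.
Proof. by rewrite /Zint big_map big_enum. Qed.

Lemma simple_onE g x : simple_on g -> g x = ev (aseq (coef g)) x.
Proof.
move=> sg; rewrite ev_aseq; case: (pselect (exists j, cell j x)) => [[j jx]|nj].
  rewrite (bigD1 j)//= indicE mem_set// mulr1 (coef_at sg jx) big1 ?addr0// => j' jj'.
  rewrite indicE memNset ?mulr0// => j'x.
  by move: jj'; rewrite (cell_inj j'x jx) eqxx.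
rewrite sg.2 => [|j jx]; last by apply: nj; exists j.
by rewrite big1// => j _; rewrite indicE memNset ?mulr0// => jx; apply: nj; exists j.
Qed.

Lemma fsides_aseq a : fsides (aseq a).
Proof. by move=> b /mapP[j _ ->] i; exact: aC.1. Qed.

Section adapted_sides.
Context (s : seq (bx n)).
Hypothesis sC : forall b, b \in s -> forall i, adapted (b.2 i).

Lemma simple_on_ev : simple_on (ev s).
Proof.
have key b i j x : b \in s -> cell j x -> (b.2 i (tnth x i) <-> C (j i) `<=` b.2 i).
  move=> bs jx; split=> [/(sC bs)[c [cx cb]]|h]; last exact/h/jx.
  by rewrite (atom_inj (jx i) cx).
split=> [j x y jx jy|x h].
  rewrite !ev_Zint; apply: eq_big_seq => b bs; congr (_ * _)%R.
  apply: eq_bigr => i _; rewrite !indicE; congr ((nat_of_bool _)%:R).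
  by apply/idP/idP; rewrite !inE; move=> /(key b i _ _ bs) hh; apply/(key b i j _ bs) => //;
    [exact: (hh _ jx)|exact: (hh _ jy)].
rewrite /ev big1_seq// => b /= bs.
case: (pselect (box b.2 x)) => bx; last by rewrite indicE memNset// mulr0.
exfalso.
have /choice[j hj] : forall i, exists c, C c (tnth x i).
  by move=> i; have [c [cx _]] := sC bs (bx i); exists c.
by apply: (h [ffun i => j i]) => i; rewrite ffunE.
Qed.

(* Finite additivity of [z] turns a sum over boxes into a sum over cells. *)
Lemma Zint_atoms (z : 'I_n -> set X -> R) : (forall i, z i set0 = 0%R) ->
  (forall b, b \in s -> forall i,
    z i (b.2 i) = (\sum_(c | `[< C c `<=` b.2 i >]) z i (C c))%R) ->
  Zint z s = Zint z (aseq (coef (ev s))).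
Proof.
move=> z0 zadd.
(* [a0 j] adds the weights of the boxes of [s] that contain the cell [j] side by side. It agrees
   with [coef] on nonempty cells; on the others the product of the [z i (C (j i))] vanishes by
   [z0]. *)
pose a0 j := (\sum_(b <- s) b.1 * \prod_i (`[< C (j i) `<=` b.2 i >])%:R)%R : R.
transitivity (\sum_j a0 j * \prod_i z i (C (j i)))%R.
  under [RHS]eq_bigr => j _ do rewrite mulr_suml.
  rewrite exchange_big/=; apply: eq_big_seq => b bs.
  have -> : (\prod_(i < n) z i (b.2 i) = \prod_(i < n) \sum_c
      if `[< C c `<=` b.2 i >] then z i (C c) else 0)%R.
    by apply: eq_bigr => i _; rewrite -big_mkcond; exact: (zadd b bs i).
  rewrite bigA_distr_bigA/= mulr_sumr; apply: eq_bigr => j _.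
  rewrite -mulrA -big_split/=; congr (_ * _)%R; apply: eq_bigr => i _.
  by case: ifP => _; rewrite ?mul1r// mul0r.
rewrite Zint_aseq; apply: eq_bigr => j _.
rewrite /coef; case: ifPn => [ne|]; last first.
  rewrite negb_forall => /existsP[i /asboolP Ci].
  have C0 : C (j i) = set0.
    by apply/seteqP; split=> x // cx; apply: Ci; exists x.
  by rewrite mul0r (bigD1 i)//= C0 z0 mul0r mulr0.
congr (_ * _)%R; rewrite ev_Zint; apply: eq_big_seq => b bs; congr (_ * _)%R.
apply: eq_bigr => i _; rewrite indicE; congr ((nat_of_bool _)%:R).
have jp := cell_pt ne i.
apply/asboolP/idP; rewrite inE; first by move=> /(_ _ jp).
by move=> /(sC bs)[c [cx cb]]; rewrite (atom_inj jp cx).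
Qed.

End adapted_sides.
End atoms.

(** The cells of the Venn diagram of the family: a point is classified by the members that contain
    it. The index of the outer region is sent to the empty set, as the outside may have infinite
    mass. *)
Lemma exists_atoms (Bs : seq (set X)) : (forall B, B \in Bs -> fmeas B) ->
  exists (K : finType) (C : K -> set X),
    atomic C /\ forall B, B \in Bs -> adapted C B.
Proof.
move=> fB; pose N := size Bs; pose B (q : 'I_N) := nth set0 Bs q.
have fBq q : fmeas (B q) by apply: fB; rewrite mem_nth.
pose C (c : {set 'I_N}) : set X := if c == finset.set0 then set0 else
  [set x | forall q, (q \in c) = `[< B q x >]].
exists {set 'I_N}, C; split; [split|].
- move=> c; rewrite /C; case: eqVneq => [_|/finset.set0Pn[q qc]].
    by split => //; rewrite measure0.
  have mC : measurable [set x | forall q, (q \in c) = `[< B q x >]].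
    rewrite [X in measurable X](_ : _ = \big[setI/setT]_q
        (if q \in c then B q else ~` B q)).
      apply: bigsetI_measurable => i _; case: ifP => _; first exact: (fBq i).1.
      exact/measurableC/(fBq i).1.
    rewrite -bigcap_seq; apply/seteqP; split=> x /= h i.
      by move=> _; rewrite h; case: asboolP.
    have /= := h i; rewrite mem_index_enum => /(_ isT).
    by case: ifP => _ ?; [rewrite asboolT|rewrite asboolF].
  split => //; apply: le_lt_trans (fBq q).2; apply: le_measure.
  + by rewrite inE.
  + by rewrite inE; exact: (fBq q).1.
  + by move=> x /= /(_ q); rewrite qc => /esym/asboolP.
- apply/trivIsetP => c c' _ _ cc'; apply/seteqP; split=> // x [].
  rewrite /C; case: eqVneq => // _; case: eqVneq => // _ /= h h'.
  by move: cc' => /eqP; apply; apply/setP => q; rewrite h h'.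
- move=> B0 B0s x B0x.
  have [q qE] : exists q, B0 = B q.
    have lt : (index B0 Bs < N)%N by rewrite index_mem.
    by exists (Ordinal lt); rewrite /B/= nth_index.
  pose c := [set q' : 'I_N | `[< B q' x >]]%SET.
  have cq : q \in c by rewrite finset.inE; apply/asboolP; rewrite -qE.
  have c0 : (c == finset.set0) = false.
    by apply/negbTE/finset.set0Pn; exists q.
  exists c; rewrite /C c0; split=> [q'|y /= /(_ q)]; first by rewrite finset.inE.
  by rewrite cq qE => /esym/asboolP.
Qed.

Definition sides n (s : seq (bx n)) : seq (set X) :=
  flatten [seq [seq b.2 i | i <- enum 'I_n] | b <- s].

Lemma mem_sides n (s : seq (bx n)) B :
  B \in sides s <-> exists2 b, b \in s & exists i, B = b.2 i.
Proof.
split=> [/flattenP[l /mapP[b bs ->] /mapP[i _ ->]]|[b bs [i ->]]].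
  by exists b => //; exists i.
apply/flattenP; exists [seq b.2 i | i <- enum 'I_n]; first exact: map_f.
by apply: map_f; rewrite mem_enum.
Qed.

Lemma exists_atoms_seq n (s : seq (bx n)) : fsides s ->
  exists (K : finType) (C : K -> set X), atomic C /\
    forall b, b \in s -> forall i, adapted C (b.2 i).
Proof.
move=> fs; have [|K [C [aC h]]] := @exists_atoms (sides s).
  by move=> B /mem_sides[b bs [i ->]]; exact: fs.
by exists K, C; split=> // b bs i; apply: h; apply/mem_sides; exists b => //; exists i.
Qed.

Lemma exists_atoms_seq2 n m (s : seq (bx n)) (t : seq (bx m)) :
  fsides s -> fsides t ->
  exists (K : finType) (C : K -> set X), [/\ atomic C,
    forall b, b \in s -> forall i, adapted C (b.2 i) &
    forall b, b \in t -> forall i, adapted C (b.2 i)].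
Proof.
move=> fs ft; have [|K [C [aC h]]] := @exists_atoms (sides s ++ sides t).
  by move=> B; rewrite mem_cat => /orP[] /mem_sides[b bs [i ->]]; [exact: fs|exact: ft].
exists K, C; split=> // b bs i; apply: h; rewrite mem_cat; apply/orP.
  by left; apply/mem_sides; exists b => //; exists i.
by right; apply/mem_sides; exists b => //; exists i.
Qed.

End boxes.

(** * Multiple integrals of step functions *)

Section isometry.
Context (R : realType) (dX dO : measure_display) (X : measurableType dX).
Context (Omega : measurableType dO).
Context (mu : {sigma_finite_measure set X -> \bar R}).
Context (P : probability Omega R) (eta : {RV P >-> point_measure R X}).
Hypothesis eta_poisson : poisson_process mu eta.
Local Notation fmeas := (fmeas mu).
Local Notation num := (count_in eta).

Definition ccount (A : set X) (w : Omega) : R := (num A w - fine (mu A))%R.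
Local Notation cnum := ccount.

(* The multiple integral of [ev s], and the sum of [ev s] over the points of [eta]. *)
Definition step_chaos n (s : seq (bx R X n)) (w : Omega) : R := Zint (fun _ B => cnum B w) s.
Local Notation TI := step_chaos.

Definition step_count n (s : seq (bx R X n)) (w : Omega) : R := Zint (fun _ B => num B w) s.
Local Notation UI := step_count.

Lemma count_fin_ae (K : finType) (C : K -> set X) : (forall c, fmeas (C c)) ->
  \forall w \ae P, forall c, eta w (C c) < +oo.
Proof.
move=> fC; apply: filter_forall => c.
by apply: filterS (count_nat_ae eta_poisson (fC c)) => w [n ->]; rewrite ltry.
Qed.

Lemma measurable_cnum A : measurable A -> measurable_fun setT (cnum A).
Proof. by move=> mA; apply: measurable_funB => //; exact: measurable_num. Qed.

Lemma rintegrable_num A : fmeas A -> rintegrable P (num A).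
Proof.
move=> fA; apply: rintegrableP; first exact: measurable_num fA.1.
by rewrite (integral_num1 eta_poisson fA); exact: fA.2.
Qed.

Lemma num_ge0 A w : (0 <= num A w)%R.
Proof. exact: fine_ge0. Qed.

Lemma rint_num A : fmeas A -> rint P (num A) = fine (mu A).
Proof.
move=> fA; rewrite -(integral_num1 eta_poisson fA); congr fine.
by apply: eq_integral => w _; rewrite ger0_norm// num_ge0.
Qed.

Lemma rintegrable_cst (c : R) : rintegrable P (fun=> c).
Proof.
by apply: rintegrableP => //; rewrite integral_prob_cst ltry.
Qed.

Lemma rint_cst (c : R) : rint P (fun=> c) = c.
Proof. by rewrite /rint /Rintegral integral_prob_cst. Qed.

Lemma rintegrable_cnum A : fmeas A -> rintegrable P (cnum A).
Proof. by move=> fA; exact: (rintegrableB (rintegrable_num fA) (rintegrable_cst _)). Qed.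

Lemma rint_cnum A : fmeas A -> rint P (cnum A) = 0%R.
Proof.
move=> fA; rewrite /cnum rintB ?rint_num// ?rint_cst ?subrr//.
  exact: rintegrable_num.
exact: rintegrable_cst.
Qed.

Lemma rint_num_sqr A : fmeas A -> rintegrable P (fun w => num A w ^+ 2)%R /\
  rint P (fun w => num A w ^+ 2)%R = (fine (mu A) + fine (mu A) ^+ 2)%R.
Proof.
move=> fA.
have h : \int[P]_w (num A w ^+ 2)%:E = (fine (mu A) + fine (mu A) ^+ 2)%:E.
  rewrite EFinD expr2 EFinM -(fmeasE fA) -(integral_num2 eta_poisson fA).
  by apply: eq_integral => w _; rewrite ger0_norm// num_ge0.
split; last by rewrite /rint /Rintegral h.
apply: rintegrableP; first by apply: measurable_funX; exact: measurable_num fA.1.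
under eq_integral => w _ do rewrite ger0_norm ?sqr_ge0//.
by rewrite h ltry.
Qed.

Lemma rint_cnum_sqr A : fmeas A -> rintegrable P (fun w => cnum A w ^+ 2)%R /\
  rint P (fun w => cnum A w ^+ 2)%R = fine (mu A).
Proof.
move=> fA; set l := fine (mu A); have [i2 e2] := rint_num_sqr fA.
have i1 := rintegrable_num fA.
have E : (fun w => cnum A w ^+ 2)%R = (fun w => num A w ^+ 2 - ((2 * l) * num A w - l ^+ 2))%R.
  by apply/funext => w; rewrite /cnum -/l; ring.
have ic := rintegrableB (rintegrableZ (2 * l)%R i1) (rintegrable_cst (l ^+ 2)).
rewrite E; split; first exact: rintegrableB.
rewrite rintB// e2 (rintB (rintegrableZ _ i1) (rintegrable_cst _)) rintZ// rint_cst rint_num//.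
by rewrite -/l; ring.
Qed.

Section cells.
Context (K : finType) (C : K -> set X).
Hypothesis aC : atomic mu C.

(** Almost surely only: [fine] is additive over the atoms when all their counts are finite. *)
Lemma TI_cells n (s : seq (bx R X n)) :
  (forall b, b \in s -> forall i, adapted C (b.2 i)) ->
  \forall w \ae P, TI s w = TI (aseq C (coef C (ev s))) w.
Proof.
move=> sC; apply: filterS (count_fin_ae aC.1) => w woo.
apply: (Zint_atoms aC) => //.
  by move=> i; rewrite /cnum /num !measure0/= subrr.
move=> b bs i; rewrite /cnum sumrB /num.
rewrite (fine_measure_adapted aC woo); last exact: sC.
by rewrite (fine_measure_adapted aC (fun c => (aC.1 c).2))//; exact: sC.
Qed.

Lemma UI_cells n (s : seq (bx R X n)) :
  (forall b, b \in s -> forall i, adapted C (b.2 i)) ->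
  \forall w \ae P, UI s w = UI (aseq C (coef C (ev s))) w.
Proof.
move=> sC; apply: filterS (count_fin_ae aC.1) => w woo.
apply: (Zint_atoms aC) => //.
  by move=> i; rewrite /num !measure0.
by move=> b bs i; rewrite /num (fine_measure_adapted aC woo)//; exact: sC.
Qed.

(** A product over distinct atoms becomes a product over all atoms with exponents 0 or 1, the shape
    in which independence is available. *)
Lemma prod_inj n (j : {ffun 'I_n -> K}) (F : K -> R) : injective j ->
  (\prod_i F (j i) = \prod_c F c ^+ (c \in j @: finset.setT))%R.
Proof.
move=> ij; rewrite [RHS](bigID (mem (j @: finset.setT)))/= [X in (_ * X)%R]big1 ?mulr1.
  rewrite (eq_bigr F); last by move=> c ->; rewrite expr1.
  by rewrite big_imset/=; [apply: eq_bigl => i; rewrite finset.inE|move=> a b _ _ /ij].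
by move=> c /negPf ->; rewrite expr0.
Qed.

(** After merging, each atom carries its centered count to the power 0, 1 or 2, with means 1, 0 and
    [mu (C c)]. A power 1 occurs unless the two index sets coincide. *)
Lemma rint_cell_prod n m (j : {ffun 'I_n -> K}) (j' : {ffun 'I_m -> K}) :
  injective j -> injective j' ->
  rintegrable P (fun w => (\prod_i cnum (C (j i)) w) * (\prod_i cnum (C (j' i)) w))%R /\
  rint P (fun w => (\prod_i cnum (C (j i)) w) * (\prod_i cnum (C (j' i)) w))%R =
  (if j @: finset.setT == j' @: finset.setT then \prod_i fine (mu (C (j i))) else 0)%R.
Proof.
move=> ij ij'.
pose e c := ((c \in j @: finset.setT) + (c \in j' @: finset.setT))%N.
pose phi c (x : R) := ((x - fine (mu (C c))) ^+ e c)%R.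
have -> : (fun w => (\prod_i cnum (C (j i)) w) * (\prod_i cnum (C (j' i)) w))%R =
    (fun w => \prod_c phi c (num (C c) w))%R.
  apply/funext => w; rewrite (prod_inj (fun c => cnum (C c) w) ij).
  rewrite (prod_inj (fun c => cnum (C c) w) ij') -big_split/=.
  by apply: eq_bigr => c _; rewrite -exprD.
have mphi c : measurable_fun setT (phi c).
  by apply: measurable_funX; exact: measurable_funB.
have iphi c : rintegrable P (fun w => phi c (num (C c) w)).
  have : (e c <= 2)%N by rewrite /e; case: (c \in _); case: (c \in _).
  rewrite /phi; case: (e c) => [|[|[|//]]].
  - by move=> _; exact: rintegrable_cst.
  - by move=> _; exact: (rintegrable_cnum (aC.1 c)).
  - by move=> _; exact: (rint_cnum_sqr (aC.1 c)).1.
have [-> ->] := rint_prod_num eta_poisson aC.1 aC.2 mphi iphi; split=> //.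
case: eqVneq => [jj'|njj'].
  rewrite (prod_inj (fun c => fine (mu (C c))) ij); apply: eq_bigr => c _.
  rewrite /phi /e -jj'; case: (c \in _); last by rewrite rint_cst.
  by rewrite (rint_cnum_sqr (aC.1 c)).2.
have [c ec] : exists c, e c = 1%N.
  apply: contra_notP (negP njj') => ne; apply/eqP/setP => c.
  have : e c <> 1%N by move=> ec; apply: ne; exists c.
  by rewrite /e; case: (c \in _); case: (c \in _).
rewrite (bigD1 c)//= /phi ec.
by rewrite [X in (X * _)%R](_ : _ = 0%R) ?mul0r//; exact: (rint_cnum (aC.1 c)).
Qed.

End cells.

(* Injective maps with the same image differ by a unique permutation. *)
Lemma sum_same_image (K : finType) n (j : {ffun 'I_n -> K})
    (b : {ffun 'I_n -> K} -> R) : injective j ->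
  (forall (j' : {ffun 'I_n -> K}) (s : 'S_n), b [ffun i => j' (s i)] = b j') ->
  (\sum_(j' : {ffun 'I_n -> K} | injectiveb j' && (j @: finset.setT == j' @: finset.setT))
     b j' = n`!%:R * b j)%R.
Proof.
move=> ij bs; pose h (s : 'S_n) : {ffun 'I_n -> K} := [ffun i => j (s i)].
have hinj : injective h.
  by move=> s s' /ffunP e; apply/permP => i; have := e i; rewrite !ffunE => /ij.
rewrite (eq_bigl (mem (h @: finset.setT))); last first.
  move=> j'; apply/idP/idP.
    move=> /andP[/injectiveP ij' /eqP im].
    have /choice[f hf] : forall i, exists i', j i' = j' i.
      move=> i; have : j' i \in j @: finset.setT by rewrite im imset_f// finset.inE.
      by move=> /imsetP[i' _ ->]; exists i'.
    have finj : injective f by move=> i i' e; apply: ij'; rewrite -!hf e.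
    apply/imsetP; exists (perm finj); rewrite ?finset.inE//.
    by apply/ffunP => i; rewrite ffunE permE hf.
  move=> /imsetP[s _ ->]; apply/andP; split.
    by apply/injectiveP => i i'; rewrite !ffunE => /ij/perm_inj.
  apply/eqP/setP => c; apply/imsetP/imsetP => -[i _ ->].
    by exists (s^-1%g i); rewrite ?finset.inE// ffunE permKV.
  by exists (s i); rewrite ?finset.inE// ffunE.
rewrite big_imset/=; last by move=> s s' _ _ /hinj.
rewrite (eq_bigr (fun=> b j)); last by move=> s _; rewrite bs.
by rewrite big_const iter_addr_0 (eq_card (B := predT)) ?card_Sn ?mulr_natl// => s;
  rewrite finset.inE.
Qed.

Section power_integrals.
Context (n : nat).
Implicit Types (s t : seq (bx R X n)).

Lemma rintegrable_box (B : 'I_n -> set X) : (forall i, fmeas (B i)) ->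
  rintegrable (power_measure mu n) (\1_(box B)) /\
  rint (power_measure mu n) (\1_(box B)) = (\prod_i fine (mu (B i)))%R.
Proof.
move=> fB; have mB := @measurable_box _ _ _ B (fun i => (fB i).1).
have e : \int[power_measure mu n]_x (\1_(box B) x)%:E = (\prod_i fine (mu (B i)))%:E.
  rewrite integral_indic// setIT.
  rewrite [LHS](power_measure_box mu (fun i => (fB i).1)) -prodEFin.
  by apply: eq_bigr => i _; exact: fmeasE.
split; last by rewrite /rint /Rintegral e.
apply: rintegrableP; first exact: measurable_indic.
under eq_integral => x _ do rewrite ger0_norm//.
by rewrite e ltry.
Qed.

Lemma rintegrable_ev s : fsides mu s -> rintegrable (power_measure mu n) (ev s) /\
  rint (power_measure mu n) (ev s) = Zint (fun _ B => fine (mu B)) s.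
Proof.
elim: s => [|b s IH] fs.
  have -> : ev ([::] : seq (bx R X n)) = (fun=> 0%R) by apply/funext => x; rewrite /ev big_nil.
  by rewrite rint0 /Zint big_nil; split => //; exact: rintegrable0.
have [i1 e1] := rintegrable_box (fs b (mem_head _ _)).
have [|i2 e2] := IH; first by move=> b' bs; apply: fs; rewrite inE bs orbT.
have -> : ev (b :: s) = (fun x => b.1 * \1_(box b.2) x + ev s x)%R.
  by apply/funext => x; rewrite /ev big_cons.
split; first by apply: rintegrableD => //; exact: rintegrableZ.
rewrite rintD ?rintZ ?e1 ?e2 ?/Zint ?big_cons//; exact: rintegrableZ.
Qed.

Lemma measurable_ev s : fsides mu s -> measurable_fun setT (ev s).
Proof. by move=> /rintegrable_ev[/rintegrable_meas]. Qed.

Section comp.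
Context (K : finType) (C : K -> set X).
Hypothesis aC : atomic mu C.

(** Products use both arguments of [G]; norm, square and clamp ignore the second. *)
Lemma simple_on_comp2 (G : R -> R -> R) (g g' : n.-tuple X -> R) : G 0%R 0%R = 0%R ->
  simple_on C g -> simple_on C g' -> simple_on C (fun x => G (g x) (g' x)).
Proof.
move=> G0 [h1 h2] [h1' h2']; split=> [j x y jx jy|x nx].
  by rewrite (h1 j x y)// (h1' j x y).
by rewrite h2// h2'.
Qed.

Lemma coef_comp2 (G : R -> R -> R) (g g' : n.-tuple X -> R) j : G 0%R 0%R = 0%R ->
  coef C (fun x => G (g x) (g' x)) j = G (coef C g j) (coef C g' j).
Proof. by move=> G0; rewrite /coef; case: ifP. Qed.

Lemma rint_simple (g : n.-tuple X -> R) : simple_on C g ->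
  rintegrable (power_measure mu n) g /\
  rint (power_measure mu n) g = (\sum_j coef C g j * \prod_i fine (mu (C (j i))))%R.
Proof.
move=> sg; have E : ev (aseq C (coef C g)) = g.
  by apply/funext => x; rewrite -(simple_onE aC).
have [] := rintegrable_ev (@fsides_aseq _ _ _ _ _ _ aC _ (coef C g)).
by rewrite E Zint_aseq => i e; split.
Qed.

End comp.
End power_integrals.

Section cells_iso.
Context (K : finType) (C : K -> set X).
Hypothesis aC : atomic mu C.

(** The sample point of a cell with a repeated atom has a repeated entry. *)
Lemma coef_offdiag n (g : n.-tuple X -> R) (j : {ffun 'I_n -> K}) : offdiag g -> ~~ injectiveb j ->
  coef C g j = 0%R.
Proof.
move=> og nj; rewrite /coef; case: ifP => // ne; apply: og.
apply: contra nj => /tuple_uniqP h; apply/injectiveP => i i' e; apply: h.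
by rewrite !tnth_mktuple e.
Qed.

Lemma coef_sym n (g : n.-tuple X -> R) (j : {ffun 'I_n -> K}) (s : 'S_n) : symfun g ->
  coef C g [ffun i => j (s i)] = coef C g j.
Proof.
move=> sg; rewrite /coef.
rewrite (_ : [forall i, _] = [forall i, `[< C (j i) !=set0 >]]).
  case: ifP => // _; rewrite -(sg s (pt C j)); congr g.
  by apply: eq_from_tnth => i; rewrite !tnth_mktuple ffunE.
apply/forallP/forallP => h i; last by rewrite ffunE.
by have := h (s^-1%g i); rewrite ffunE permKV.
Qed.

Lemma rint_cells n m (a : {ffun 'I_n -> K} -> R) (b : {ffun 'I_m -> K} -> R) :
  (forall j : {ffun 'I_n -> K}, ~~ injectiveb j -> a j = 0%R) ->
  (forall j : {ffun 'I_m -> K}, ~~ injectiveb j -> b j = 0%R) ->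
  rintegrable P (fun w => TI (aseq C a) w * TI (aseq C b) w)%R /\
  rint P (fun w => TI (aseq C a) w * TI (aseq C b) w)%R =
  (\sum_(j : {ffun 'I_n -> K} | injectiveb j)
   \sum_(j' : {ffun 'I_m -> K} | injectiveb j' &&
     (j @: finset.setT == j' @: finset.setT)) a j * b j' * \prod_i fine (mu (C (j i))))%R.
Proof.
move=> a0 b0.
pose F (p : {ffun 'I_n -> K} * {ffun 'I_m -> K}) w : R :=
  ((\prod_i cnum (C (p.1 i)) w) * (\prod_i cnum (C (p.2 i)) w))%R.
pose ab (p : {ffun 'I_n -> K} * {ffun 'I_m -> K}) := (a p.1 * b p.2)%R.
(* Terms with a repeated atom have coefficient 0. Setting them to 0 keeps the powers of the centered
   counts at most 2. *)
pose F' (p : {ffun 'I_n -> K} * {ffun 'I_m -> K}) w := if injectiveb p.1 && injectiveb p.2 then F p w else 0%R.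
have iF' p : rintegrable P (F' p).
  rewrite /F'; case e : (injectiveb p.1 && injectiveb p.2); last exact: rintegrable0.
  by move: e => /andP[/injectiveP i1 /injectiveP i2]; have [] := rint_cell_prod aC i1 i2.
have E : (fun w => TI (aseq C a) w * TI (aseq C b) w)%R =
    (fun w => \sum_(p <- enum {: {ffun 'I_n -> K} * {ffun 'I_m -> K}}) ab p * F' p w)%R.
  apply/funext => w; rewrite /TI !Zint_aseq big_enum/= mulr_suml.
  rewrite (eq_bigr (fun p => ab (p.1, p.2) * F' (p.1, p.2) w)%R); last by case.
  rewrite -(pair_bigA _ (fun j j' => ab (j, j') * F' (j, j') w)%R)/=.
  apply: eq_bigr => j _; rewrite mulr_sumr; apply: eq_bigr => j' _.
  rewrite /ab /F' /F /=; case: ifPn => [_|]; first by ring.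
  by rewrite negb_and => /orP[/a0|/b0] ->; ring.
rewrite E; split; first exact: rintegrable_sum.
rewrite rint_sum// big_enum/=.
rewrite (eq_bigr (fun p => ab (p.1, p.2) * rint P (F' (p.1, p.2)))%R); last by case.
rewrite -(pair_bigA _ (fun j j' => ab (j, j') * rint P (F' (j, j')))%R)/=.
rewrite [RHS]big_mkcond/=; apply: eq_bigr => j _.
case: ifPn => ij; last first.
  by apply: big1 => j' _; rewrite /ab /= a0// !mul0r.
rewrite [RHS]big_mkcond/=; apply: eq_bigr => j' _; rewrite /ab /F'/= ij/=.
case e : (injectiveb j') => /=; last by rewrite rint0 mulr0.
have ij' : injectiveb j' by rewrite e.
have [_ ->] := rint_cell_prod aC (injectiveP _ ij) (injectiveP _ ij').
by case: ifP => _; rewrite ?mulr0.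
Qed.

End cells_iso.

Lemma measurable_Zint n (z : Omega -> 'I_n -> set X -> R) (s : seq (bx R X n)) :
  (forall b, b \in s -> forall i, measurable_fun setT (fun w => z w i (b.2 i))) ->
  measurable_fun setT (fun w => Zint (z w) s).
Proof.
move=> mz; rewrite /Zint (_ : (fun w => _) = (fun w => \sum_(b <- s)
    (if b \in s then b.1 * \prod_(i < n) z w i (b.2 i) else 0))%R); last first.
  by apply/funext => w; apply: eq_big_seq => b ->.
apply: measurable_sum => b; case bs : (b \in s) => //.
apply: measurable_funM => //; apply: measurable_prod => i _; exact: mz.
Qed.

Lemma measurable_TI n (s : seq (bx R X n)) : fsides mu s -> measurable_fun setT (TI s).
Proof. by move=> fs; apply: measurable_Zint => b bs i; exact/measurable_cnum/(fs b bs i).1. Qed.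

Lemma measurable_UI n (s : seq (bx R X n)) : fsides mu s -> measurable_fun setT (UI s).
Proof. by move=> fs; apply: measurable_Zint => b bs i; exact/measurable_num/(fs b bs i).1. Qed.

Lemma TI_mul n m (s : seq (bx R X n)) (t : seq (bx R X m)) :
  fsides mu s -> fsides mu t -> offdiag (ev s) -> offdiag (ev t) ->
  exists (K : finType) (C : K -> set X), [/\ atomic mu C, simple_on C (ev s),
    simple_on C (ev t), rintegrable P (fun w => TI s w * TI t w)%R &
  rint P (fun w => TI s w * TI t w)%R =
  (\sum_(j : {ffun 'I_n -> K} | injectiveb j)
   \sum_(j' : {ffun 'I_m -> K} | injectiveb j' &&
     (j @: finset.setT == j' @: finset.setT))
       coef C (ev s) j * coef C (ev t) j' * \prod_i fine (mu (C (j i))))%R].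
Proof.
move=> fs ft os ot; have [K [C [aC sC tC]]] := exists_atoms_seq2 fs ft.
have [h1 h2] := rint_cells aC (fun j => @coef_offdiag _ C n _ j os)
  (fun j => @coef_offdiag _ C m _ j ot).
have E : \forall w \ae P, (TI (aseq C (coef C (ev s))) w * TI (aseq C (coef C (ev t))) w =
    TI s w * TI t w)%R.
  by apply: filterS2 (TI_cells aC sC) (TI_cells aC tC) => w -> ->.
have mm : measurable_fun setT (fun w => TI s w * TI t w)%R.
  by apply: measurable_funM; exact: measurable_TI.
exists K, C; split => //; [exact: (simple_on_ev aC sC)|exact: (simple_on_ev aC tC)| |].
  exact: rintegrable_ae mm h1 E.
by rewrite -h2; apply/esym/rint_ae => //; exact: rintegrable_meas h1.
Qed.

(** Injective index maps with the same image have equally many arguments, so no pair survives in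
    [TI_mul]. *)
Lemma TI_orthogonal n m (s : seq (bx R X n)) (t : seq (bx R X m)) :
  fsides mu s -> fsides mu t -> offdiag (ev s) -> offdiag (ev t) -> n != m ->
  rint P (fun w => TI s w * TI t w)%R = 0%R.
Proof.
move=> fs ft os ot nm; have [K [C [_ _ _ _ ->]]] := TI_mul fs ft os ot.
apply: big1 => j /injectiveP ij; apply: big1 => j' /andP[/injectiveP ij' /eqP e].
exfalso; have := congr1 (fun A : {set K} => #|A|) e.
by rewrite !card_imset// !cardsT !card_ord; apply/eqP.
Qed.

(** The injective maps [j'] with the image of [j] are its [n!] rearrangements, and by symmetry
    [ev t] has the same coefficient at all of them. *)
Lemma TI_isometry n (s t : seq (bx R X n)) :
  fsides mu s -> fsides mu t -> offdiag (ev s) -> offdiag (ev t) -> symfun (ev t) ->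
  rintegrable P (fun w => TI s w * TI t w)%R /\
  rint P (fun w => TI s w * TI t w)%R =
  (n`!%:R * rint (power_measure mu n) (fun x => ev s x * ev t x))%R.
Proof.
move=> fs ft os ot st; have [K [C [aC sC tC ii ->]]] := TI_mul fs ft os ot.
split=> //.
have [_ ->] := rint_simple aC (simple_on_comp2 (G := *%R) (mulr0 _) sC tC).
rewrite mulr_sumr big_mkcond; apply: eq_bigr => j _.
rewrite (coef_comp2 (G := *%R) _ _ _ _ (mulr0 _)).
case: ifPn => [/injectiveP ij|nj]; last by rewrite coef_offdiag// !mul0r mulr0.
rewrite -mulr_suml -mulr_sumr (sum_same_image ij); first by ring.
by move=> j' s'; exact: coef_sym.
Qed.

(** Over common atoms the integral is computed from the values of the function, so the choice of the
    boxes that represent it does not matter. *)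
Lemma TI_ext n (s t : seq (bx R X n)) : fsides mu s -> fsides mu t -> ev s = ev t ->
  \forall w \ae P, TI s w = TI t w.
Proof.
move=> fs ft e; have [K [C [aC sC tC]]] := exists_atoms_seq2 fs ft.
by apply: filterS2 (TI_cells aC sC) (TI_cells aC tC) => w -> ->; rewrite e.
Qed.

End isometry.

(** * Moment bounds for step functions *)

Section bounds.
Context (R : realType) (dX dO : measure_display) (X : measurableType dX).
Context (Omega : measurableType dO).
Context (mu : {sigma_finite_measure set X -> \bar R}).
Context (P : probability Omega R) (eta : {RV P >-> point_measure R X}).
Hypothesis eta_poisson : poisson_process mu eta.
Local Notation fmeas := (fmeas mu).
Local Notation num := (count_in eta).
Local Notation cnum := (ccount mu eta).
Local Notation TI := (step_chaos mu eta).
Local Notation UI := (step_count eta).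

Lemma rint_norm_cnum A : fmeas A ->
  (rint P (fun w => `|cnum A w|) <= 2 * fine (mu A))%R.
Proof.
move=> fA; rewrite mulrDl mul1r -{1}(rint_num eta_poisson fA) -(rint_cst P (fine _)).
have i1 := rintegrable_num eta_poisson fA; have i2 := rintegrable_cst P (fine (mu A)).
rewrite -rintD//; apply: le_rint.
- exact/rintegrable_norm/rintegrable_cnum.
- exact: rintegrableD.
- move=> w; rewrite /ccount (le_trans (ler_normB _ _))//.
  by rewrite !ger0_norm ?fine_ge0// num_ge0.
Qed.

(** On a cell with distinct atoms the absolute moment factors by independence, and each factor is at
    most [mu (C c) + mu (C c)]: hence [2 ^+ n]. This bound complements the isometry because the
    kernels are at first known to be integrable only. *)
Lemma TI_L1 n (s : seq (bx R X n)) : fsides mu s -> offdiag (ev s) ->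
  rintegrable P (TI s) /\
  (rint P (fun w => `|TI s w|) <= 2 ^+ n * rint (power_measure mu n) (fun x => `|ev s x|))%R.
Proof.
move=> fs os; have [K [C [aC sC]]] := exists_atoms_seq fs.
have sg := simple_on_ev aC sC.
pose phi (j : {ffun 'I_n -> K}) c x : R := (`|x - fine (mu (C c))| ^+ (c \in j @: finset.setT))%R.
pose F (j : {ffun 'I_n -> K}) w : R :=
  if injectiveb j then (\prod_i `|cnum (C (j i)) w|)%R else 0%R.
have key j : rintegrable P (F j) /\
    (rint P (F j) <= 2 ^+ n * \prod_i fine (mu (C (j i))))%R.
  rewrite /F; case e : (injectiveb j); last first.
    rewrite rint0; split; first exact: rintegrable0.
    by rewrite mulr_ge0// prodr_ge0// => i _; rewrite fine_ge0.
  have /injectiveP ij : injectiveb j by rewrite e.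
  have -> : (fun w => \prod_i `|cnum (C (j i)) w|)%R =
      (fun w => \prod_c phi j c (num (C c) w))%R.
    by apply/funext => w; rewrite (prod_inj (fun c => `|cnum (C c) w|%R) ij).
  have mphi c : measurable_fun setT (phi j c).
    apply: measurable_funX; apply: measurableT_comp => //; exact: measurable_funB.
  have iphi c : rintegrable P (fun w => phi j c (num (C c) w)).
    rewrite /phi; case: (c \in _); first exact/rintegrable_norm/(rintegrable_cnum eta_poisson (aC.1 c)).
    exact: rintegrable_cst.
  have [ii ->] := rint_prod_num eta_poisson aC.1 aC.2 mphi iphi; split => //.
  have -> : (2 ^+ n * \prod_i fine (mu (C (j i))) = \prod_i (2 * fine (mu (C (j i)))))%R.
    by rewrite big_split/= prodr_const card_ord.
  rewrite (prod_inj (fun c => 2 * fine (mu (C c)))%R ij).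
  apply: ler_prod => c _; apply/andP; split.
    by apply: rint_ge0 => w; rewrite /phi exprn_ge0.
  rewrite /phi; case: (c \in _); last by rewrite rint_cst.
  by rewrite !expr1; exact: rint_norm_cnum (aC.1 c).
pose G w := (\sum_(j <- enum {ffun 'I_n -> K}) `|coef C (ev s) j| * F j w)%R.
have iG : rintegrable P G by apply: rintegrable_sum => j; have [] := key j.
have TG : \forall w \ae P, (`|TI s w| <= G w)%R.
  apply: filterS (TI_cells eta_poisson aC sC) => w ->.
  rewrite /step_chaos Zint_aseq /G big_enum/= (le_trans (ler_norm_sum _ _ _))//.
  apply: ler_sum => j _; rewrite normrM normr_prod /F.
  by case: ifPn => // nj; rewrite coef_offdiag// normr0 !mul0r.
have mT := measurable_TI eta fs.
have iT : rintegrable P (TI s).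
  apply: rintegrableP => //; apply: le_lt_trans (rintegrable_lty iG).
  apply: ae_ge0_le_integral => //.
  - by apply/measurable_EFinP; exact: measurableT_comp.
  - by apply/measurable_EFinP; apply: measurableT_comp => //; exact: rintegrable_meas iG.
  - by apply: filterS TG => w h _; rewrite lee_fin (le_trans h)// ler_norm.
split=> //.
have GE : rint P G = (\sum_j `|coef C (ev s) j| * rint P (F j))%R.
  by rewrite rint_sum ?big_enum// => j; have [] := key j.
apply: (@le_trans _ _ (rint P G)).
  rewrite -lee_fin -!rintE//; last exact: rintegrable_norm.
  apply: ae_ge0_le_integral => //.
  - by apply/measurable_EFinP; exact: measurableT_comp.
  - move=> w _; rewrite lee_fin; apply: sumr_ge0 => j _; rewrite mulr_ge0// /F.
    by case: ifP => // _; apply: prodr_ge0.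
  - by apply/measurable_EFinP; exact: rintegrable_meas iG.
  - by apply: filterS TG => w h _; rewrite lee_fin.
have sn : simple_on C (fun x => `|ev s x|%R).
  exact: (simple_on_comp2 (G := fun x y => `|x|%R) (normr0 _) sg sg).
have [_ ->] := rint_simple aC sn.
rewrite GE mulr_sumr; apply: ler_sum => j _.
rewrite (coef_comp2 (G := fun x _ => `|x|%R) C (ev s) (ev s) j (normr0 _)).
by rewrite mulrCA ler_wpM2l//; have [] := key j.
Qed.

(** [integral_num_shift] turns the factor [num A] into [mu A] and moves the exponent to [num A + 1],
    whence the extra [expR 1]. *)
Lemma rint_num_expR A : fmeas A ->
  rintegrable P (fun w => num A w * expR (num A w))%R /\
  rint P (fun w => num A w * expR (num A w))%R =
  (fine (mu A) * expR 1 * expR (fine (mu A) * (expR 1 - 1)))%R.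
Proof.
move=> fA; have mN := measurable_num eta fA.1.
have e : \int[P]_w (num A w * expR (num A w))%:E =
    (fine (mu A) * expR 1 * expR (fine (mu A) * (expR 1 - 1)))%:E.
  rewrite -mulrA EFinM -(fmeasE fA).
  transitivity (\int[P]_w (`|num A w| * expR (num A w))%:E).
    by apply: eq_integral => w _; rewrite ger0_norm ?num_ge0.
  rewrite (integral_num_shift eta_poisson (phi := expR) fA) ?expR_ge0//; congr (_ * _).
  rewrite EFinM -(integral_expR_num eta_poisson fA) -ge0_integralZl_EFin ?expR_ge0//.
  - by apply: eq_integral => w _; rewrite expRD mulrC EFinM.
  - by apply/measurable_EFinP; exact: measurableT_comp.
split; last by rewrite /rint /Rintegral e.
apply: rintegrableP; first by apply: measurable_funM => //; exact: measurableT_comp.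
under eq_integral => w _ do rewrite ger0_norm ?mulr_ge0 ?expR_ge0 ?num_ge0//.
by rewrite e ltry.
Qed.

Lemma rint_expR_num A : fmeas A ->
  rintegrable P (fun w => expR (num A w)) /\
  rint P (fun w => expR (num A w)) = expR (fine (mu A) * (expR 1 - 1)).
Proof.
move=> fA; have mN := measurable_num eta fA.1.
have e := integral_expR_num eta_poisson fA.
split; last by rewrite /rint /Rintegral e.
apply: rintegrableP; first exact: measurableT_comp.
under eq_integral => w _ do rewrite ger0_norm ?expR_ge0//.
by rewrite e ltry.
Qed.

Lemma expR1_ge1 : (1 <= expR 1 :> R)%R.
Proof. by rewrite -expR0 ler_expR. Qed.

(* A change of measure: under the weight [expR (num B)] the process is again
   Poisson, with intensity at most [expR 1 * mu]. *)
Lemma UI_expR_bound (B : set X) : fmeas B -> forall n (s : seq (bx R X n)),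
  fsides mu s -> offdiag (ev s) -> (forall x, 0 <= ev s x)%R ->
  rintegrable P (fun w => UI s w * expR (num B w))%R /\
  (rint P (fun w => UI s w * expR (num B w)) <=
   expR 1 ^+ n * expR (fine (mu B) * (expR 1 - 1)) * rint (power_measure mu n) (ev s))%R.
Proof.
move=> fB n s fs os s0.
(* [B] joins the sides so that [num B] is a sum over atoms and its exponential factors along
   them. *)
have [|K [C [aC hC]]] := @exists_atoms _ _ _ mu (B :: sides s).
  move=> A; rewrite inE => /orP[/eqP ->//|/mem_sides[b bs [i ->]]]; exact: fs.
have BC : adapted C B by apply: hC; rewrite mem_head.
have sC b : b \in s -> forall i, adapted C (b.2 i).
  by move=> bs i; apply: hC; rewrite inE; apply/orP; right; apply/mem_sides; exists b => //; exists i.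
have sg := simple_on_ev aC sC.
pose inB c := `[< C c `<=` B >].
pose phi (j : {ffun 'I_n -> K}) c x : R :=
  (x ^+ (c \in j @: finset.setT) * (if inB c then expR x else 1))%R.
pose F (j : {ffun 'I_n -> K}) w : R :=
  if injectiveb j then (\prod_c phi j c (num (C c) w))%R else 0%R.
pose M := (expR 1 ^+ n * expR (fine (mu B) * (expR 1 - 1)))%R.
have key j : rintegrable P (F j) /\ (rint P (F j) <= M * \prod_i fine (mu (C (j i))))%R.
  rewrite /F; case e : (injectiveb j); last first.
    rewrite rint0; split; first exact: rintegrable0.
    by rewrite mulr_ge0 ?prodr_ge0 ?mulr_ge0 ?exprn_ge0 ?expR_ge0// => i _; rewrite fine_ge0.
  have /injectiveP ij : injectiveb j by rewrite e.
  have mphi c : measurable_fun setT (phi j c).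
    by apply: measurable_funM => //; case: (inB c).
  have iphi c : rintegrable P (fun w => phi j c (num (C c) w)) /\
      (rint P (fun w => phi j c (num (C c) w)) <=
      (expR 1 * fine (mu (C c))) ^+ (c \in j @: finset.setT) *
      (if inB c then expR (fine (mu (C c)) * (expR 1 - 1)) else 1))%R.
    rewrite /phi; case: (c \in _); case: (inB c).
    - have [? e1] := rint_num_expR (aC.1 c).
      by split => //; rewrite expr1 (mulrC (expR 1)) -e1.
    - rewrite (_ : (fun w => _) = num (C c)); last by apply/funext => w; rewrite mulr1.
      split; first exact: (rintegrable_num eta_poisson (aC.1 c)).
      (* Outside [B] the intensity is not multiplied; [1 <= expR 1] gives a bound common to all
         atoms. *)
      rewrite (rint_num eta_poisson (aC.1 c)) mulr1 ler_peMl ?fine_ge0//; exact: expR1_ge1.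
    - rewrite (_ : (fun w => _) = (fun w => expR (num (C c) w))); last first.
        by apply/funext => w; rewrite mul1r.
      by have [? ->] := rint_expR_num (aC.1 c); rewrite mul1r.
    - rewrite (_ : (fun w => _) = fun=> 1%R); last by apply/funext => w; rewrite mulr1.
      by rewrite rint_cst mulr1; split => //; exact: rintegrable_cst.
  have [ii ->] := rint_prod_num eta_poisson aC.1 aC.2 mphi (fun c => (iphi c).1).
  split => //.
  apply: (@le_trans _ _ (\prod_c ((expR 1 * fine (mu (C c))) ^+ (c \in j @: finset.setT) *
      (if inB c then expR (fine (mu (C c)) * (expR 1 - 1)) else 1)))%R).
    apply: ler_prod => c _; apply/andP; split; last by have [] := iphi c.
    apply: rint_ge0 => w; rewrite /phi mulr_ge0 ?exprn_ge0 ?num_ge0//.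
    by case: ifP => // _; exact: expR_ge0.
  rewrite big_split/= -(prod_inj (fun c => expR 1 * fine (mu (C c)))%R ij).
  rewrite big_split/= prodr_const card_ord -big_mkcond/= /M.
  rewrite (fine_measure_adapted aC (fun c => (aC.1 c).2) BC) mulr_suml.
  by rewrite (big_morph _ (@expRD R) (@expR0 R)) mulrAC.
pose G w := (\sum_(j <- enum {ffun 'I_n -> K}) coef C (ev s) j * F j w)%R.
have iG : rintegrable P G by apply: rintegrable_sum => j; have [] := key j.
have coef0 j : (0 <= coef C (ev s) j)%R by rewrite /coef; case: ifP.
have UG : \forall w \ae P, (G w = UI s w * expR (num B w))%R.
  apply: filterS2 (UI_cells eta_poisson aC sC) (count_fin_ae eta_poisson aC.1) => w -> woo.
  rewrite /step_count Zint_aseq /G big_enum/= mulr_suml; apply: eq_bigr => j _.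
  rewrite /F; case: ifPn => [/injectiveP ij|nj]; last by rewrite coef_offdiag// !mul0r.
  rewrite -mulrA; congr (_ * _)%R; rewrite (prod_inj (fun c => num (C c) w) ij).
  rewrite [num B w](fine_measure_adapted aC woo BC) (big_morph _ (@expRD R) (@expR0 R)).
  by rewrite [X in (_ * X)%R]big_mkcond -big_split.
have mU : measurable_fun setT (fun w => UI s w * expR (num B w))%R.
  apply: measurable_funM; first exact: (measurable_UI eta fs).
  by apply: measurableT_comp => //; exact: (measurable_num eta fB.1).
split; first exact: rintegrable_ae mU iG UG.
rewrite -(rint_ae (rintegrable_meas iG) mU UG).
rewrite rint_sum; last by move=> j; have [] := key j.
have [_ ->] := rint_simple aC sg.
rewrite -/M big_enum/= mulr_sumr; apply: ler_sum => j _.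
by rewrite mulrCA ler_wpM2l//; have [] := key j.
Qed.

(** Every side lies in [B], so a centered count is at most [y = num B w + mu B] in absolute value,
    and [y ^+ n <= N ^+ n * expR y] because [y / N <= expR (y / N)] and [n <= N]. *)
Lemma TI_expR_bound n (t : seq (bx R X n)) : fsides mu t ->
  exists B (c : R), fmeas B /\ \forall w \ae P, (`|TI t w| <= c * expR (num B w))%R.
Proof.
move=> ft; pose B : set X := \big[setU/set0]_(A <- sides t) A.
have fB : fmeas B.
  have : forall A, A \in sides t -> fmeas A by move=> A /mem_sides[b bs [i ->]]; exact: ft.
  rewrite /B; elim: (sides t) => [|A l IH] h.
    by rewrite big_nil; split => //; rewrite measure0.
  rewrite big_cons; have [mA Aoo] := h A (mem_head _ _).
  have [|ml loo] := IH; first by move=> A' Al; apply: h; rewrite inE Al orbT.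
  split; first exact: measurableU.
  rewrite (@le_lt_trans _ _ (mu A + mu (\big[setU/set0]_(j <- l) j)))//.
    exact: measureU2.
  exact: lte_add_pinfty.
(* [n.+1] rather than [n], to divide by it also for [n = 0]. *)
pose N := (n.+1%:R : R); pose l := fine (mu B).
exists B, ((\sum_(b <- t) `|b.1|) * (N ^+ n * expR l))%R; split => //.
have sB b i : b \in t -> b.2 i `<=` B.
  move=> bt x bx; rewrite /B -bigcup_seq; exists (b.2 i) => //=.
  by apply/mem_sides; exists b => //; exists i.
have mon (m : {measure set X -> \bar R}) b i : b \in t -> m B < +oo ->
    (fine (m (b.2 i)) <= fine (m B))%R.
  move=> bt mBoo; have le : m (b.2 i) <= m B.
    by apply: le_measure; rewrite ?inE; [exact: (ft _ bt i).1|exact: fB.1|exact: sB].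
  apply: fine_le => //; rewrite ge0_fin_numE//.
  exact: le_lt_trans mBoo.
have := count_fin_ae eta_poisson (fun _ : unit => fB).
apply: filterS => w /(_ tt) wB.
rewrite /step_chaos /Zint (le_trans (ler_norm_sum _ _ _))// -mulrA mulr_suml.
rewrite big_seq [leRHS]big_seq; apply: ler_sum => b bt.
rewrite normrM ler_wpM2l// normr_prod.
set y := (num B w + l)%R.
have y0 : (0 <= y)%R by rewrite addr_ge0 ?num_ge0 ?fine_ge0.
have Npos : (0 < N)%R by rewrite ltr0n.
apply: (@le_trans _ _ (\prod_(i < n) y)%R).
  apply: ler_prod => i _; rewrite normr_ge0/= /ccount (le_trans (ler_normB _ _))//.
  rewrite !ger0_norm ?fine_ge0 ?num_ge0// lerD//; last exact: mon fB.2.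
  exact: mon wB.
rewrite prodr_const card_ord -mulrA -expRD (addrC l) -/y.
apply: (@le_trans _ _ ((N * expR (y / N)) ^+ n)%R).
  have N0 := ltW Npos.
  apply: lerXn2r; rewrite ?nnegrE ?mulr_ge0 ?expR_ge0//.
  rewrite -ler_pdivrMl// mulrC (le_trans _ (expR_ge1Dx _))//.
  by rewrite lerDr.
rewrite exprMn ler_wpM2l ?exprn_ge0 ?(ltW Npos)// -expRM_natl ler_expR.
by rewrite mulrA ler_pdivrMr// mulrC ler_wpM2l// ler_nat.
Qed.

End bounds.

(** * Symmetrization and partial integration *)

Section combinatorics.
Context (R : realType) (k : nat).

(** The elements of [J] are listed first, then those of its complement; this listing of all indices
    is the permutation. *)
Lemma perm_onto (J : {set 'I_k}) :
  exists t : 'S_k, t @: [set i : 'I_k | (i < #|J|)%N]%SET = J.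
Proof.
pose l := enum J ++ enum (~: J).
have pl : perm_eq l (ord_tuple k).
  apply: uniq_perm; rewrite ?val_ord_tuple ?enum_uniq//.
    rewrite cat_uniq !enum_uniq andbT/=; apply/hasPn => i.
    by rewrite !mem_enum finset.inE.
  by move=> i; rewrite mem_cat !mem_enum finset.inE orbN.
have /tuple_permP[p lp] := pl.
have pE (i : 'I_k) : p i = nth i l i.
  rewrite lp (nth_map i) ?size_enum_ord ?ltn_ord//.
  by rewrite tnth_ord_tuple /= nth_ord_enum.
exists p; apply/eqP; rewrite eqEcard; apply/andP; split.
  apply/fintype.subsetP => j /imsetP[i]; rewrite finset.inE => iJ ->.
  by rewrite pE nth_cat -cardE iJ -mem_enum mem_nth// -cardE.
rewrite card_imset; last exact: perm_inj.
have Jk : (#|J| <= k)%N by rewrite -[X in (_ <= X)%N]card_ord max_card.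
have wi : injective (widen_ord Jk) by move=> a b [] /val_inj.
rewrite -{1}(card_ord #|J|) -(card_imset predT wi).
apply/subset_leq_card/fintype.subsetP => j /imsetP[i _ ->].
by rewrite finset.inE /=; exact: ltn_ord.
Qed.

Variables (d m : 'I_k -> R).
Local Open Scope ring_scope.
Let G (J : {set 'I_k}) := \prod_i (if i \in J then d i else m i).

(* Averaging over permutations: all [n]-subsets of the indices contribute
   equally to the expansion of [\prod_i (d i + m i)]. *)
Lemma sum_perm_split :
  k`!%:R * \prod_(i < k) (d i + m i) =
  \sum_(n < k.+1) 'C(k, n)%:R *
    \sum_(s : 'S_k) \prod_(i < k) (if (i < n)%N then d (s i) else m (s i)).
Proof.
have GE (s : 'S_k) (n : nat) : \prod_(i < k) (if (i < n)%N then d (s i) else m (s i)) =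
    G (s @: [set i : 'I_k | (i < n)%N]%SET).
  rewrite /G [RHS](reindex_perm s); apply: eq_bigr => i _.
  by rewrite (mem_imset _ _ (@perm_inj _ s)) finset.inE.
(* Reindexing by a permutation that carries the first [#|J|] indices onto [J] shows that the sum
   depends on the cardinal only. *)
have key (J : {set 'I_k}) : \sum_(s : 'S_k) G (s @: J) =
    \sum_(s : 'S_k) G (s @: [set i : 'I_k | (i < #|J|)%N]%SET).
  have [t tJ] := perm_onto J.
  rewrite [RHS](reindex_inj (mulgI t)); apply: eq_bigr => s _.
  congr G; rewrite -{1}tJ -imset_comp; apply: eq_imset => i /=.
  by rewrite permM.
transitivity (\sum_(n < k.+1) \sum_(J : {set 'I_k} | #|J| == n) k`!%:R * G J).
  rewrite bigA_distr/= mulr_sumr (partition_big (fun J : {set 'I_k} => inord #|J| : 'I_k.+1) predT)//=.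
  apply: eq_bigr => n _; apply: eq_bigl => J.
  have Jk : (#|J| < k.+1)%N by rewrite ltnS -[X in (_ <= X)%N]card_ord max_card.
  by rewrite -val_eqE/= inordK.
apply: eq_bigr => n _.
transitivity (\sum_(J : {set 'I_k} | #|J| == n) \sum_(s : 'S_k) G (s @: J)).
  rewrite [RHS]exchange_big/= [RHS](eq_bigr (fun=> \sum_(J : {set 'I_k} | #|J| == n) G J)).
    rewrite -mulr_sumr big_const iter_addr_0 mulr_natl; congr (_ *+ _).
    rewrite -[in LHS]card_Sn; apply: eq_card => s.
    by rewrite finset.inE.
  move=> s _; rewrite [LHS](reindex_inj (imset_inj (@perm_inj _ s^-1%g)))/=.
  rewrite (eq_bigl (fun J : {set 'I_k} => #|J| == n)); last first.
    by move=> J; rewrite card_imset//; exact: perm_inj.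
  apply: eq_bigr => J _; congr G; rewrite -imset_comp -[RHS]imset_id.
  by apply: eq_imset => i /=; rewrite permKV.
rewrite (eq_bigr (fun=> \sum_(s : 'S_k) \prod_(i < k) (if (i < n)%N then d (s i) else m (s i)))).
  rewrite sumr_const (_ : #|_| = 'C(k, n)) ?mulr_natl//.
  have := @card_draws 'I_k n; rewrite card_ord => <-.
  by apply: eq_card => J; rewrite finset.inE.
move=> J /eqP Jn; rewrite key Jn; apply: eq_bigr => s _; exact/esym/GE.
Qed.

End combinatorics.

Section symmetrization.
Context (R : realType) (dX : measure_display) (X : measurableType dX).
Context (mu : {sigma_finite_measure set X -> \bar R}).
Local Notation fmeas := (fmeas mu).

Definition sym_bx n (s : seq (bx R X n)) : seq (bx R X n) :=
  flatten [seq [seq ((b.1 / n`!%:R)%R, (fun i => b.2 (sigma i))) |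
    sigma : 'S_n <- enum 'S_n] | b : bx R X n <- s].

Lemma big_sym_bx n (s : seq (bx R X n)) (F : bx R X n -> R) :
  (\sum_(b <- sym_bx s) F b = \sum_(b <- s) \sum_(sigma : 'S_n)
     F ((b.1 / n`!%:R)%R, (fun i => b.2 (sigma i))))%R.
Proof.
rewrite /sym_bx big_flatten big_map; apply: eq_bigr => b _.
by rewrite big_map big_enum.
Qed.

Lemma box_perm n (B : 'I_n -> set X) (sigma : 'S_n) x :
  box (fun i => B (sigma i)) x <-> box B (permute_tuple sigma^-1%g x).
Proof.
split=> h i; first by rewrite tnth_mktuple; have := h (sigma^-1%g i); rewrite permKV.
by have := h (sigma i); rewrite tnth_mktuple permK.
Qed.

Lemma ev_sym_bx n (s : seq (bx R X n)) x :
  ev (sym_bx s) x = ((n`!%:R)^-1 * \sum_(sigma : 'S_n) ev s (permute_tuple sigma x))%R.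
Proof.
rewrite /ev big_sym_bx exchange_big/= mulr_sumr (reindex_inj invg_inj)/=.
apply: eq_bigr => sigma _; rewrite mulr_sumr; apply: eq_bigr => b _.
rewrite mulrCA mulrA; congr (_ * _)%R; rewrite !indicE; congr ((nat_of_bool _)%:R).
have := box_perm b.2 sigma^-1%g x; rewrite invgK => h.
by apply/idP/idP; rewrite !inE => /h.
Qed.

Lemma permute_tupleM n (s t : 'S_n) (x : n.-tuple X) :
  permute_tuple s (permute_tuple t x) = permute_tuple (s * t)%g x.
Proof. by apply: eq_from_tnth => i; rewrite !tnth_mktuple permM. Qed.

Lemma sym_bx_sym n (s : seq (bx R X n)) : symfun (ev (sym_bx s)).
Proof.
move=> t x; rewrite !ev_sym_bx; congr (_ * _)%R.
rewrite [RHS](reindex_inj (mulIg t)); apply: eq_bigr => sigma _.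
by rewrite permute_tupleM.
Qed.

Lemma uniq_permute n (s : 'S_n) (x : n.-tuple X) : uniq (permute_tuple s x) = uniq x.
Proof.
apply/tuple_uniqP/tuple_uniqP => h i j.
  move=> e.
  have := h (s^-1%g i) (s^-1%g j); rewrite !tnth_mktuple !permKV.
  by move=> /(_ e) /perm_inj ->.
by rewrite !tnth_mktuple => /h /perm_inj.
Qed.

Lemma sym_bx_offdiag n (s : seq (bx R X n)) : offdiag (ev s) -> offdiag (ev (sym_bx s)).
Proof.
move=> os x nx; rewrite ev_sym_bx big1 ?mulr0// => sigma _; apply: os.
by rewrite uniq_permute.
Qed.

Lemma fsides_sym_bx n (s : seq (bx R X n)) : fsides mu s -> fsides mu (sym_bx s).
Proof.
move=> fs b /flattenP[l /mapP[b' b's ->] /mapP[sigma _ ->]] i /=; exact: fs.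
Qed.

Section partial.
Context (n m k : nat) (e : (n + m)%N = k).

Definition lpart (q : 'I_n) : 'I_k := cast_ord e (lshift m q).
Definition rpart (l : 'I_m) : 'I_k := cast_ord e (rshift n l).

(** The candidate kernel of order [n] at the level of lists of boxes: the last [m] sides are
    integrated out, see [ev_part]. *)
Definition part (s : seq (bx R X k)) : seq (bx R X n) :=
  [seq (('C(k, n)%:R * b.1 * \prod_l fine (mu (b.2 (rpart l))))%R,
        (fun q => b.2 (lpart q))) | b : bx R X k <- s].

Lemma fsides_part s : fsides mu s -> fsides mu (part s).
Proof. by move=> fs b /mapP[b' bs ->] i /=; exact: fs. Qed.

Lemma indic_box_cat (B : 'I_k -> set X) (y : n.-tuple X) (x : m.-tuple X) :
  (\1_(box B) (cat_cast e (y, x)) =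
  \1_(box (fun q => B (lpart q))) y * \1_(box (fun l => B (rpart l))) x :> R)%R.
Proof.
rewrite -natrM !indicE mulnb; congr ((nat_of_bool _)%:R).
rewrite /lpart /rpart; move: B; case: k / e => B.
apply/idP/andP; rewrite !inE cat_castE.
  move=> h; split=> i.
    by have := h (lshift m i); rewrite tnth_lshift cast_ord_id.
  by have := h (rshift n i); rewrite tnth_rshift cast_ord_id.
move=> [h1 h2] i; rewrite -(splitK i); case: (fintype.split i) => j /=;
  rewrite ?tnth_lshift ?tnth_rshift.
  by have := h1 j; rewrite cast_ord_id.
by have := h2 j; rewrite cast_ord_id.
Qed.

Lemma ev_part s y : fsides mu s ->
  rintegrable (power_measure mu m) (fun x => ev s (cat_cast e (y, x))) /\
  ev (part s) y = ('C(k, n)%:R *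
    rint (power_measure mu m) (fun x => ev s (cat_cast e (y, x))))%R.
Proof.
move=> fs.
pose t := [seq ((b.1 * \1_(box (fun q => b.2 (lpart q))) y)%R,
  (fun l => b.2 (rpart l))) | b : bx R X k <- s] : seq (bx R X m).
have ft : fsides mu t by move=> b /mapP[b' bs ->] i /=; exact: fs.
have E : (fun x => ev s (cat_cast e (y, x))) = ev t.
  apply/funext => x; rewrite /ev big_map; apply: eq_bigr => b _.
  by rewrite indic_box_cat mulrA.
rewrite E; have [i ->] := rintegrable_ev ft; split => //.
rewrite /ev /Zint !big_map mulr_sumr; apply: eq_bigr => b _ /=.
by rewrite !mulrA mulrAC.
Qed.

Lemma part_offdiag s : fsides mu s -> offdiag (ev s) -> offdiag (ev (part s)).
Proof.
move=> fs os y ny; rewrite (ev_part y fs).2.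
rewrite (eq_rint _ (g := fun=> 0%R)) ?rint0 ?mulr0// => x.
apply: os; apply: contra ny; rewrite /cat_cast; case: k / e => /=.
by rewrite cat_uniq => /and3P[].
Qed.

Lemma part_sym s : fsides mu s -> symfun (ev s) -> symfun (ev (part s)).
Proof.
move=> fs ss sigma y; rewrite !(ev_part _ fs).2; congr (_ * _)%R.
apply: eq_rint => x.
suff [t ->] : exists t : 'S_k,
    cat_cast e (permute_tuple sigma y, x) = permute_tuple t (cat_cast e (y, x)).
  exact: ss.
case: k / e.
(* [sigma] acts on the first [n] coordinates and is extended by the identity on the others. *)
pose f (p : 'I_(n + m)) := unsplit (match fintype.split p with
  | inl q => inl (sigma q) | inr l => inr l end).
have fi : injective f.
  apply: (can_inj (g := fun p => unsplit (match fintype.split p with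
    | inl q => inl (sigma^-1%g q) | inr l => inr l end))) => p.
  rewrite /f unsplitK -[RHS]splitK; case: (fintype.split p) => q //=.
  by rewrite permK.
exists (perm fi); apply: eq_from_tnth => p; rewrite tnth_mktuple permE /f !cat_castE.
rewrite -[in LHS](splitK p); case: (fintype.split p) => q /=;
  by rewrite ?tnth_lshift ?tnth_rshift ?tnth_mktuple.
Qed.

End partial.
End symmetrization.

(** * Simplicity of the process *)

Section separating.
Context (R : realType) (dX : measure_display) (X : measurableType dX).

(** Everything that later arguments draw from [borel_space]: it makes points, diagonals and finer
    and finer finite partitions measurable. *)
Definition separating (B : nat -> set X) := (forall i, measurable (B i)) /\
  forall x y, (forall i, B i x <-> B i y) -> x = y.

(** Preimages of rational half-lines under the injection [phi]: distinct reals are separated by a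
    rational. Numbers that code no rational contribute the half-line at 0. *)
Lemma borel_separating : borel_space R X -> exists B, separating B.
Proof.
move=> [D [phi [psi [_ _ mphi _ [_ phiK _]]]]].
pose q i : R := if unpickle i is Some r then ratr (r : rat) else 0%R.
exists (fun i => phi @^-1` [set r | (r < q i)%R]); split.
  move=> i; rewrite -[X in measurable X]setTI; apply: mphi => //.
  rewrite (_ : [set r | (r < q i)%R] = `]-oo, q i[%classic); last first.
    by apply/seteqP; split=> r /=; rewrite in_itv.
  exact: measurable_itv.
move=> x y xy; apply: (can_inj phiK); apply/eqP; case: ltgtP => // h; exfalso.
  have [r] := rat_in_itvoo h; rewrite in_itv/= => /andP[h1 h2].
  have [/= /(_ _) hh _] := xy (pickle r); rewrite /q pickleK in hh.
  by have := hh h1; rewrite ltNge (ltW h2).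
have [r] := rat_in_itvoo h; rewrite in_itv/= => /andP[h1 h2].
have [/= _ hh] := xy (pickle r); rewrite /q pickleK in hh.
by have := hh h1; rewrite ltNge (ltW h2).
Qed.

Context (B : nat -> set X).
Hypothesis sB : separating B.

Lemma measurable_point (x : X) : measurable [set x].
Proof.
rewrite (_ : [set x] = \bigcap_i (if `[< B i x >] then B i else ~` B i)).
  apply: bigcapT_measurable => i; case: asboolP => _; first exact: sB.1.
  exact/measurableC/sB.1.
apply/seteqP; split=> y.
  by move=> -> i _; case: asboolP.
move=> h; apply: sB.2 => i; have := h i I.
by case: asboolP => hx; split.
Qed.

(** The partition of [X] generated by the first [m] sets of [B]; [code] returns the index of the
    cell of a point. *)
Definition sepcell m (c : {set 'I_m}) : set X :=
  [set x | forall i : 'I_m, (i \in c) = `[< B i x >]].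

Lemma measurable_sepcell m (c : {set 'I_m}) : measurable (sepcell c).
Proof.
rewrite (_ : sepcell c = \big[setI/setT]_(i < m) (if i \in c then B i else ~` B i)).
  apply: bigsetI_measurable => i _; case: ifP => _; first exact: sB.1.
  exact/measurableC/sB.1.
rewrite -bigcap_seq; apply/seteqP; split=> x /= h i.
  by move=> _; rewrite h; case: asboolP.
have /= := h i; rewrite mem_index_enum => /(_ isT).
by case: ifP => _ ?; [rewrite asboolT|rewrite asboolF].
Qed.

Definition code m (x : X) : {set 'I_m} := [set i : 'I_m | `[< B i x >]]%SET.

Lemma sepcellP m (c : {set 'I_m}) x : sepcell c x <-> code m x = c.
Proof.
split=> [h|<- i]; last by rewrite finset.inE.
by apply/setP => i; rewrite finset.inE -h.
Qed.

Lemma trivIset_sepcell m : trivIset setT (@sepcell m).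
Proof.
apply/trivIsetP => c c' _ _ cc'; apply/seteqP; split=> // x [/sepcellP h /sepcellP h'].
by move: cc'; rewrite -h -h' eqxx.
Qed.

Lemma bigcup_sepcell m (A : set X) : A = \bigcup_c (A `&` @sepcell m c).
Proof.
apply/seteqP; split=> x; last by move=> [c _ []].
by move=> Ax; exists (code m x) => //; split => //; apply/sepcellP.
Qed.

Lemma measure_sepcells m (nu : {measure set X -> \bar R}) A : measurable A ->
  nu A = \sum_(c : {set 'I_m}) nu (A `&` sepcell c).
Proof.
move=> mA; rewrite {1}(bigcup_sepcell m A) measure_fin_bigcup//; last 3 first.
- exact: finite_finset.
- apply/trivIsetP => c c' _ _ cc'; rewrite setIACA.
  by move/trivIsetP : (@trivIset_sepcell m) => ->//; rewrite setI0.
- by move=> c _; apply: measurableI => //; exact: measurable_sepcell.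
rewrite (_ : [set: {set 'I_m}] = [set` enum {set 'I_m}]); last first.
  by apply/seteqP; split=> c //= _; rewrite mem_enum.
by rewrite -fsbig_seq ?enum_uniq// big_enum.
Qed.

Section atoms_of_point_measure.
Context (xi : point_measure R X).

Lemma point_measure_lt2 A : measurable A -> xi A < 2%:E -> xi A = 0 \/ xi A = 1.
Proof.
move=> mA; have [->//|[n ->]] := point_measure_integer xi mA.
by rewrite lte_fin ltr_nat; case: n => [|[|]]// _; [left|right].
Qed.

(** Each [B i] splits the unit mass of [A] into 0 and 1. Intersecting over [i] the halves of mass 1
    loses only countably many null sets, and by separation the intersection cannot contain two
    points. *)
Lemma unit_atom A : measurable A -> xi A = 1 ->
  exists x, [/\ A x, xi [set x] = 1 & xi (A `\ x) = 0].
Proof.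
move=> mA A1.
have mAB i : measurable (A `&` B i) by apply: measurableI => //; exact: sB.1.
have mADB i : measurable (A `\` B i) by apply: measurableD => //; exact: sB.1.
have AD i : xi A = xi (A `\` B i) + xi (A `&` B i) by apply: measureDI => //; exact: sB.1.
have lt2 i : xi (A `&` B i) < 2%:E.
  by rewrite (@le_lt_trans _ _ 1)// ?lte_fin ?ltr1n// -A1 le_measure ?inE.
pose Q i := if `[< xi (A `&` B i) = 1 >] then B i else ~` B i.
have mQ i : measurable (Q i).
  by rewrite /Q; case: asboolP => _; [exact: sB.1|exact/measurableC/sB.1].
have Q0 i : xi (A `\` Q i) = 0.
  rewrite /Q; case: asboolP => [h|h].
    have := AD i; rewrite A1 h => /(congr1 (fun z => z - 1)).
    by rewrite addeK// subee.
  rewrite setDE setCK; have [//|] := point_measure_lt2 (mAB i) (lt2 i).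
  by [].
pose A' := A `&` \bigcap_i Q i.
have mA' : measurable A' by apply: measurableI => //; exact: bigcapT_measurable.
have D0 : xi (A `\` A') = 0.
  apply/eqP; rewrite eq_le measure_ge0 andbT.
  have -> : A `\` A' = \bigcup_i (A `\` Q i).
    apply/seteqP; split=> [x [Ax nA'x]|x [i _ [Ax nQ]]]; last first.
      by split => // -[_ /(_ i I)].
    apply: contrapT => h; apply: nA'x; split => // i _.
    by apply: contrapT => nQ; apply: h; exists i.
  have <- : \sum_(i <oo) xi (A `\` Q i) = 0 by apply: eseries0 => i _ _; exact: Q0.
  apply: measure_sigma_subadditive => //.
  - by move=> i; exact: measurableD.
  - by apply: bigcup_measurable => i _; exact: measurableD.
have A'1 : xi A' = 1.
  have : xi A = xi (A `\` A') + xi (A `&` A') by apply: measureDI.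
  by rewrite D0 add0e A1 setIidr//; exact: subIsetl.
have [x A'x] : A' !=set0.
  by apply/set0P/eqP => A'0; move: A'1; rewrite A'0 measure0 => -[] /eqP; rewrite eq_sym oner_eq0.
have A'E : A' = [set x].
  apply/seteqP; split=> y; last by move=> ->.
  move=> A'y; apply: sB.2 => i; have := A'x.2 i I; have := A'y.2 i I.
  by rewrite /Q; case: asboolP => _ ? ?; split.
by exists x; split; [exact: A'x.1|rewrite -A'E|rewrite -A'E].
Qed.

(** By integrality the part of [A] in each cell has mass 0 or 1, and in the latter case it holds
    exactly one point of [xi] by [unit_atom]; these points are gathered over the cells. *)
Lemma count_atoms A m : measurable A -> 
  (forall c : {set 'I_m}, xi (A `&` sepcell c) < 2%:E) ->
  exists l : seq X, [/\ uniq l, forall x, x \in l <-> A x /\ 0 < xi [set x] &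
    xi A = (size l)%:R%:E].
Proof.
move=> mA lt2.
have mAc (c : {set 'I_m}) : measurable (A `&` sepcell c).
  by apply: measurableI => //; exact: measurable_sepcell.
have /choice[l hl] : forall c : {set 'I_m}, exists l : seq X,
    [/\ uniq l, forall x, x \in l <-> (A `&` sepcell c) x /\ 0 < xi [set x] &
    xi (A `&` sepcell c) = (size l)%:R%:E].
  move=> c; have [h0|h1] := point_measure_lt2 (mAc c) (lt2 c).
    exists [::]; split=> // x; split=> // -[cx]; rewrite lt_neqAle => /andP[+ _].
    rewrite eq_sym => /eqP; case; apply/eqP; rewrite eq_le measure_ge0 andbT -h0.
    by apply: le_measure; rewrite ?inE//; [exact: measurable_point|move=> _ ->].
  have [x [Ax x1 Ax0]] := unit_atom (mAc c) h1.
  exists [:: x]; split=> // y; rewrite inE; split=> [/eqP ->|[Ay y0]].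
    by rewrite x1.
  apply: contraPT y0 => yx; apply/negP; rewrite -leNgt -Ax0.
  apply: le_measure; rewrite ?inE; [exact: measurable_point| |].
    by apply: measurableD => //; exact: measurable_point.
  by move=> _ ->; split=> //; apply/eqP.
exists (flatten [seq l c | c <- enum {set 'I_m}]).
have codeE c x : x \in l c -> code m x = c.
  by have [_ h _] := hl c => /h[[_ /sepcellP]].
have mem x : x \in flatten [seq l c | c <- enum {set 'I_m}] <-> x \in l (code m x).
  split=> [/flattenP[s /mapP[c _ ->] xl]|xl]; first by rewrite (codeE _ _ xl).
  by apply/flattenP; exists (l (code m x)) => //; apply: map_f; rewrite mem_enum.
split.
- have : uniq (enum {set 'I_m}) by exact: enum_uniq.
  elim: (enum _) => //= c s IH /andP[cs us]; rewrite cat_uniq (IH us).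
  have [-> _ _] := hl c; rewrite andbT/=; apply/hasPn => x /flattenP[t /mapP[c' c's ->] xl].
  apply/negP => xc; move: cs; rewrite -(codeE _ _ xc) (codeE _ _ xl).
  by rewrite c's.
- move=> x; apply: (iff_trans (mem x)); have [_ h _] := hl (code m x).
  apply: (iff_trans (h x)); split=> [[[]]//|[Ax x0]].
  by split => //; split => //; apply/sepcellP.
- rewrite (measure_sepcells m _ mA) size_flatten /shape -map_comp sumnE big_map natr_sum.
  rewrite -sumEFin big_enum/=; apply: eq_bigr => c _.
  by have [_ _ ->] := hl c.
Qed.

End atoms_of_point_measure.
End separating.

Section simplicity.
Context (R : realType) (dX dO : measure_display) (X : measurableType dX).
Context (Omega : measurableType dO).
Context (mu : {sigma_finite_measure set X -> \bar R}).
Context (P : probability Omega R) (eta : {RV P >-> point_measure R X}).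
Hypothesis eta_poisson : poisson_process mu eta.
Hypothesis mu_nonatomic : nonatomic mu.
Context (B : nat -> set X).
Hypothesis sB : separating B.
Local Notation fmeas := (fmeas mu).
Local Notation num := (count_in eta).
Local Notation sepcell := (sepcell B).
Local Notation code := (code B).

Lemma nonatomic_point x : mu [set x] = 0.
Proof.
apply/eqP; rewrite eq_le measure_ge0 andbT leNgt; apply/negP => h.
have [A [mA /subset_set1[->|->] A0 Ax]] := mu_nonatomic (measurable_point sB x) h.
  by move: A0; rewrite measure0 ltxx.
by move: Ax; rewrite ltxx.
Qed.

(** The pairs that the first [m] sets fail to separate; as [m] grows they shrink to the diagonal of
    [A]. *)
Definition near_diag (A : set X) m : set (X * X) :=
  [set z | [/\ A z.1, A z.2 & code m z.1 = code m z.2]].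

Lemma near_diagE A m : near_diag A m =
  \bigcup_c ((A `&` @sepcell m c) `*` (A `&` sepcell c)).
Proof.
apply/seteqP; split=> -[x y] /=.
  move=> [Ax Ay e]; exists (code m x) => //.
  by split; (split; [by []|apply/sepcellP]).
by move=> [c _ [[Ax /sepcellP cx] [Ay /sepcellP cy]]]; split=> //; rewrite cx cy.
Qed.

Lemma measurable_near_diag A m : measurable A -> measurable (near_diag A m).
Proof.
move=> mA; rewrite near_diagE; apply: fin_bigcup_measurable; first exact: finite_finset.
by move=> c _; apply: measurableX; apply: measurableI => //; exact: measurable_sepcell.
Qed.

Lemma near_diag_measure A m : fmeas A ->
  (mu \x mu) (near_diag A m) = (\sum_(c : {set 'I_m}) fine (mu (A `&` sepcell c)) ^+ 2)%:E.
Proof.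
move=> fA.
have fAc c : fmeas (A `&` @sepcell m c).
  have mAc : measurable (A `&` @sepcell m c).
    by apply: measurableI; [exact: fA.1|exact: measurable_sepcell].
  split => //; apply: le_lt_trans fA.2; apply: le_measure; rewrite ?inE//.
  exact: fA.1.
rewrite near_diagE measure_fin_bigcup//; last 3 first.
- exact: finite_finset.
- apply/trivIsetP => c c' _ _ cc'; apply/seteqP; split=> // -[x y] /=.
  move=> [[[_ /sepcellP h] _] [[_ /sepcellP h'] _]].
  by move: cc'; rewrite -h -h' eqxx.
- by move=> c _; apply: measurableX; exact: (fAc c).1.
rewrite (_ : [set: {set 'I_m}] = [set` enum {set 'I_m}]); last first.
  by apply/seteqP; split=> c //= _; rewrite mem_enum.
rewrite -fsbig_seq ?enum_uniq// big_enum -sumEFin; apply: eq_bigr => c _.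
rewrite [LHS](product_measure1E mu mu (fAc c).1 (fAc c).1).
by rewrite expr2 EFinM -(fmeasE (fAc c)).
Qed.

(** Each section of the intersection is contained in a singleton, which is null by nonatomicity.
    Continuity from above applies since level 0 has finite mass, the square of [mu A]. *)
Lemma near_diag_cvg A : fmeas A -> (mu \x mu) (near_diag A m) @[m --> \oo] --> 0.
Proof.
move=> fA.
have mF m := @measurable_near_diag A m fA.1.
have <- : (mu \x mu) (\bigcap_m near_diag A m) = 0.
  rewrite /product_measure1; apply: integral0_eq => x _ /=.
  apply/eqP; rewrite eq_le measure_ge0 andbT -(nonatomic_point x).
  have sub : xsection (\bigcap_m near_diag A m) x `<=` [set x].
    move=> y /xsectionP h; apply: sB.2 => i.
    have [_ _ /setP/(_ ord_max)] := h i.+1 I.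
    by rewrite !finset.inE /= => e; split=> /asboolP; [rewrite -e|rewrite e] => /asboolP.
  apply: le_measure => //; rewrite inE; last exact: (measurable_point sB x).
  by apply: measurable_xsection; exact: bigcapT_measurable.
apply: nonincreasing_cvg_mu => //.
- by rewrite [X in X < _](near_diag_measure 0 fA) ltry.
- exact: bigcapT_measurable.
- move=> m n mn; apply/subsetPset => -[x y] [Ax Ay e]; split => //=.
  apply/setP => i; move/setP : e => /(_ (widen_ord mn i)).
  by rewrite !finset.inE.
Qed.

(* Some cell of level [m] contains two points; the expected number of such ordered pairs
   is the mass of [near_diag A m]. *)
Definition crowded (A : set X) m : set Omega :=
  [set w | exists c : {set 'I_m}, 2%:E <= eta w (A `&` sepcell c)].

Lemma measurable_crowded A m : measurable A -> measurable (crowded A m).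
Proof.
move=> mA; have -> : crowded A m = \bigcup_c [set w | 2%:E <= eta w (A `&` @sepcell m c)].
  by apply/seteqP; split=> w [c]; [exists c|move=> _; exists c].
apply: fin_bigcup_measurable; first exact: finite_finset.
move=> c _; rewrite -[X in measurable X]setTI; apply: measurable_fun_lee => //.
by apply: measurable_count; apply: measurableI => //; exact: measurable_sepcell.
Qed.

(** Markov's inequality for the sum over cells of [N ^+ 2 - N], which is at least 1 as soon as one
    integer count [N] is at least 2, and whose mean is the sum of the squared masses. *)
Lemma crowded_le A m : fmeas A -> P (crowded A m) <= (mu \x mu) (near_diag A m).
Proof.
move=> fA; rewrite near_diag_measure//.
have fAc c : fmeas (A `&` @sepcell m c).
  have mAc : measurable (A `&` @sepcell m c).
    by apply: measurableI; [exact: fA.1|exact: measurable_sepcell].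
  split => //; apply: le_lt_trans fA.2; apply: le_measure; rewrite ?inE//.
  exact: fA.1.
pose N c w := num (A `&` @sepcell m c) w.
have iN c : rintegrable P (fun w => N c w ^+ 2 - N c w)%R.
  apply: rintegrableB; first exact: (rint_num_sqr eta_poisson (fAc c)).1.
  exact: (rintegrable_num eta_poisson (fAc c)).
have rN c : rint P (fun w => N c w ^+ 2 - N c w)%R = (fine (mu (A `&` @sepcell m c)) ^+ 2)%R.
  have [i2 e2] := rint_num_sqr eta_poisson (fAc c).
  rewrite rintB//; last exact: (rintegrable_num eta_poisson (fAc c)).
  by rewrite e2 (rint_num eta_poisson (fAc c)) addrAC subrr add0r.
pose H w := (\sum_(c <- enum {set 'I_m}) 1 * (N c w ^+ 2 - N c w))%R.
have iH : rintegrable P H := rintegrable_sum (enum {set 'I_m}) (fun=> 1%R) iN.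
have <- : rint P H = (\sum_(c : {set 'I_m}) fine (mu (A `&` sepcell c)) ^+ 2)%R.
  by rewrite (rint_sum _ (fun=> 1%R) iN) big_enum; apply: eq_bigr => c _; rewrite mul1r rN.
have mC := @measurable_crowded A m fA.1.
rewrite -(rintE iH) -(setIT (crowded A m)) -integral_indic// [X in X <= _](_ : _ =
  \int[P]_w (\1_(crowded A m) w)%:E)//.
have Hnat w : (forall c, exists n, num (A `&` @sepcell m c) w = n%:R) -> forall c,
    (0 <= N c w ^+ 2 - N c w)%R.
  move=> h c; have [[|n] hn] := h c; rewrite /N hn; first by rewrite expr2 mulr0 subr0.
  by rewrite expr2 -{3}(mul1r n.+1%:R) -mulrBl mulr_ge0// subr_ge0 ler1n.
have nat_ae : \forall w \ae P, forall c : {set 'I_m}, exists n,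
    eta w (A `&` sepcell c) = n%:R%:E /\ num (A `&` sepcell c) w = n%:R.
  by apply: filter_forall => c; exact: (num_nat_ae eta_poisson (fAc c)).
have H0 : \forall w \ae P, (0 <= H w)%R.
  apply: filterS nat_ae => w h; apply: sumr_ge0 => c _; rewrite mul1r; apply: Hnat.
  by move=> c'; have [n [_ hn]] := h c'; exists n.
have mH := rintegrable_meas iH.
(* [H] is known to be nonnegative only where the counts are integers, that is almost surely; the
   comparison of integrals asks for it everywhere. *)
rewrite (ae_eq_integral (fun w => (Num.max 0 (H w))%:E))//; last 3 first.
- exact/measurable_EFinP.
- by apply/measurable_EFinP; exact: measurable_maxr.
- by apply: filterS H0 => w h _; rewrite max_r.
apply: ae_ge0_le_integral => //.
- by apply/measurable_EFinP; exact: measurable_indic.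
- by move=> w _; rewrite lee_fin le_max lexx.
- by apply/measurable_EFinP; exact: measurable_maxr.
apply: filterS2 H0 nat_ae => w h0 h _; rewrite lee_fin max_r// indicE.
case: (pselect (crowded A m w)) => [cw|ncw]; last by rewrite memNset.
rewrite mem_set//; have [c hc] := cw.
have hH : (0 <= H w - (N c w ^+ 2 - N c w))%R.
  rewrite /H big_enum/= (bigD1 c)//= mul1r addrAC subrr add0r.
  apply: sumr_ge0 => c' _; rewrite mul1r; apply: Hnat.
  by move=> c''; have [n [_ hn]] := h c''; exists n.
rewrite (@le_trans _ _ (N c w ^+ 2 - N c w)%R)//; last by rewrite -subr_ge0.
have [n [e hn]] := h c; move: hc; rewrite e lee_fin ler_nat => n2.
rewrite /N hn expr2 -{3}(mul1r n%:R) -mulrBl.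
case: n n2 {e hn} => [|[|n]]// _.
by rewrite mulr_ege1 ?ler1n// lerBrDr -natr1 -natr1 -addrA lerDr.
Qed.

(** An exceptional [w] is crowded at every level, and the probability of being crowded tends to 0
    with the level. *)
Lemma simple_ae A : fmeas A ->
  \forall w \ae P, exists m, forall c : {set 'I_m}, eta w (A `&` sepcell c) < 2%:E.
Proof.
move=> fA; exists (\bigcap_m crowded A m); split.
- by apply: bigcapT_measurable => m; apply: measurable_crowded; exact: fA.1.
- apply/eqP; rewrite eq_le measure_ge0 andbT.
  have h := near_diag_cvg fA; rewrite -(cvg_lim _ h)//.
  apply: lime_ge; first by apply/cvg_ex; exists 0.
  apply: nearW => m; apply: le_trans (crowded_le m fA).
  apply: le_measure; rewrite ?inE.
  + by apply: bigcapT_measurable => m'; apply: measurable_crowded; exact: fA.1.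
  + by apply: measurable_crowded; exact: fA.1.
  + exact: bigcap_inf.
- move=> w /= h m _; apply: contrapT => h2; apply: h; exists m => c.
  by rewrite ltNge; apply/negP => h3; apply: h2; exists c.
Qed.

Lemma points_ae A : fmeas A -> \forall w \ae P, exists l : seq X,
  [/\ uniq l, forall x, x \in l <-> A x /\ 0 < eta w [set x] &
  num A w = (size l)%:R].
Proof.
move=> fA; apply: filterS (simple_ae fA) => w [m h].
have [l [ul ml el]] := count_atoms sB fA.1 h.
by exists l; split=> //; rewrite /count_in el.
Qed.

End simplicity.

(** * Counting tuples with entries in given lists *)

Section tuples_from_lists.
Context (R : realType) (X : choiceType) (k : nat).

(** All lists are embedded in one list [U], so that tuples become finite functions into ['I_N] and
    the count distributes as a product of sums. Order 0 and empty [U] are treated apart, since [nth]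
    needs a default point. *)
Lemma esum_tuples (c : R) (l : 'I_k -> seq X) : (0 <= c)%R -> (forall i, uniq (l i)) ->
  \esum_(t in [set t : k.-tuple X | forall i, tnth t i \in l i]) c%:E =
  (c * \prod_(i < k) (size (l i))%:R : R)%:E.
Proof.
move=> c0 ul; case: k l ul => [|k'] l ul.
  rewrite big_ord0 mulr1 (_ : [set t | _] = [set [tuple]]); last first.
    by apply/seteqP; split=> t /=; [rewrite tuple0|move=> _ []].
  by rewrite esum_set1.
pose U := undup (flatten [seq l i | i <- enum 'I_k'.+1]).
have memU i x : x \in l i -> x \in U.
  move=> xl; rewrite mem_undup; apply/flattenP; exists (l i) => //.
  by apply: map_f; rewrite mem_enum.
case: (eqVneq U [::]) => [U0|].
  have l0 i : l i = [::] by case: (l i) (memU i) => // x s /(_ x (mem_head _ _)); rewrite U0.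
  rewrite (_ : [set t | _] = set0) ?esum_set0 ?big_ord_recl ?l0 ?mul0r ?mulr0//.
  by apply/seteqP; split=> t //= /(_ ord0); rewrite l0.
case EU : U => [//|x0 U'] _ {EU U'}.
pose N := size U; pose tf (f : {ffun 'I_k'.+1 -> 'I_N}) := [tuple nth x0 U (f i) | i < k'.+1].
have tfI : injective tf.
  move=> f g e; apply/ffunP => i; have := congr1 (fun t => tnth t i) e.
  rewrite !tnth_mktuple => /eqP; rewrite nth_uniq ?ltn_ord ?undup_uniq// => /eqP.
  exact: val_inj.
pose good (f : {ffun 'I_k'.+1 -> 'I_N}) := [forall i, nth x0 U (f i) \in l i].
pose L := [seq tf f | f <- enum {ffun 'I_k'.+1 -> 'I_N} & good f].
have -> : [set t : k'.+1.-tuple X | forall i, tnth t i \in l i] = [set` L].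
  apply/seteqP; split=> t /=.
    move=> h; have hU i : (index (tnth t i) U < N)%N by rewrite index_mem; exact: memU (h i).
    apply/mapP; exists [ffun i => Ordinal (hU i)].
      rewrite mem_filter mem_enum andbT; apply/forallP => i.
      by rewrite ffunE /= nth_index//; exact: memU (h i).
    by apply: eq_from_tnth => i; rewrite tnth_mktuple ffunE /= nth_index//; exact: memU (h i).
  move=> /mapP[f]; rewrite mem_filter => /andP[/forallP gf _] -> i.
  by rewrite tnth_mktuple.
rewrite esum_fset; [|exact: finite_seq|by move=> *; rewrite lee_fin].
rewrite -fsbig_seq; last by rewrite map_inj_uniq// filter_uniq// enum_uniq.
rewrite sumEFin; congr EFin; have -> : (\sum_(t <- L) c = c * \sum_(t <- L) 1)%R.
  by rewrite mulr_sumr; apply: eq_bigr => t _; rewrite mulr1.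
congr (_ * _)%R; rewrite big_map big_filter big_enum_cond/= big_mkcond/=.
transitivity (\sum_(f : {ffun 'I_k'.+1 -> 'I_N}) \prod_i (nth x0 U (f i) \in l i)%:R : R)%R.
  apply: eq_bigr => f _; rewrite /good; case: forallP => [h|h].
    by rewrite big1// => i _; rewrite h.
  have /existsNP[i hi] := h.
  by rewrite (bigD1 i)//= (negPf (introN idP hi)) mul0r.
rewrite -(bigA_distr_bigA (fun i (u : 'I_N) => (nth x0 U u \in l i)%:R%R))/=.
apply: eq_bigr => i _.
rewrite -(big_mkord predT (fun u => (nth x0 U u \in l i)%:R%R)) -(big_nth x0 predT (fun x => (x \in l i)%:R%R)).
rewrite -natr_sum; congr (_%:R); rewrite -(@perm_size _ [seq x <- U | x \in l i]).
  by rewrite size_filter -sum1_count [RHS]big_mkcond; apply: eq_bigr => x _; case: (_ \in _).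
apply: uniq_perm; rewrite ?filter_uniq ?undup_uniq// => x.
by rewrite mem_filter; case: (boolP (x \in l i)) => // /memU ->.
Qed.

End tuples_from_lists.

(** A single enumeration of a double series through the pairing [pickle]; numbers that code no pair
    contribute 0. It serves to merge countably many covers into one. *)
Lemma nneseries_pair (R : realType) (a : nat -> nat -> \bar R) :
  (forall i j, 0 <= a i j) ->
  \sum_(n <oo) (if pickle_inv n is Some p then a p.1 p.2 else 0) =
  \sum_(i <oo) \sum_(j <oo) a i j.
Proof.
move=> a0; rewrite nneseries_esumT; last by move=> n; case: (pickle_inv n).
under [RHS]eq_eseriesr => i _ do rewrite nneseries_esumT//.
rewrite nneseries_esumT; last by move=> i; exact: esum_ge0.
rewrite esum_esum//.
rewrite (esumID [set n | exists p : nat * nat, n = pickle p]); last first.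
  by move=> n _; case: (pickle_inv n).
rewrite [X in _ + X]esum1 ?adde0; last first.
  move=> n [_ h]; case e : (pickle_inv n) => [p|//]; exfalso; apply: h; exists p.
  by have := @pickle_invK (nat * nat)%type n; rewrite e.
rewrite setTI (@reindex_esum _ _ _ [set: nat * nat] _ pickle).
  rewrite (_ : [set: nat * nat] = [set: nat] `*`` (fun=> [set: nat])).
    by apply: eq_esum => p _; rewrite pickleK_inv.
  by apply/seteqP; split.
split.
- by move=> p _; exists p.
- by move=> p q _ _; exact: (pcan_inj pickleK).
- by move=> n [p ->]; exists p.
Qed.

(** * Approximation by step functions off the diagonals *)

Section covers.
Context (R : realType) (dX : measure_display) (X : measurableType dX).
Context (mu : {sigma_finite_measure set X -> \bar R}) (k : nat).
Local Notation fmeas := (fmeas mu).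
Implicit Types (g f : k.-tuple X -> R) (s : seq (bx R X k)).

(** Disjoint sides keep the box off the diagonals; moreover one point from each side always makes a
    tuple of distinct points, so the sum of the indicator over such tuples is a product of
    counts. *)
Definition gbox (B : 'I_k -> set X) :=
  (forall i, fmeas (B i)) /\ (forall i j, i != j -> B i `&` B j = set0).

Definition gseq s := forall b, b \in s -> gbox b.2.

Definition bmass (B : 'I_k -> set X) : R := (\prod_i fine (mu (B i)))%R.

(* Unlike the [L^1] norm of [g], a pointwise majorant off the diagonals also
   controls the sum of [g] over the distinct points of [eta]. *)
Definition cov g (e : R) := exists (c : nat -> R) (B : nat -> 'I_k -> set X),
  [/\ forall m, (0 <= c m)%R, forall m, gbox (B m),
    forall x : k.-tuple X, uniq x -> (g x)%:E <= \sum_(m <oo) (c m * \1_(box (B m)) x)%:E &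
    \sum_(m <oo) (c m * bmass (B m))%:E <= e%:E].

Lemma bmass_ge0 B : (0 <= bmass B)%R.
Proof. by apply: prodr_ge0 => i _; exact: fine_ge0. Qed.

Lemma fmeas_set0 : fmeas set0.
Proof. by split => //; rewrite measure0. Qed.

Lemma gbox_set0 : gbox (fun=> set0).
Proof. by split=> [i|i j _]; [exact: fmeas_set0|rewrite set0I]. Qed.

Lemma gbox_uniq B x : gbox B -> box B x -> uniq x.
Proof.
move=> [_ dB] Bx; apply/tuple_uniqP => i j e; apply/eqP; apply: contraT => ij.
have := dB i j ij => /seteqP[/(_ (tnth x i))]; rewrite /= {2}e.
by move=> /(_ (conj (Bx i) (Bx j))).
Qed.

Lemma gseq_offdiag s : gseq s -> offdiag (ev s).
Proof.
move=> gs x nx; rewrite /ev big1_seq// => b /= bs.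
rewrite indicE memNset ?mulr0// => bx; move/negP : nx; apply.
exact: gbox_uniq (gs b bs) bx.
Qed.

Lemma gseq_fsides s : gseq s -> fsides mu s.
Proof. by move=> gs b /gs[]. Qed.

Lemma gseq_cat s t : gseq s -> gseq t -> gseq (s ++ t).
Proof. by move=> hs ht b; rewrite mem_cat => /orP[/hs|/ht]. Qed.

Lemma gseq_scale a s : gseq s -> gseq (scale_bx a s).
Proof. by move=> hs b /mapP[b' /hs h ->]. Qed.

Lemma cov_le g g' e e' : (forall x : k.-tuple X, uniq x -> g x <= g' x)%R -> (e' <= e)%R ->
  cov g' e' -> cov g e.
Proof.
move=> gg ee [c [B [c0 gB h1 h2]]]; exists c, B; split=> // [x ux|].
  by apply: le_trans (h1 x ux); rewrite lee_fin gg.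
by apply: le_trans h2 _; rewrite lee_fin.
Qed.

(** The boxes of all covers are listed in one sequence by [nneseries_pair], padded with terms of
    weight 0. *)
Lemma cov_series (g_ : nat -> k.-tuple X -> R) (e_ : nat -> R) g e :
  (forall i, cov (g_ i) (e_ i)) ->
  (forall x : k.-tuple X, uniq x -> (g x)%:E <= \sum_(i <oo) (g_ i x)%:E) ->
  (forall i x, 0 <= g_ i x)%R -> (forall i, 0 <= e_ i)%R ->
  \sum_(i <oo) (e_ i)%:E <= e%:E -> cov g e.
Proof.
move=> cg hg g0 e0 he.
have /choice[c /choice[B h]] := cg.
pose c' n := if pickle_inv n is Some p then c (p : nat * nat).1 p.2 else 0%R.
pose B' n := if pickle_inv n is Some p then B (p : nat * nat).1 p.2 else fun=> set0.
exists c', B'; split.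
- by move=> n; rewrite /c'; case: (pickle_inv n) => // p; have [] := h p.1.
- move=> n; rewrite /B'; case: (pickle_inv n) => [p|]; last exact: gbox_set0.
  by have [] := h p.1.
- move=> x ux; apply: (le_trans (hg x ux)).
  apply: (@le_trans _ _ (\sum_(i <oo) \sum_(m <oo) (c i m * \1_(box (B i m)) x)%:E)).
    apply: lee_nneseries => i _; first by rewrite lee_fin.
    by have [_ _ + _] := h i; exact.
  rewrite -nneseries_pair; last first.
    by move=> i j; rewrite lee_fin mulr_ge0//; have [] := h i.
  rewrite le_eqVlt; apply/orP; left; apply/eqP/eq_eseriesr => n _.
  by rewrite /c' /B'; case: (pickle_inv n) => //; rewrite mul0r.
- rewrite (@eq_eseriesr _ _ (fun n => if pickle_inv n is Some p then
      (c (p : nat * nat).1 p.2 * bmass (B p.1 p.2))%:E else 0)); last first.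
    by move=> n _; rewrite /c' /B'; case: (pickle_inv n) => //; rewrite mul0r.
  rewrite (nneseries_pair (a := fun i j => (c i j * bmass (B i j))%:E)); last first.
    by move=> i j; rewrite lee_fin mulr_ge0 ?bmass_ge0//; have [] := h i.
  apply: le_trans he; apply: lee_nneseries => i _.
    by move=> _; apply: nneseries_ge0 => j _ _; rewrite lee_fin mulr_ge0 ?bmass_ge0//; have [] := h i.
  by have [] := h i.
Qed.

Lemma cov_box c B : (0 <= c)%R -> gbox B -> cov (fun x => c * \1_(box B) x)%R (c * bmass B).
Proof.
move=> c0 gB; exists (fun n => if n == 0%N then c else 0%R), (fun=> B); split=> //.
- by move=> n; case: ifP.
- move=> x _; rewrite (@nneseriesD1 _ _ 0%N)//=.
    by rewrite eseries0 ?adde0// => n _ /negPf ->; rewrite mul0r.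
  by move=> n _; case: ifP => _; rewrite lee_fin mulr_ge0.
- rewrite (@nneseriesD1 _ _ 0%N)//=.
    by rewrite eseries0 ?adde0// => n _ /negPf ->; rewrite mul0r.
  by move=> n _; case: ifP => _; rewrite lee_fin mulr_ge0 ?bmass_ge0.
Qed.

Lemma cov0 : cov (fun=> 0%R) 0%R.
Proof.
by apply: (cov_le _ _ (cov_box (lexx 0%R) gbox_set0)) => [x _|]; rewrite mul0r.
Qed.

Lemma cov_add g g' e e' : (forall x, 0 <= g x)%R -> (forall x, 0 <= g' x)%R ->
  (0 <= e)%R -> (0 <= e')%R -> cov g e -> cov g' e' -> cov (fun x => g x + g' x)%R (e + e')%R.
Proof.
move=> g0 g'0 e0 e'0 cg cg'.
have two (a b : R) : (0 <= a)%R -> (0 <= b)%R ->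
  \sum_(i <oo) (nth 0%R [:: a; b] i)%:E = (a + b)%:E.
  move=> a0 b0.
  have p i : 0 <= (nth 0%R [:: a; b] i)%:E by rewrite lee_fin; case: i => [|[|[]]].
  rewrite (@nneseriesD1 _ _ 0%N)// (@nneseriesD1 _ _ 1%N)//=.
  rewrite eseries0 ?adde0 ?EFinD// => i _ /=.
  by case: i => [|[|i]]//= _; rewrite nth_nil.
apply: (@cov_series (fun i x => nth 0%R [:: g x; g' x] i) (nth 0%R [:: e; e'])).
- by move=> [|[|i]]//=; apply: (cov_le _ _ cov0) => [x _|]; rewrite nth_nil.
- by move=> x _; rewrite two.
- by move=> [|[|i]] x //=; rewrite nth_nil.
- by move=> [|[|i]] //=; rewrite nth_nil.
- by rewrite two.
Qed.

Lemma cov_nonneg_seq s : gseq s -> (forall b, b \in s -> 0 <= b.1)%R ->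
  cov (ev s) (Zint (fun _ B => fine (mu B)) s).
Proof.
elim: s => [|b s IH] gs s0.
  apply: (cov_le _ _ cov0) => [x _|]; first by rewrite /ev big_nil.
  by rewrite /Zint big_nil.
have sub b' : b' \in s -> b' \in b :: s by rewrite inE => ->; rewrite orbT.
have b0 : (0 <= b.1)%R by apply: s0; rewrite mem_head.
have := cov_add _ _ _ _ (cov_box b0 (gs b (mem_head _ _))) (IH (fun b' h => gs b' (sub b' h))
   (fun b' h => s0 b' (sub b' h))).
rewrite /bmass /Zint !big_cons => h.
rewrite (_ : ev (b :: s) = fun x => (b.1 * \1_(box b.2) x + ev s x)%R); last first.
  by apply/funext => x; rewrite /ev big_cons.
apply: h.
- by move=> x; rewrite mulr_ge0.
- move=> x; rewrite /ev big_seq; apply: sumr_ge0 => b' bs.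
  by rewrite mulr_ge0// s0// sub.
- by rewrite mulr_ge0//; exact: bmass_ge0.
- rewrite big_seq; apply: sumr_ge0 => b' bs; rewrite mulr_ge0 ?s0 ?sub//.
  exact: bmass_ge0.
Qed.

Local Notation muk := (power_measure mu k).

(* On disjoint cells, the cover by the cells themselves is exact. *)
Lemma cov_norm_ev s : gseq s -> cov (fun x => `|ev s x|)%R (rint muk (fun x => `|ev s x|)%R).
Proof.
move=> gs; have [K [C [aC sC]]] := exists_atoms_seq (gseq_fsides gs).
have sg := simple_on_ev aC sC.
have sn : simple_on C (fun x => `|ev s x|%R).
  exact: (simple_on_comp2 (G := fun x _ => `|x|%R) (normr0 _) sg sg).
pose a := coef C (fun x => `|ev s x|%R).
(* Only cells with distinct atoms are kept: the others are not admissible in a cover, and their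
   coefficient is 0. *)
pose t : seq (bx R X k) := [seq (a j, fun i => C (j i)) |
   j : {ffun 'I_k -> K} <- enum {ffun 'I_k -> K} & injectiveb j].
have on : offdiag (fun x => `|ev s x|%R).
  by move=> x nx; rewrite (gseq_offdiag gs)// normr0.
have bigt (F : bx R X k -> R) : (forall j : {ffun 'I_k -> K}, ~~ injectiveb j -> F (a j, fun i => C (j i)) = 0)%R ->
    (\sum_(b <- t) F b = \sum_(b <- aseq C a) F b)%R.
  move=> F0; have -> : (\sum_(b <- aseq C a) F b = \sum_j F (a j, fun i => C (j i)))%R.
    by rewrite /aseq big_map big_enum.
  rewrite /t big_map big_filter big_enum_cond/=.
  rewrite [RHS](bigID (fun j : {ffun 'I_k -> K} => injectiveb j))/=.
  by rewrite [X in (_ + X)%R]big1 ?addr0.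
have a0 (j : {ffun 'I_k -> K}) : ~~ injectiveb j -> a j = 0%R by exact: coef_offdiag.
have -> : (fun x => `|ev s x|)%R = ev t.
  apply/funext => x; rewrite (simple_onE aC x sn) /ev bigt// => j /a0 ->.
  by rewrite mul0r.
have -> : rint muk (ev t) = Zint (fun _ B => fine (mu B)) t.
  rewrite (rintegrable_ev _).2// => b /mapP[j _ ->] i; exact: aC.1.
apply: cov_nonneg_seq.
  move=> b /mapP[j]; rewrite mem_filter => /andP[/injectiveP ij _] ->; split=> [i|i i' ii'].
    exact: aC.1.
  by move/trivIsetP : aC.2; apply => //; apply: contra ii' => /eqP /ij ->.
move=> b /mapP[j _ ->] /=; rewrite /a /coef; case: ifP => // _.
Qed.

End covers.

Section approximation.
Context (R : realType) (dX : measure_display) (X : measurableType dX).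
Context (mu : {sigma_finite_measure set X -> \bar R}).
Hypothesis mu_nonatomic : nonatomic mu.
Context (B : nat -> set X).
Hypothesis sB : separating B.
Local Notation fmeas := (fmeas mu).

(** By separation, equality of two entries is the conjunction of countably many measurable
    conditions. *)
Lemma measurable_nonuniq n : measurable [set x : n.-tuple X | ~~ uniq x].
Proof.
rewrite (_ : [set x : n.-tuple X | _] = \bigcup_(p in [set p : 'I_n * 'I_n | p.1 != p.2])
    \bigcap_q [set x : n.-tuple X | B q (tnth x p.1) <-> B q (tnth x p.2)]).
  apply: fin_bigcup_measurable; first exact: finite_finset.
  move=> -[i j] _ /=; apply: bigcapT_measurable => q.
  rewrite (_ : [set x | _] =
     (((@tnth n X)^~ i @^-1` B q) `&` ((@tnth n X)^~ j @^-1` B q)) `|`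
     (~` ((@tnth n X)^~ i @^-1` B q) `&` ~` ((@tnth n X)^~ j @^-1` B q))).
    have m (l : 'I_n) : measurable ((@tnth n X)^~ l @^-1` B q).
      by rewrite -[X in measurable X]setTI; apply: measurable_tnth => //; exact: sB.1.
    by apply: measurableU; apply: measurableI => //; exact: measurableC.
  apply/seteqP; split=> x /=; last by case=> -[].
  by case: (pselect (B q (tnth x i))) => h [h1 h2]; [left; tauto|right; tauto].
apply/seteqP; split=> x /=.
  move=> nu; apply: contrapT => h; move/negP : nu; apply; apply/tuple_uniqP => i j e.
  apply/eqP; apply: contraT => ij; exfalso; apply: h; exists (i, j) => //= q _ /=.
  by rewrite e.
move=> [[i j] /= ij h]; apply/negP => /tuple_uniqP u; move/eqP : ij; apply.
by apply: u; apply: sB.2 => q; exact: h q I.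
Qed.

(** Induction by Tonelli: tails with a repetition are null, and for the other tails the first entry
    must be one of finitely many null points. *)
Lemma nonuniq_null n : power_measure mu n [set x : n.-tuple X | ~~ uniq x] = 0.
Proof.
elim: n => [|n IH].
  by rewrite (_ : [set x : 0.-tuple X | _] = set0) ?measure0//; apply/seteqP; split=> x //=; rewrite tuple0.
pose N := @pair_cons _ X n @^-1` [set x : n.+1.-tuple X | ~~ uniq x].
have mN : measurable N.
  rewrite -[X in measurable X]setTI.
  exact: (@measurable_pair_cons _ X n measurableT _ (@measurable_nonuniq n.+1)).
rewrite [LHS](_ : _ = (mu \x power_measure mu n) N)//.
rewrite -(setIT N) -integral_indic// fubini_tonelli2; last 2 first.
- by apply/measurable_EFinP; exact: measurable_indic.
- by move=> z; rewrite lee_fin.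
have mG : measurable_fun setT (fubini_G mu (fun z => (\1_N z)%:E)).
  apply: measurable_fun_fubini_tonelli_G; last by move=> z; rewrite lee_fin.
  by apply/measurable_EFinP; exact: measurable_indic.
rewrite (ae_eq_integral (cst 0))//; first by rewrite integral0.
exists [set x : n.-tuple X | ~~ uniq x]; split=> //; first exact: measurable_nonuniq.
move=> t /= /not_implyP[_]; apply: contra_notP => /negP; rewrite negbK => ut.
rewrite /fubini_G.
have null (s : seq X) : measurable [set` s] /\ mu [set` s] = 0.
  elim: s => [|x s [mS IHs]].
    rewrite (_ : [set` _] = set0) ?measure0//.
    by apply/seteqP; split=> y //=; rewrite in_nil.
  have -> : [set` x :: s] = [set x] `|` [set` s].
    apply/seteqP; split=> y /=; rewrite inE; first by move=> /orP[/eqP|]; [left|right].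
    by move=> [->|->]; rewrite ?eqxx ?orbT.
  have mx := measurable_point sB x; split; first exact: measurableU.
  apply/eqP; rewrite eq_le measure_ge0 andbT.
  apply: (@le_trans _ _ (mu [set x] + mu [set` s])); first exact: measureU2.
  by rewrite (nonatomic_point mu_nonatomic sB) IHs adde0.
rewrite (eq_integral (fun x => (\1_[set` t] x)%:E)); last first.
  move=> x _; congr EFin; rewrite !indicE; congr ((nat_of_bool _)%:R).
  by apply/idP/idP; rewrite !inE /N /pair_cons /= ut andbT negbK.
by rewrite integral_indic ?setIT//; have [] := null t.
Qed.

Lemma uniq_ae n : \forall x \ae power_measure mu n, uniq (x : n.-tuple X).
Proof.
exists [set x : n.-tuple X | ~~ uniq x]; split.
- exact: measurable_nonuniq.
- exact: nonuniq_null.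
- by move=> x /= /negP.
Qed.

Section fixed_order.
Context (k : nat).
Local Notation muk := (power_measure mu k).
Implicit Types (f g : k.-tuple X -> R).
Local Notation cov := (cov mu).
Local Notation gseq := (gseq mu).
Local Notation gbox := (gbox mu).

(** A cover bounds [g] only at tuples with distinct entries; the remaining tuples are null by
    [uniq_ae]. *)
Lemma cov_integral g e : (forall x, 0 <= g x)%R -> measurable_fun setT g ->
  cov g e -> \int[muk]_x (g x)%:E <= e%:E.
Proof.
move=> g0 mg [c [D [c0 gD h1 h2]]]; apply: le_trans h2.
have mD m : measurable (box (D m)) by apply: measurable_box => i; exact: ((gD m).1 i).1.
apply: (@le_trans _ _ (\int[muk]_x \sum_(m <oo) (c m * \1_(box (D m)) x)%:E)).
  apply: ae_ge0_le_integral => //.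
  - by move=> x _; rewrite lee_fin.
  - exact/measurable_EFinP.
  - by move=> x _; apply: nneseries_ge0 => m _ _; rewrite lee_fin mulr_ge0.
  - apply: ge0_emeasurable_sum => [m x _ _|m _]; first by rewrite lee_fin mulr_ge0.
    by apply/measurable_EFinP; apply: measurable_funM => //; exact: measurable_indic.
  - by apply: filterS (uniq_ae k) => x ux _; exact: h1.
rewrite integral_nneseries//; last 2 first.
- by move=> m; apply/measurable_EFinP; apply: measurable_funM => //; exact: measurable_indic.
- by move=> m x _; rewrite lee_fin mulr_ge0.
rewrite le_eqVlt; apply/orP; left; apply/eqP/eq_eseriesr => m _.
have [i e1] := rintegrable_box (gD m).1.
by rewrite (rintE (rintegrableZ (c m) i)) rintZ// e1.
Qed.

Lemma cov_rint g e : measurable_fun setT g -> cov (fun x => `|g x|)%R e ->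
  rintegrable muk g /\ (rint muk (fun x => `|g x|) <= e)%R.
Proof.
move=> mg cg.
have h : \int[muk]_x `|g x|%:E <= e%:E.
  by apply: cov_integral => //; exact: measurableT_comp.
have i : rintegrable muk g by apply: rintegrableP => //; apply: le_lt_trans h _; exact: ltry.
by split => //; rewrite -lee_fin -rintE//; exact: rintegrable_norm.
Qed.

(** Approximation by covers rather than in [L^1] norm; [cov_rint] shows that it is at least as
    strong. *)
Definition appr f := forall e : R, (0 < e)%R ->
  exists2 s, gseq s & cov (fun x => `|f x - ev s x|)%R e.

Lemma appr_ev s : gseq s -> appr (ev s).
Proof.
move=> gs e e0; exists s => //; apply: (cov_le _ (ltW e0) (cov0 mu k)) => x _.
by rewrite subrr normr0.
Qed.

Lemma appr_eq f g : (forall x : k.-tuple X, uniq x -> f x = g x) -> appr f -> appr g.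
Proof.
move=> fg af e e0; have [s gs cs] := af e e0; exists s => //.
by apply: (cov_le _ (lexx _) cs) => x ux; rewrite fg.
Qed.

Lemma appr_add f g : appr f -> appr g -> appr (fun x => f x + g x)%R.
Proof.
move=> af ag e e0; have e20 : (0 < e / 2)%R by rewrite divr_gt0.
have [s gs cs] := af _ e20; have [t gt ct] := ag _ e20.
exists (s ++ t); first exact: gseq_cat.
apply: (cov_le _ _ (cov_add _ _ (ltW e20) (ltW e20) cs ct)) => //.
- by move=> x _; rewrite ev_cat opprD addrACA ler_normD.
- by rewrite -splitr.
Qed.

Lemma cov_scale a g e : (0 <= a)%R -> cov g e -> cov (fun x => a * g x)%R (a * e)%R.
Proof.
move=> a0 [c [D [c0 gD h1 h2]]]; exists (fun m => a * c m)%R, D; split=> //.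
- by move=> m; rewrite mulr_ge0.
- move=> x ux; under eq_eseriesr => m _ do rewrite -mulrA EFinM.
  rewrite nneseriesZl; last by move=> m _; rewrite lee_fin mulr_ge0.
  by rewrite EFinM lee_wpmul2l// h1.
- under eq_eseriesr => m _ do rewrite -mulrA EFinM.
  rewrite nneseriesZl; last by move=> m _; rewrite lee_fin mulr_ge0 ?bmass_ge0.
  by rewrite EFinM lee_wpmul2l.
Qed.

Lemma appr_scale a f : appr f -> appr (fun x => a * f x)%R.
Proof.
move=> af e e0; have b0 : (0 < `|a| + 1)%R by rewrite ltr_wpDl.
have [s gs cs] := af (e / (`|a| + 1))%R (divr_gt0 e0 b0).
exists (scale_bx a s); first exact: gseq_scale.
apply: (cov_le _ _ (cov_scale (normr_ge0 a) cs)).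
  by move=> x _; rewrite ev_scale -mulrBr normrM.
rewrite mulrA ler_pdivrMr// mulrC ler_wpM2l ?(ltW e0)//.
by rewrite lerDl.
Qed.

Lemma appr_sub f g : appr f -> appr g -> appr (fun x => f x - g x)%R.
Proof.
move=> af ag; have h := appr_add af (appr_scale (-1) ag).
by apply: appr_eq h => x _; rewrite mulN1r.
Qed.

Lemma appr0 : appr (fun=> 0%R).
Proof.
have h : gseq ([::] : seq (bx R X k)) by [].
by apply: appr_eq (appr_ev h) => x _; rewrite /ev big_nil.
Qed.

Lemma appr_sum (I : Type) (r : seq I) (a : I -> R) (F : I -> k.-tuple X -> R) :
  (forall i, appr (F i)) -> appr (fun x => \sum_(i <- r) a i * F i x)%R.
Proof.
move=> aF; elim: r => [|i r IH].
  by apply: appr_eq appr0 => x _; rewrite big_nil.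
by apply: appr_eq (appr_add (appr_scale (a i) (aF i)) IH) => x _; rewrite big_cons.
Qed.

(** Converse of [cov_rint] up to [e]: a step function is covered at the cost of its norm by
    [cov_norm_ev], and the remainder at small cost. Through it [L^1] bounds yield covers. *)
Lemma appr_cov f e : appr f -> rintegrable muk f -> (0 < e)%R ->
  cov (fun x => `|f x|)%R (rint muk (fun x => `|f x|) + e)%R.
Proof.
move=> af fi e0; have e20 : (0 < e / 2)%R by rewrite divr_gt0.
have [s gs cs] := af _ e20.
have [si _] := rintegrable_ev (gseq_fsides gs).
have mfs : measurable_fun setT (fun x => f x - ev s x)%R.
  exact: measurable_funB (rintegrable_meas fi) (rintegrable_meas si).
have [fsi fse] := cov_rint mfs cs.
have sr : (rint muk (fun x => `|ev s x|) <= rint muk (fun x => `|f x|) + e / 2)%R.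
  apply: (@le_trans _ _ (rint muk (fun x => `|f x| + `|f x - ev s x|)%R)).
    apply: le_rint; first exact: rintegrable_norm.
      by apply: rintegrableD; exact: rintegrable_norm.
    move=> x; rewrite -{1}(subKr (f x) (ev s x)) (le_trans (ler_normB _ _))//.
  by rewrite rintD ?lerD2l//; exact: rintegrable_norm.
apply: (cov_le _ _ (cov_add _ _ _ (ltW e20) (cov_norm_ev gs) cs)) => //.
- by move=> x _; rewrite -{1}(subrKC (ev s x) (f x)) ler_normD.
- by rewrite (le_trans (lerD sr (lexx _)))// -addrA -splitr.
- by apply: rint_ge0.
Qed.

(** The limit minus [F N] is covered by the telescoping series of the increments, whose norms are
    summable because the integrals of the [F n] are bounded. *)
Lemma appr_monotone (F : nat -> k.-tuple X -> R) f :
  (forall n, appr (F n)) -> (forall n, rintegrable muk (F n)) -> rintegrable muk f ->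
  (forall n (x : k.-tuple X), F n x <= F n.+1 x)%R -> (forall n x, F n x <= f x)%R ->
  (forall x : k.-tuple X, uniq x -> forall e, 0 < e -> exists n, f x <= F n x + e)%R ->
  appr f.
Proof.
move=> aF iF fi Finc Ff Fcv e e0.
have Fmon n m x : (n <= m)%N -> (F n x <= F m x)%R.
  move=> /subnK <-; elim: (m - n)%N => [//|l IH]; exact: le_trans IH (Finc _ _).
pose r n := rint muk (F n).
(* Beyond [N] the total increase of the integrals is at most [e / 4]; the slacks [ee n] add up to at
   most [e / 4], and [e / 2] is left for approximating [F N]. *)
have [N hN] : exists N, forall M, (r (N + M)%N - r N <= e / 4)%R.
  have hs : has_sup (range r).
    split; first by exists (r 0%N), 0%N.
    exists (rint muk f) => _ [n _ <-]; exact: le_rint.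
  have e40 : (0 < e / 4)%R by rewrite divr_gt0.
  have [_ [N _ <-] hN] := sup_adherent e40 hs.
  exists N => M; rewrite lerBlDl -lerBlDr; apply: le_trans (ltW hN).
  rewrite lerD2r; apply: ub_le_sup; first by have [] := hs.
  by exists (N + M)%N.
pose d n x := (F (N + n).+1 x - F (N + n)%N x)%R.
have d0 n x : (0 <= d n x)%R by rewrite subr_ge0.
have ad n : appr (d n) by exact: appr_sub.
have id' n : rintegrable muk (d n) by exact: rintegrableB.
pose ee n := (e / 4 / 2 ^+ n.+1)%R : R.
have ee0 n : (0 < ee n)%R by rewrite !divr_gt0// exprn_gt0.
have cd n : cov (d n) (rint muk (d n) + ee n)%R.
  apply: (cov_le _ _ (appr_cov (ad n) (id' n) (ee0 n))) => [x _|].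
    exact: ler_norm.
  by rewrite lerD2r le_eqVlt; apply/orP; left; apply/eqP/eq_rint => x; rewrite ger0_norm.
have rd0 n : (0 <= rint muk (d n))%R by exact: rint_ge0.
have telx x M : (\sum_(n < M) d n x = F (N + M)%N x - F N x)%R.
  elim: M => [|M IH]; first by rewrite big_ord0 addn0 subrr.
  by rewrite big_ord_recr/= IH /d addnS; ring.
have telr M : (\sum_(n < M) rint muk (d n) = r (N + M)%N - r N)%R.
  elim: M => [|M IH]; first by rewrite big_ord0 addn0 subrr.
  by rewrite big_ord_recr/= IH /d rintB// addnS /r; ring.
have tele M : (\sum_(n < M) ee n <= e / 4)%R.
  have -> : (\sum_(n < M) ee n = e / 4 - e / 4 / 2 ^+ M)%R.
    elim: M => [|M IH]; first by rewrite big_ord0 expr0 divr1 subrr.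
    rewrite big_ord_recr/= IH /ee exprS.
    have : (2 ^+ M != 0 :> R)%R by rewrite expf_neq0.
    by move: (2 ^+ M)%R => z z0; field; rewrite z0.
  by rewrite gerBl !divr_ge0 ?(ltW e0)// exprn_ge0.
have ser (a : nat -> R) (C : R) : (forall n, 0 <= a n)%R -> (forall M, \sum_(n < M) a n <= C)%R ->
    \sum_(n <oo) (a n)%:E <= C%:E.
  move=> a0 aC; apply: lime_le; first by apply: is_cvg_nneseries => n _ _; rewrite lee_fin.
  by apply: nearW => M; rewrite big_mkord sumEFin lee_fin.
have cf : cov (fun x => `|f x - F N x|)%R (e / 4 + e / 4)%R.
  apply: (cov_series cd).
  - move=> x ux; rewrite ger0_norm ?subr_ge0//.
    apply/lee_addgt0Pr => del del0; have [n hn] := Fcv x ux del del0.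
    apply: (@le_trans _ _ ((F (N + n)%N x - F N x) + del)%:E).
      rewrite lee_fin lerBlDr addrAC subrK; apply: le_trans hn _.
      by rewrite lerD2r Fmon// leq_addl.
    rewrite EFinD leeD2r// -telx -sumEFin -(big_mkord predT (fun n => (d n x)%:E)).
    by apply: nneseries_lim_ge => i _ _; rewrite lee_fin.
  - by [].
  - by move=> n; rewrite addr_ge0// ltW.
  - apply: ser => [n|M]; first by rewrite addr_ge0// ltW.
    by rewrite big_split lerD// telr.
have [s gs cs] := aF N (e / 2)%R (divr_gt0 e0 (ltr0Sn _ 1)).
have e40 : (0 <= e / 4)%R by rewrite divr_ge0// ltW.
have e20 : (0 <= e / 2)%R by rewrite divr_ge0// ltW.
exists s => //.
apply: (cov_le _ _ (cov_add _ _ (addr_ge0 e40 e40) e20 cf cs)) => //.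
- move=> x _; apply: le_trans (ler_normD _ _).
  by rewrite addrA subrK.
- by rewrite le_eqVlt; apply/orP; left; apply/eqP; field.
Qed.

End fixed_order.

End approximation.

(** * Density of step functions off the diagonals *)

Section density.
Import HBNNSimple.
Context (R : realType) (dX : measure_display) (X : measurableType dX).
Context (mu : {sigma_finite_measure set X -> \bar R}).
Hypothesis mu_nonatomic : nonatomic mu.
Context (B : nat -> set X).
Hypothesis sB : separating B.
Context (k : nat).
Local Notation fmeas := (fmeas mu).
Local Notation muk := (power_measure mu k).
Local Notation gbox := (gbox mu).
Local Notation appr := (appr (k := k) mu).

Lemma rintegrable_indic (A : set (k.-tuple X)) : measurable A -> muk A < +oo ->
  rintegrable muk (\1_A).
Proof.
move=> mA Aoo; apply: rintegrableP; first exact: measurable_indic.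
under eq_integral => x _ do rewrite ger0_norm//.
by rewrite integral_indic// setIT.
Qed.

(** The indicators of the finite unions increase to that of the whole union, so [appr_monotone]
    applies. *)
Lemma appr_disjoint_union (A : nat -> set (k.-tuple X)) :
  (forall i, measurable (A i)) -> trivIset setT A ->
  muk (\bigcup_i A i) < +oo -> (forall i, appr (\1_(A i))) -> appr (\1_(\bigcup_i A i)).
Proof.
move=> mA tA Aoo aA.
have mU : measurable (\bigcup_i A i) by exact: bigcup_measurable.
have iA i : rintegrable muk (\1_(A i)).
  apply: rintegrable_indic => //; apply: le_lt_trans Aoo.
  by apply: le_measure; rewrite ?inE//; exact: bigcup_sup.
pose F n x := (\sum_(i <- iota 0 n) 1 * \1_(A i) x : R)%R.
have Fin i0 n x : A i0 x -> F n x = (i0 < n)%:R%R.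
  move=> Ax; rewrite /F (eq_bigr (fun i => (i == i0)%:R)%R); last first.
    move=> i _; rewrite mul1r indicE; congr ((nat_of_bool _)%:R).
    apply/idP/eqP; rewrite inE; last by move=> ->.
    by move=> Aix; apply: contrapT => /eqP ii; move/trivIsetP : tA => /(_ _ _ I I ii) /seteqP[/(_ x (conj Aix Ax))].
  case: (ltnP i0 n) => h.
    rewrite (bigD1_seq i0)/= ?iota_uniq ?mem_iota// eqxx big1 ?addr0// => i /negPf ->//.
  rewrite big1_seq// => i /=; rewrite mem_iota/= add0n => ilt.
  by case: eqP => // ii; move: ilt; rewrite ii ltnNge h.
have Fout n x : (forall i, ~ A i x) -> F n x = 0%R.
  by move=> h; rewrite /F big1// => i _; rewrite indicE memNset ?mulr0//; exact: h.
apply: (appr_monotone mu_nonatomic sB (F := F)).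
- by move=> n; exact: appr_sum.
- by move=> n; exact: rintegrable_sum.
- exact: rintegrable_indic.
- move=> n x; case: (pselect (exists i, A i x)) => [[i Aix]|h].
    by rewrite !(Fin i)// ler_nat; case: ltnP => // h; rewrite (leq_trans h).
  by rewrite !Fout// => i Aix; apply: h; exists i.
- move=> n x; case: (pselect (exists i, A i x)) => [[i Aix]|h].
    by rewrite (Fin i)// indicE mem_set ?ler_nat; [case: (_ < _)%N|exists i].
  by rewrite Fout// => i Aix; apply: h; exists i.
- move=> x _ e e0; case: (pselect (exists i, A i x)) => [[i Aix]|h].
    exists i.+1; rewrite (Fin i)// ltnSn indicE mem_set ?lerDl ?ltW//.
    by exists i.
  exists 0%N; rewrite Fout; last by move=> i Aix; apply: h; exists i.
  by rewrite add0r indicE memNset ?ltW// => -[i _ Aix]; apply: h; exists i.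
Qed.

Lemma gbox_finite D : gbox D -> measurable (box D) /\ muk (box D) < +oo.
Proof.
move=> [fD _]; split; first by apply: measurable_box => i; exact: (fD i).1.
rewrite power_measure_box; last by move=> i; exact: (fD i).1.
rewrite (_ : \prod_(i < k) _ = (\prod_i fine (mu (D i)))%:E) ?ltry//.
by rewrite -prodEFin; apply: eq_bigr => i _; exact: fmeasE.
Qed.

Lemma appr_gbox D : gbox D -> appr (\1_(box D)).
Proof.
move=> gD; apply: (appr_eq (f := ev [:: (1%R, D)])).
  by move=> x _; rewrite /ev big_seq1 mul1r.
by apply: appr_ev => b; rewrite inE => /eqP ->.
Qed.

(** Dynkin's theorem inside a fixed box, whose finite mass makes the countable unions integrable. *)
Lemma appr_indic_gbox D (A : set (k.-tuple X)) : gbox D -> measurable A ->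
  appr (\1_(A `&` box D)).
Proof.
move=> gD mA; have [mD Doo] := gbox_finite gD.
pose G := [set A : set (k.-tuple X) |
  exists2 B : 'I_k -> set X, (forall i, measurable (B i)) & A = box B].
have gen : @measurable _ (k.-tuple X) = <<s G >> by exact: box_generates.
apply: (@dynkin_induction _ _ G (fun A => appr (\1_(A `&` box D))) gen);
  last by rewrite -gen.
- move=> _ _ [A1 m1 ->] [A2 m2 ->]; exists (fun i => A1 i `&` A2 i).
    by move=> i; exact: measurableI.
  by rewrite boxI.
- by rewrite setTI; exact: appr_gbox.
- move=> _ [E mE ->]; rewrite boxI; apply: appr_gbox; case: gD => fD dD; split.
    move=> i; have mED : measurable (E i `&` D i) by apply: measurableI => //; exact: (fD i).1.
    split => //; apply: le_lt_trans (fD i).2; apply: le_measure; rewrite ?inE//.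
    exact: (fD i).1.
  by move=> i j ij; rewrite setIACA (dD i j ij) setI0.
- move=> S mS aS; apply: appr_eq (appr_sub (appr_gbox gD) aS) => x _.
  rewrite !indicE !in_setI in_setC.
  by case: (x \in S); case: (x \in box D); rewrite /= ?subrr ?subr0.
- move=> F mF tF aF; rewrite setI_bigcupl; apply: appr_disjoint_union => //.
  + by move=> i; exact: measurableI.
  + apply/trivIsetP => i j _ _ ij; rewrite setIACA.
    by move/trivIsetP : tF => ->//; rewrite set0I.
  + apply: le_lt_trans Doo; apply: le_measure; rewrite ?inE//.
      by apply: bigcup_measurable => i _; exact: measurableI.
    by move=> x [i _ []].
Qed.

(** Distinct points are separated by finitely many sets [B q], hence lie in different cells of some
    level. An exhausting set, a level and a list of codes of cells name one box, so countably many
    suffice. *)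
Lemma gbox_cover : exists D : nat -> 'I_k -> set X, (forall n, gbox (D n)) /\
  forall x : k.-tuple X, uniq x -> exists n, box (D n) x.
Proof.
have /sigma_finiteP[E [TE ndE Eoo]] := sigma_finiteT mu.
pose part m v := [set x : X | pickle (code B m x) = v].
have mpart m v : measurable (part m v).
  rewrite (_ : part m v = \bigcup_(c in [set c : {set 'I_m} | pickle c = v]) sepcell B c).
    apply: fin_bigcup_measurable; first exact: finite_finset.
    by move=> c _; exact: measurable_sepcell.
  apply/seteqP; split=> x /=; first by move=> h; exists (code B m x) => //; apply/sepcellP.
  by move=> [c /= cv /sepcellP xc]; rewrite /part /= xc.
pose D0 (p : nat * nat * seq nat) (j : 'I_k) : set X :=
  if injectiveb (fun j : 'I_k => nth 0%N p.2 j) then E p.1.1 `&` part p.1.2 (nth 0%N p.2 j)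
  else set0.
exists (fun n => if unpickle n is Some p then D0 p else fun=> set0); split.
  move=> n; case: (unpickle n) => [p|]; last exact: gbox_set0.
  rewrite /D0; case: (boolP (injectiveb _)) => [/injectiveP ij|_]; last exact: gbox_set0.
  split=> [j|j j' jj'].
    have [mE Ep] := Eoo p.1.1.
    have mEp : measurable (E p.1.1 `&` part p.1.2 (nth 0%N p.2 j)) by exact: measurableI.
    by split => //; apply: le_lt_trans Ep; apply: le_measure; rewrite ?inE.
  apply/seteqP; split=> // x [[_ h] [_ h']]; move: jj' => /eqP; apply; apply: ij.
  by rewrite -h -h'.
move=> x ux.
have /choice[i hi] : forall j, exists i, E i (tnth x j).
  by move=> j; have : [set: X] (tnth x j) by []; rewrite TE => -[i _ h]; exists i.
have /choice[q hq] : forall p : 'I_k * 'I_k, exists q, p.1 != p.2 ->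
    ~ (B q (tnth x p.1) <-> B q (tnth x p.2)).
  move=> [j j'] /=; case: (eqVneq j j') => [->|jj']; first by exists 0%N.
  apply: contrapT => h; move/eqP : jj'; apply; move/tuple_uniqP : ux; apply.
  apply: sB.2 => q; apply: contrapT => hq; apply: h; exists q => _; exact: hq.
(* A level at which all pairs of entries are separated; the successor, because level [m] uses the
   indices below [m]. *)
pose m := (\max_p q p).+1; pose i0 := (\max_j i j)%N.
pose l := [seq pickle (code B m (tnth x j)) | j <- enum 'I_k].
have lE (j : 'I_k) : nth 0%N l j = pickle (code B m (tnth x j)).
  by rewrite (nth_map j) ?size_enum_ord ?ltn_ord// nth_ord_enum.
exists (pickle (i0, m, l)); rewrite pickleK => j; rewrite /D0 ifT/=.
  split; last by rewrite /part /= lE.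
  move: (tnth x j) (hi j); exact/subsetPset/ndE/leq_bigmax.
apply/injectiveP => j1 j2; rewrite !lE => /(pcan_inj pickleK) /setP ec.
apply/eqP; apply: contraT => j12; exfalso; apply: (hq (j1, j2) j12) => /=.
have qm : (q (j1, j2) < m)%N by rewrite ltnS; exact: leq_bigmax.
have := ec (Ordinal qm); rewrite !finset.inE /= => e.
by split=> /asboolP; [rewrite e|rewrite -e] => /asboolP.
Qed.

(** The covering boxes are made disjoint, and the part of [A] in each is approximated separately.
    Tuples with repetitions are not covered, but [appr] ignores them. *)
Lemma appr_indic (A : set (k.-tuple X)) : measurable A -> muk A < +oo -> appr (\1_A).
Proof.
move=> mA Aoo; have [D [gD cD]] := gbox_cover.
pose A' n := A `&` seqDU (fun n => box (D n)) n.
have mD n : measurable (box (D n)) by have [] := gbox_finite (gD n).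
have mS n : measurable (seqDU (fun n => box (D n)) n).
  by apply: measurableD => //; exact: bigsetU_measurable.
have mA' n : measurable (A' n) by exact: measurableI.
have aA' n : appr (\1_(A' n)).
  rewrite (_ : A' n = A' n `&` box (D n)); first exact: appr_indic_gbox.
  by apply/seteqP; split=> x; [move=> [Ax Sx]; split => //; case: Sx|case].
apply: (appr_eq (f := \1_(\bigcup_n A' n))).
  move=> x ux; rewrite !indicE; congr ((nat_of_bool _)%:R).
  apply/idP/idP; rewrite !inE; first by move=> [n _ []].
  move=> Ax; have [n Dx] := cD x ux.
  have : (\bigcup_n seqDU (fun n => box (D n)) n) x by rewrite -seqDU_bigcup_eq; exists n.
  by move=> [n' _ h]; exists n'.
apply: appr_disjoint_union => //.
  apply/trivIsetP => i j _ _ ij; rewrite setIACA.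
  by move/trivIsetP : (trivIset_seqDU (fun n => box (D n))) => ->//; rewrite setI0.
apply: le_lt_trans Aoo; apply: le_measure; rewrite ?inE//; first exact: bigcup_measurable.
by move=> x [n _ []].
Qed.

Lemma appr_nonneg (f : k.-tuple X -> R) : rintegrable muk f -> (forall x, 0 <= f x)%R -> appr f.
Proof.
move=> fi f0; have /measurable_EFinP mf := rintegrable_meas fi.
pose g := nnsfun_approx measurableT mf.
have gf n x : (g n x <= f x)%R.
  rewrite -lee_fin /g nnsfun_approxE.
  by apply: (le_approx (f := EFin \o f)) => // t _; rewrite lee_fin.
have gi n : rintegrable muk (g n).
  apply: le_rintegrable fi _ => // x; first by rewrite ger0_norm.
(* The level set of the value 0 may have infinite mass; its coefficient is 0, so it is replaced by
   the empty set. *)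
have gE n : g n = (fun x => \sum_(y <- finmap.enum_fset (fset_set (range (g n))))
    y * \1_(if y == 0%R then set0 else g n @^-1` [set y]) x)%R :> (_ -> R).
  apply/funext => x; rewrite {1}fimfunE fsbig_finite//.
  by apply: eq_bigr => y _; case: (eqVneq y 0%R) => [->|//]; rewrite !mul0r.
have ag n : appr (g n).
  rewrite gE; apply: appr_sum => y.
  case: (eqVneq y 0%R) => [y0|y0].
    by rewrite indic0; exact: appr0.
  have mg : measurable (g n @^-1` [set y]) by [].
  apply: appr_indic => //.
  case: (ltP 0%R y) => [yp|yn]; last first.
    rewrite (_ : _ @^-1` _ = set0) ?measure0//; apply/seteqP; split=> x //= gy.
    by have : (0 <= g n x)%R by []; rewrite gy => yn'; move: y0; rewrite eq_le yn yn'.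
  (* Markov's inequality bounds the mass of the level set of a positive value. *)
  have : y%:E * muk (g n @^-1` [set y]) < +oo.
    apply: le_lt_trans (rintegrable_lty (gi n)).
    rewrite -(setIT (g n @^-1` _)) -integral_indic// -ge0_integralZl_EFin// ?(ltW yp)//; last first.
      by apply/measurable_EFinP; exact: measurable_indic.
    apply: ge0_le_integral => //.
    - by move=> x _; rewrite mule_ge0// lee_fin// ltW.
    - by apply/measurable_funeM/measurable_EFinP.
    - by apply/measurable_EFinP; exact: measurableT_comp.
    - move=> x _; rewrite -EFinM lee_fin indicE; case: (boolP (x \in _)).
        by rewrite inE /= => ->; rewrite mulr1 ger0_norm// ltW.
      by rewrite mulr0.
  by apply: contraTT; rewrite -!leNgt !leye_eq => /eqP ->; rewrite mulry gtr0_sg// mul1e.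
apply: (appr_monotone mu_nonatomic sB (F := g)) => //.
- move=> n x; have /lefP := nd_nnsfun_approx measurableT mf (leqnSn n); exact.
- move=> x _ e e0.
  have := @cvg_nnsfun_approx _ _ _ _ measurableT _ mf _ x I.
  move=> /(_ (fun t _ => f0 t : 0 <= (EFin \o f) t)) h.
  have /fine_cvgP[_ {}h] : (fun n => (g n x)%:E) @ \oo --> (f x)%:E := h.
  move/cvgrPdist_le : h => /(_ e e0) [n _ /(_ n (leqnn n))] /=.
  by rewrite ger0_norm ?subr_ge0// => h; exists n; rewrite -lerBlDl.
Qed.

Lemma appr_L1 (f : k.-tuple X -> R) : rintegrable muk f -> appr f.
Proof.
move=> fi; have mf := rintegrable_meas fi.
have ap (g : k.-tuple X -> R) : rintegrable muk g -> appr (fun x => Num.max (g x) 0)%R.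
  move=> gi; have mg := rintegrable_meas gi.
  apply: appr_nonneg; last by move=> x; rewrite le_max lexx orbT.
  apply: le_rintegrable (rintegrable_norm gi) _; first exact: measurable_maxr.
  by move=> x; rewrite ger0_norm ?le_max ?lexx ?orbT// ge_max ler_norm normr_ge0.
have := appr_sub (ap _ fi) (ap _ (rintegrableZ (-1) fi)).
apply: appr_eq => x _; rewrite mulN1r /Num.max.
by case: ltgtP => h; case: ltgtP => h'; lra.
Qed.

End density.

(** * U-statistics *)

Section esums.
Context (R : realType) (T : choiceType) (S : set T).

Lemma esum_series_le (a : nat -> T -> \bar R) : (forall m t, 0 <= a m t) ->
  \esum_(t in S) \sum_(m <oo) a m t <= \sum_(m <oo) \esum_(t in S) a m t.
Proof.
move=> a0; apply: ge_ereal_sup => _ [A [fA AS] <-].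
rewrite fsbig_finite//= -nneseries_sum; last by move=> *.
apply: lee_nneseries => m _; first by move=> _; apply: sume_ge0.
rewrite -fsbig_finite//; apply: ereal_sup_ubound; exists A => //.
Qed.

Local Notation V f := (\esum_(t in S) (f t)%:E).

(** The positive and negative parts in [U_sum] may be replaced by any nonnegative [p] and [q] with
    difference [f] and finite sums: adding [q] to the positive part of [f] gives the same as adding
    [p] to its negative part. *)
Lemma esum_diff (f p q : T -> R) : (forall t, S t -> f t = p t - q t)%R ->
  (forall t, 0 <= p t)%R -> (forall t, 0 <= q t)%R -> V p < +oo -> V q < +oo ->
  \esum_(t in S) (EFin \o f)^\+ t - \esum_(t in S) (EFin \o f)^\- t = V p - V q.
Proof.
move=> fE p0 q0 poo qoo.
have pE t : (EFin \o f)^\+ t = (Num.max (f t) 0%R)%:E by rewrite funeposE /= EFin_max.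
have nE t : (EFin \o f)^\- t = (Num.max (- f t)%R 0%R)%:E by rewrite funenegE /= EFin_max.
under eq_esum => t _ do rewrite pE.
under [X in _ - X]eq_esum => t _ do rewrite nE.
have ge0 (h : T -> R) : (forall t, 0 <= h t)%R -> 0 <= V h.
  by move=> h0; apply: esum_ge0 => t _; rewrite lee_fin.
have f0 t : (0 <= Num.max (f t) 0)%R by rewrite le_max lexx orbT.
have g0 t : (0 <= Num.max (- f t) 0)%R by rewrite le_max lexx orbT.
have E : V (fun t => Num.max (f t) 0)%R + V q = V p + V (fun t => Num.max (- f t) 0)%R.
  rewrite -!esumD; try by move=> t _; rewrite lee_fin.
  apply: eq_esum => t St; rewrite -!EFinD; congr EFin; rewrite (fE t St).
  by rewrite /Num.max; case: ltgtP => h; case: ltgtP => h'; lra.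
have fin (h : T -> R) : (forall t, 0 <= h t)%R -> V h < +oo -> V h = (fine (V h))%:E.
  by move=> h0 hoo; rewrite fineK// ge0_fin_numE// ge0.
have foo : V (fun t => Num.max (f t) 0)%R < +oo.
  apply: le_lt_trans poo; apply: le_esum => t St; rewrite lee_fin (fE t St) ge_max p0.
  by rewrite lerBlDr lerDl q0.
have goo : V (fun t => Num.max (- f t) 0)%R < +oo.
  apply: le_lt_trans qoo; apply: le_esum => t St; rewrite lee_fin (fE t St) ge_max q0.
  by rewrite opprB lerBlDr lerDl p0.
move: E; rewrite (fin _ f0 foo) (fin _ g0 goo) (fin _ p0 poo) (fin _ q0 qoo).
move: (fine _) (fine _) (fine _) (fine _) => a b c d.
move=> [e]; rewrite /GRing.add/= /adde /= -/(_ - _)%R; congr EFin; lra.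
Qed.

End esums.

Lemma abse_diff_le (R : realType) (x y : R) (a b g : \bar R) : 0 <= a -> 0 <= b ->
  a <= g -> b <= g -> g < +oo -> `|x%:E + a - (y%:E + b) - (x - y)%:E| <= g.
Proof.
case: a => [a| |]//; case: b => [b| |]//; case: g => [g| |]//.
rewrite !lee_fin => a0 b0 ag bg _; rewrite ler_norml; apply/andP; split; lra.
Qed.

Section U_sums.
Context (R : realType) (dX dO : measure_display) (X : measurableType dX).
Context (Omega : measurableType dO).
Context (mu : {sigma_finite_measure set X -> \bar R}).
Context (P : probability Omega R) (eta : {RV P >-> point_measure R X}).
Hypothesis eta_poisson : poisson_process mu eta.
Hypothesis mu_nonatomic : nonatomic mu.
Context (B : nat -> set X).
Hypothesis sB : separating B.
Context (k : nat).
Local Notation fmeas := (fmeas mu).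
Local Notation num := (count_in eta).
Local Notation gbox := (gbox mu).
Local Notation gseq := (gseq mu).
Local Notation cov := (cov mu).
Local Notation UI := (step_count eta).
Local Notation V w f := (\esum_(t in distinct_tuples (eta w)) (f t)%:E).

(** Almost surely each side contains finitely many points, as many as its count says ([points_ae]);
    by disjointness the tuples of points in the box are all choices of one point per side. *)
Lemma V_box (c : R) (D : 'I_k -> set X) : (0 <= c)%R -> gbox D -> \forall w \ae P,
  V w (fun t => c * \1_(box D) t)%R = (c * \prod_i num (D i) w)%:E.
Proof.
move=> c0 gD.
have h : \forall w \ae P, forall i, exists l : seq X,
  [/\ uniq l, forall x, x \in l <-> D i x /\ 0 < eta w [set x] &
  num (D i) w = (size l)%:R].
  by apply: filter_forall => i; exact: (points_ae eta_poisson mu_nonatomic sB (gD.1 i)).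
apply: filterS h => w /choice[l hl].
rewrite (eq_esum (b := fun t => if t \in box D then c%:E else 0)); last first.
  by move=> t _; rewrite indicE; case: (t \in box D); rewrite ?mulr1 ?mulr0.
rewrite -esum_mkcondr (_ : _ `&` _ = [set t : k.-tuple X | forall i, tnth t i \in l i]).
  rewrite (esum_tuples c0); last by move=> i; have [] := hl i.
  by congr (_ * _)%R%:E; apply: eq_bigr => i _; have [_ _ ->] := hl i.
apply/seteqP; split=> t /=.
  move=> [[ut pt] Dt] i; have [_ h _] := hl i; apply/h; split; [exact: Dt|exact: pt].
move=> tl; have Dt : box D t by move=> i; have [_ h _] := hl i; have [] := (h _).1 (tl i).
split => //; split; first exact: gbox_uniq gD Dt.
by move=> i; have [_ h _] := hl i; have [] := (h _).1 (tl i).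
Qed.

Lemma V_seq (s : seq (bx R X k)) : gseq s -> (forall b, b \in s -> 0 <= b.1)%R ->
  \forall w \ae P, V w (ev s) = (UI s w)%:E.
Proof.
elim: s => [|b s IH] gs s0.
  apply: aeW => w; rewrite /step_count /Zint big_nil esum1// => t _.
  by rewrite /ev big_nil.
have sub b' : b' \in s -> b' \in b :: s by rewrite inE => ->; rewrite orbT.
have b0 : (0 <= b.1)%R by apply: s0; rewrite mem_head.
have s0' b' : b' \in s -> (0 <= b'.1)%R by move=> h; apply: s0; exact: sub.
apply: filterS2 (V_box b0 (gs b (mem_head _ _))) (IH (fun b' h => gs b' (sub b' h)) s0').
move=> w h1 h2; rewrite /step_count /Zint big_cons EFinD -h1.
rewrite -[X in _ + X]h2 -esumD; last 2 first.
- by move=> t _; rewrite lee_fin mulr_ge0.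
- move=> t _; rewrite lee_fin /ev big_seq; apply: sumr_ge0 => b' bs.
  by rewrite mulr_ge0// s0'.
by apply: eq_esum => t _; rewrite /ev big_cons EFinD.
Qed.

(** Splitting by the sign of the weights, with [e] equal to 1 or -1. As boxes may overlap this is
    not the positive part of [ev s], but any decomposition into nonnegative terms suits
    [esum_diff]. *)
Definition pos_bx (e : R) (s : seq (bx R X k)) : seq (bx R X k) :=
  [seq (Num.max (e * b.1)%R 0%R, b.2) | b : bx R X k <- s].

Lemma pos_bx_gseq e s : gseq s -> gseq (pos_bx e s).
Proof. by move=> gs b /mapP[b' bs ->]; exact: (gs _ bs). Qed.

Lemma pos_bx_ge0 e s b : b \in pos_bx e s -> (0 <= b.1)%R.
Proof. by move=> /mapP[b' _ ->] /=; rewrite le_max lexx orbT. Qed.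

Lemma pos_bx_ev_ge0 e s t : (0 <= ev (pos_bx e s) t)%R.
Proof.
rewrite /ev big_seq; apply: sumr_ge0 => b bs.
by rewrite mulr_ge0// (pos_bx_ge0 bs).
Qed.

Lemma pos_bx_Zint z s : (Zint z s = Zint z (pos_bx 1 s) - Zint z (pos_bx (-1) s))%R.
Proof.
rewrite /Zint !big_map -sumrB; apply: eq_bigr => b _ /=; rewrite -mulrBl.
congr (_ * _)%R; rewrite mul1r mulN1r /Num.max.
by case: ltgtP => h; case: ltgtP => h'; lra.
Qed.

(** The sum over points is not known to be measurable, so its distance to [UI s] is bounded by a
    measurable [G]: the series of the cover evaluated on counts. Its weighted integral is estimated
    box by box with [UI_expR_bound]. *)
Lemma U_estimate (f : k.-tuple X -> R) s e : gseq s -> cov (fun x => `|f x - ev s x|)%R e ->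
  exists G : Omega -> \bar R, [/\ measurable_fun setT G, forall w, 0 <= G w,
    \forall w \ae P, `|U_sum f (eta w) - (UI s w)%:E| <= G w &
    forall B0, fmeas B0 -> \int[P]_w (G w * (expR (num B0 w))%:E) <=
      (expR 1 ^+ k * expR (fine (mu B0) * (expR 1 - 1)) * e)%:E].
Proof.
move=> gs [c [D [c0 gD h1 h2]]].
pose G w := \sum_(m <oo) (c m * \prod_i num (D m i) w)%:E.
have t0 m w : (0 <= c m * \prod_i num (D m i) w)%R.
  by rewrite mulr_ge0// prodr_ge0// => i _; exact: num_ge0.
have mt m : measurable_fun setT (fun w => c m * \prod_i num (D m i) w)%R.
  apply: measurable_funM => //; apply: measurable_prod => i _.
  exact: (measurable_num eta ((gD m).1 i).1).
exists G; split.
- apply: ge0_emeasurable_sum => [m w _ _|m _]; first by rewrite lee_fin.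
  exact/measurable_EFinP.
- by move=> w; apply: nneseries_ge0 => m _ _; rewrite lee_fin.
- have hD : \forall w \ae P, forall m, V w (fun t => c m * \1_(box (D m)) t)%R =
      (c m * \prod_i num (D m i) w)%:E.
    by apply: ae_foralln => m; exact: V_box.
  have hp := V_seq (pos_bx_gseq (e := 1) gs) (@pos_bx_ge0 1 s).
  have hn := V_seq (pos_bx_gseq (e := -1) gs) (@pos_bx_ge0 (-1) s).
  apply: filterS3 hD hp hn => w wD wp wn.
  (* Where [G] is infinite the bound is void; elsewhere the sums of both remainders are finite, as
     [esum_diff] demands. *)
  case: (eqVneq (G w) +oo) => [->|Gw]; first exact: leey.
  pose r t := (f t - ev s t)%R.
  have Vr : V w (fun t => `|r t|)%R <= G w.
    apply: (@le_trans _ _ (\esum_(t in distinct_tuples (eta w))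
        \sum_(m <oo) (c m * \1_(box (D m)) t)%:E)).
      by apply: le_esum => t [ut _]; exact: h1.
    apply: le_trans (esum_series_le _ _) _; first by move=> m t; rewrite lee_fin mulr_ge0.
    by rewrite (eq_eseriesr (fun m _ => wD m)).
  pose rp t := Num.max (r t) 0%R; pose rn t := Num.max (- r t)%R 0%R.
  have rp0 t : (0 <= rp t)%R by rewrite le_max lexx orbT.
  have rn0 t : (0 <= rn t)%R by rewrite le_max lexx orbT.
  have Goo : G w < +oo by rewrite ltey.
  have Vp : V w rp <= G w.
    apply: le_trans Vr; apply: le_esum => t _; rewrite lee_fin ge_max ler_norm.
    exact: normr_ge0.
  have Vn : V w rn <= G w.
    apply: le_trans Vr; apply: le_esum => t _; rewrite lee_fin ge_max -normrN ler_norm.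
    exact: normr_ge0.
  have VD (g g' : k.-tuple X -> R) : (forall t, 0 <= g t)%R -> (forall t, 0 <= g' t)%R ->
      V w (fun t => g t + g' t)%R = V w g + V w g'.
    by move=> g0 g'0; rewrite -esumD// => t _; rewrite lee_fin.
  rewrite /U_sum (@esum_diff _ _ _ f (fun t => ev (pos_bx 1 s) t + rp t)%R
     (fun t => ev (pos_bx (-1) s) t + rn t)%R); last 5 first.
  + move=> t _; rewrite opprD addrACA.
    have -> : (ev (pos_bx 1 s) t - ev (pos_bx (-1) s) t = ev s t)%R.
      by rewrite !ev_Zint -pos_bx_Zint.
    rewrite -[LHS](subrKC (ev s t)) -/(r t); congr (_ + _)%R.
    by rewrite /rp /rn /Num.max; case: ltgtP => h; case: ltgtP => h'; lra.
  + by move=> t; rewrite addr_ge0 ?pos_bx_ev_ge0.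
  + by move=> t; rewrite addr_ge0 ?pos_bx_ev_ge0.
  + rewrite VD// ?wp; last by move=> t; exact: pos_bx_ev_ge0.
    by rewrite lte_add_pinfty ?ltry// (le_lt_trans Vp).
  + rewrite VD// ?wn; last by move=> t; exact: pos_bx_ev_ge0.
    by rewrite lte_add_pinfty ?ltry// (le_lt_trans Vn).
  rewrite !VD//; try by move=> t; exact: pos_bx_ev_ge0.
  rewrite wp wn; have -> : UI s w = (UI (pos_bx 1 s) w - UI (pos_bx (-1) s) w)%R.
    exact: pos_bx_Zint.
  by apply: abse_diff_le Goo => //; apply: esum_ge0 => t _; rewrite lee_fin.
- move=> B0 fB0.
  have mE : measurable_fun setT (fun w => (expR (num B0 w))%:E).
    by apply/measurable_EFinP; apply: measurableT_comp => //; exact: (measurable_num eta fB0.1).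
  have -> : \int[P]_w (G w * (expR (num B0 w))%:E) =
      \int[P]_w \sum_(m <oo) (c m * \prod_i num (D m i) w * expR (num B0 w))%:E.
    apply: eq_integral => w _; rewrite muleC /G -nneseriesZl; last by move=> m _; rewrite lee_fin.
    by apply: eq_eseriesr => m _; rewrite -EFinM mulrC.
  rewrite integral_nneseries//; last 2 first.
  + move=> m; apply/measurable_EFinP; apply: measurable_funM => //.
    exact/measurable_EFinP.
  + by move=> m w _; rewrite lee_fin mulr_ge0 ?expR_ge0.
  set M := (expR 1 ^+ k * expR (fine (mu B0) * (expR 1 - 1)))%R.
  have M0 : (0 <= M)%R by rewrite mulr_ge0 ?exprn_ge0 ?expR_ge0.
  apply: (@le_trans _ _ (\sum_(m <oo) M%:E * (c m * bmass mu (D m))%:E)); last first.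
    rewrite nneseriesZl; last by move=> m _; rewrite lee_fin mulr_ge0 ?bmass_ge0.
    by rewrite (EFinM M e) lee_wpmul2l.
  apply: lee_nneseries => m _.
    by move=> _; apply: integral_ge0 => w _; rewrite lee_fin mulr_ge0 ?expR_ge0.
  have gs1 : gseq [:: (c m, D m)] by move=> b; rewrite mem_seq1 => /eqP ->; exact: gD.
  have ev1 x : ev [:: (c m, D m)] x = (c m * \1_(box (D m)) x)%R by rewrite /ev big_seq1.
  have := UI_expR_bound eta_poisson fB0 (gseq_fsides gs1) (gseq_offdiag gs1).
  have UI1 w : UI [:: (c m, D m)] w = (c m * \prod_i num (D m i) w)%R.
    by rewrite /step_count /Zint big_seq1.
  case; first by move=> x; rewrite ev1 mulr_ge0.
  move=> i1 b1.
  rewrite (eq_integral (fun w => (UI [:: (c m, D m)] w * expR (num B0 w))%:E)); last first.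
    by move=> w _; rewrite UI1.
  rewrite (rintE i1) -EFinM lee_fin (le_trans b1)// -/M ler_wpM2l//.
  have [_ ->] := rintegrable_ev (gseq_fsides gs1).
  by rewrite /Zint big_seq1.
Qed.

End U_sums.

(** * Chaos decomposition of step U-statistics *)

Section decomposition.
Context (R : realType) (dX dO : measure_display) (X : measurableType dX).
Context (Omega : measurableType dO).
Context (mu : {sigma_finite_measure set X -> \bar R}).
Context (P : probability Omega R) (eta : {RV P >-> point_measure R X}).
Local Notation num := (count_in eta).
Local Notation TI := (step_chaos mu eta).
Local Notation UI := (step_count eta).

Lemma prod_lpart_rpart n m k (e : (n + m)%N = k) (F G : 'I_k -> R) :
  (\prod_(p < k) (if (p < n)%N then F p else G p) =
  \prod_q F (lpart e q) * \prod_l G (rpart e l))%R.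
Proof.
rewrite /lpart /rpart; case: k / e F G => F G.
rewrite big_split_ord/=; congr (_ * _)%R; apply: eq_bigr => i _.
  by rewrite cast_ord_id ltn_ord.
by rewrite cast_ord_id ltnNge leq_addr.
Qed.

(** An algebraic identity in the counts, valid for every [w]. The list is symmetrized because all
    sets of [n] factors then contribute the same, which gives the binomial coefficient in [part]. *)
Lemma UI_decomp k (s : seq (bx R X k)) w :
  UI s w = (\sum_(n < k.+1) TI (part mu (subnKC (leq_ord n)) (sym_bx s)) w)%R.
Proof.
transitivity (\sum_(b <- s) \sum_(n < k.+1) \sum_(sigma : 'S_k) 'C(k, n)%:R * (b.1 / k`!%:R) *
   \prod_(p < k) (if (p < n)%N then ccount mu eta (b.2 (sigma p)) w else fine (mu (b.2 (sigma p)))))%R.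
  apply: eq_bigr => b _.
  have := sum_perm_split (fun p => ccount mu eta (b.2 p) w) (fun p => fine (mu (b.2 p))).
  have -> : (\prod_(i < k) (ccount mu eta (b.2 i) w + fine (mu (b.2 i))) =
      \prod_(i < k) num (b.2 i) w)%R.
    by apply: eq_bigr => i _; rewrite /ccount subrK.
  move=> h; have k0 : k`!%:R != 0%R :> R by rewrite pnatr_eq0 -lt0n fact_gt0.
  apply: (mulfI k0); rewrite mulrCA h mulr_sumr [RHS]mulr_sumr; apply: eq_bigr => n _.
  rewrite -mulr_sumr; move: (\sum_(_ : 'S_k) _)%R (_%:R)%R (_%:R)%R k0 => S c d d0.
  by field.
rewrite exchange_big/=; apply: eq_bigr => n _.
rewrite /step_chaos /Zint /part big_map big_sym_bx; apply: eq_bigr => b _.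
apply: eq_bigr => sigma _ /=.
rewrite (prod_lpart_rpart (subnKC (leq_ord n)) (fun p => ccount mu eta (b.2 (sigma p)) w)
  (fun p => fine (mu (b.2 (sigma p))))).
by rewrite mulrA mulrAC.
Qed.

Hypothesis eta_poisson : poisson_process mu eta.
Hypothesis mu_nonatomic : nonatomic mu.
Context (B : nat -> set X).
Hypothesis sB : separating B.

(** The [L^1] norm is turned into a cover by density, at an extra cost [e / M] with [e] arbitrary.
    The choice [B0 = set0] gives the bound without weight. *)
Lemma U_L1 k (f : k.-tuple X -> R) (Y : Omega -> R) s B0 :
  rintegrable (power_measure mu k) f -> gseq mu s -> fmeas mu B0 ->
  measurable_fun setT Y -> (\forall w \ae P, (Y w)%:E = U_sum f (eta w)) ->
  \int[P]_w (`|Y w - UI s w| * expR (num B0 w))%:E <=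
  (expR 1 ^+ k * expR (fine (mu B0) * (expR 1 - 1)) *
    rint (power_measure mu k) (fun x => `|f x - ev s x|)%R)%:E.
Proof.
move=> fi gs fB0 mY YU.
set M := (expR 1 ^+ k * expR _)%R.
have M0 : (0 < M)%R by rewrite mulr_gt0 ?exprn_gt0 ?expR_gt0.
have fsi : rintegrable (power_measure mu k) (fun x => f x - ev s x)%R.
  by apply: rintegrableB => //; exact: (rintegrable_ev (gseq_fsides gs)).1.
apply/lee_addgt0Pr => e e0.
have e'0 : (0 < e / M)%R by rewrite divr_gt0.
have c := appr_cov mu_nonatomic sB (appr_L1 mu_nonatomic sB fsi) fsi e'0.
have [G [mG G0 aG iG]] := U_estimate eta_poisson mu_nonatomic sB gs c.
have := iG _ fB0; rewrite -/M mulrDr [(M * (e / M))%R]mulrC divfK ?gt_eqF// EFinD.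
apply: le_trans.
have mE : measurable_fun setT (fun w => expR (num B0 w)).
  by apply: measurableT_comp => //; exact: (measurable_num eta fB0.1).
apply: ae_ge0_le_integral => //.
- have mU := measurable_UI eta (gseq_fsides gs).
  have mN := measurableT_comp (@normr_measurable R setT) (measurable_funB mY mU).
  by apply/measurable_EFinP; exact: measurable_funM mN mE.
- by move=> w _; rewrite mule_ge0// lee_fin expR_ge0.
- apply: emeasurable_funM => //; exact/measurable_EFinP.
apply: filterS2 YU aG => w YUw Gw _.
rewrite EFinM lee_wpmul2r ?lee_fin ?expR_ge0//.
by move: Gw; rewrite -YUw -EFinB abse_EFin.
Qed.

End decomposition.

(** * Square-integrable functions *)

Section square_integrable.
Context (R : realType) (d : measure_display) (T : measurableType d).
Context (m : {measure set T -> \bar R}).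
Implicit Types f g h : T -> R.

Definition L2 f := measurable_fun setT f /\ rintegrable m (fun x => f x ^+ 2)%R.
Definition nsq f := rint m (fun x => f x ^+ 2)%R.

Lemma nsq_ge0 f : (0 <= nsq f)%R.
Proof. by apply: rint_ge0 => x; exact: sqr_ge0. Qed.

Lemma L2M f g : L2 f -> L2 g -> rintegrable m (fun x => f x * g x)%R.
Proof.
move=> [mf f2] [mg g2].
apply: (le_rintegrable (g := fun x => f x ^+ 2 + g x ^+ 2)%R).
- exact: measurable_funM.
- exact: rintegrableD.
- by move=> x; rewrite ler_norml; apply/andP; split; nra.
Qed.

Lemma L2Z c f : L2 f -> L2 (fun x => c * f x)%R.
Proof.
move=> [mf f2]; split; first exact: measurable_funM.
rewrite (_ : (fun _ => _) = fun x => c ^+ 2 * f x ^+ 2)%R; last first.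
  by apply/funext => x; rewrite exprMn.
exact: rintegrableZ.
Qed.

Lemma nsqZ c f : L2 f -> nsq (fun x => c * f x)%R = (c ^+ 2 * nsq f)%R.
Proof.
by move=> [mf f2]; rewrite /nsq -rintZ//; apply: eq_rint => x; rewrite exprMn.
Qed.

Lemma L2D f g : L2 f -> L2 g -> L2 (fun x => f x + g x)%R.
Proof.
move=> Lf Lg; split; first exact: (measurable_funD Lf.1 Lg.1).
rewrite (_ : (fun _ => _) = fun x => (f x ^+ 2 + g x ^+ 2) + 2 * (f x * g x))%R.
  apply: rintegrableD; last exact: rintegrableZ (L2M Lf Lg).
  exact: rintegrableD Lf.2 Lg.2.
by apply/funext => x; ring.
Qed.

Lemma nsqD f g : L2 f -> L2 g -> nsq (fun x => f x + g x)%R =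
  (nsq f + nsq g + 2 * rint m (fun x => f x * g x))%R.
Proof.
move=> Lf Lg; have Lfg := L2M Lf Lg.
rewrite /nsq -(rintZ _ Lfg) -(rintD Lf.2 Lg.2) -rintD.
- by apply: eq_rint => x; ring.
- exact: rintegrableD Lf.2 Lg.2.
- exact: rintegrableZ.
Qed.

Lemma L2B f g : L2 f -> L2 g -> L2 (fun x => f x - g x)%R.
Proof.
move=> Lf Lg; have := L2D Lf (L2Z (-1) Lg).
by congr L2; apply/funext => x; rewrite mulN1r.
Qed.

Lemma nsqB f g : L2 f -> L2 g -> nsq (fun x => f x - g x)%R =
  (nsq f + nsq g - 2 * rint m (fun x => f x * g x))%R.
Proof.
move=> Lf Lg; have Lfg := L2M Lf Lg.
transitivity (nsq (fun x => f x + (-1) * g x))%R.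
  by apply: eq_rint => x; rewrite mulN1r.
rewrite nsqD ?nsqZ//; last exact: L2Z.
rewrite sqrrN expr1n mul1r; congr (_ + _)%R.
rewrite -mulrN; congr (_ * _)%R; rewrite -[RHS]mulN1r -(rintZ _ Lfg).
by apply: eq_rint => x; rewrite mulrCA.
Qed.

Lemma L2_0 : L2 (fun=> 0%R).
Proof. by split => //; rewrite expr0n; exact: rintegrable0. Qed.

Lemma L2_sum (I : Type) (s : seq I) (F : I -> T -> R) : (forall i, L2 (F i)) ->
  L2 (fun x => \sum_(i <- s) F i x)%R.
Proof.
move=> LF; elim: s => [|i s IH].
  by rewrite (_ : (fun _ => _) = fun=> 0%R); [exact: L2_0|apply/funext => x; rewrite big_nil].
rewrite (_ : (fun _ => _) = fun x => F i x + \sum_(i <- s) F i x)%R; first exact: L2D.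
by apply/funext => x; rewrite big_cons.
Qed.

Lemma L2_ae f g : measurable_fun setT g -> L2 f -> (\forall x \ae m, f x = g x) -> L2 g.
Proof.
move=> mg [mf f2] fg; split => //; apply: rintegrable_ae f2 _.
  exact: measurable_funX.
by apply: filterS fg => x ->.
Qed.

Lemma nsq_ae f g : measurable_fun setT f -> measurable_fun setT g ->
  (\forall x \ae m, f x = g x) -> nsq f = nsq g.
Proof.
move=> mf mg fg; apply: rint_ae; [exact: measurable_funX..|].
by apply: filterS fg => x ->.
Qed.

Lemma cauchy_schwarz f g : L2 f -> L2 g ->
  (`|rint m (fun x => f x * g x)| <= Num.sqrt (nsq f) * Num.sqrt (nsq g))%R.
Proof.
move=> Lf Lg; rewrite -sqrtrM ?nsq_ge0// -sqrtr_sqr ler_wsqrtr//.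
set b := rint _ _.
have ng := nsq_ge0 g; have nf := nsq_ge0 f.
have Q s t : (0 <= s ^+ 2 * nsq f + t ^+ 2 * nsq g - 2 * (s * t) * b)%R.
  have := nsq_ge0 (fun x => s * f x - t * g x)%R; congr (_ <= _)%R.
  rewrite nsqB ?nsqZ//; [|exact: L2Z..]; congr (_ - _)%R; rewrite -mulrA; congr (_ * _)%R.
  rewrite /b -rintZ; last exact: L2M.
  by apply: eq_rint => x; ring.
have [g0|g0] := eqVneq (nsq g) 0%R.
  have [->|b0] := eqVneq b 0%R; first by rewrite expr0n/= mulr_ge0.
  (* With this choice the nonnegative form [Q] would take the value -1. *)
  have := Q 1%R ((nsq f + 1) / (2 * b))%R; rewrite g0.
  have -> : (2 * (1 * ((nsq f + 1) / (2 * b))) * b = nsq f + 1)%R by field.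
  by rewrite mulr0 addr0 expr1n mul1r opprD addrA subrr sub0r oppr_ge0 ler10.
have g1 : (0 < nsq g)%R by rewrite lt_neqAle eq_sym g0.
(* [Q (nsq g) b] equals [nsq g * (nsq f * nsq g - b ^+ 2)]. *)
rewrite -subr_ge0 -(pmulr_rge0 _ g1); have := Q (nsq g) b; congr (_ <= _)%R; ring.
Qed.

Lemma rint_norm_eq0 f : rintegrable m f -> rint m (fun x => `|f x|)%R = 0%R ->
  \forall x \ae m, f x = 0%R.
Proof.
move=> fi n0; have mf : measurable_fun setT (EFin \o f).
  by apply/measurable_EFinP; exact: rintegrable_meas fi.
have : \int[m]_x `|(EFin \o f) x| = 0.
  by rewrite -[RHS](congr1 EFin n0) -(rintE (rintegrable_norm fi)).
move/(ae_eq_integral_abs m measurableT mf) => h.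
by apply: filterS h => x /(_ I)[].
Qed.

Lemma nsq_eq0 f : L2 f -> nsq f = 0%R -> \forall x \ae m, f x = 0%R.
Proof.
move=> [mf f2] n0; have : rint m (fun x => `|f x ^+ 2|)%R = 0%R.
  by rewrite -[RHS]n0; apply: eq_rint => x; rewrite ger0_norm// sqr_ge0.
move/(rint_norm_eq0 f2) => h.
by apply: filterS h => x /eqP; rewrite sqrf_eq0 => /eqP.
Qed.

Lemma cvg_rintM (u v : nat -> T -> R) f g : (forall n, L2 (u n)) -> (forall n, L2 (v n)) ->
  L2 f -> L2 g ->
  nsq (fun x => u n x - f x)%R @[n --> \oo] --> (0 : R)%R ->
  nsq (fun x => v n x - g x)%R @[n --> \oo] --> (0 : R)%R ->
  rint m (fun x => u n x * v n x)%R @[n --> \oo] --> rint m (fun x => f x * g x)%R.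
Proof.
move=> Lu Lv Lf Lg uf vg.
have sqrt0 (w : nat -> R) : (w n @[n --> \oo] --> (0 : R)%R ->
    Num.sqrt (w n) @[n --> \oo] --> (0 : R)%R)%classic.
  move=> w0; rewrite -[X in _ --> X](@sqrtr0 R).
  exact: (cvg_comp _ _ w0 (@sqrt_continuous R 0%R)).
pose a n := Num.sqrt (nsq (fun x => u n x - f x)%R).
pose b n := Num.sqrt (nsq (fun x => v n x - g x)%R).
have a0 : a n @[n --> \oo] --> (0 : R)%R by exact: sqrt0.
have b0 : b n @[n --> \oo] --> (0 : R)%R by exact: sqrt0.
set l := rint m (fun x => f x * g x)%R.
pose c n := (a n * b n + a n * Num.sqrt (nsq g) + Num.sqrt (nsq f) * b n)%R.
have c0 : c n @[n --> \oo] --> (0 : R)%R.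
  have -> : (0 = 0 * 0 + 0 * Num.sqrt (nsq g) + Num.sqrt (nsq f) * 0 :> R)%R.
    by rewrite !(mul0r, mulr0) !addr0.
  apply: cvgD; first apply: cvgD; apply: cvgM => //; exact: cvg_cst.
have bnd n : (`|rint m (fun x => u n x * v n x) - l| <= c n)%R.
  have L1 := L2B (Lu n) Lf; have L3 := L2B (Lv n) Lg.
  have -> : (rint m (fun x => u n x * v n x) - l =
    rint m (fun x => (u n x - f x) * (v n x - g x)) + rint m (fun x => (u n x - f x) * g x) +
      rint m (fun x => f x * (v n x - g x)))%R.
    apply/eqP; rewrite subr_eq; apply/eqP.
    rewrite /l -!rintD; try by do ?apply: rintegrableD; exact: L2M.
    by apply: eq_rint => x; ring.
  apply: (le_trans (ler_normD _ _)); apply: lerD; last exact: cauchy_schwarz.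
  apply: (le_trans (ler_normD _ _)); apply: lerD; exact: cauchy_schwarz.
apply/cvgrPdist_le => e e0.
move/cvgrPdist_le : c0 => /(_ e e0); apply: filterS => n.
rewrite sub0r normrN => h; rewrite distrC (le_trans (bnd n))//.
exact: le_trans (ler_norm _) h.
Qed.

Lemma Lfun2P f : f \in Lfun m 2%:E <-> L2 f.
Proof.
split=> [h|[mf f2]].
  split; last exact: Lfun2_integrable_sqr.
  by move: h; rewrite inE => /andP[]; rewrite inE.
rewrite inE; apply/andP; split; rewrite inE//= /finite_norm unlock /Lnorm.
apply: poweR_lty.
rewrite (eq_integral (fun x => (f x ^+ 2)%:E)) ?(rintE f2) ?ltry// => x _ /=.
by rewrite powR_mulrn// real_normK// num_real.
Qed.

Lemma Lnorm2E (f : T -> \bar R) g : measurable_fun setT f -> L2 g ->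
  (\forall x \ae m, f x = (g x)%:E) -> 'N[m]_2%:E[f] = (Num.sqrt (nsq g))%:E.
Proof.
move=> mf [mg g2] fg; rewrite unlock /Lnorm.
have -> : \int[m]_x `|f x| `^ 2 = (nsq g)%:E.
  rewrite -(rintE g2); apply: ae_eq_integral => //.
  - by apply: (measurableT_comp (measurable_poweR _)) => //; exact: measurableT_comp.
  - apply/measurable_EFinP; exact: measurable_funX.
  - apply: filterS fg => x -> _ /=.
    by rewrite powR_mulrn// real_normK// num_real.
by rewrite poweR_EFin powR12_sqrt// nsq_ge0.
Qed.

Lemma cvg_sqrt_nsq (w : nat -> R) : (forall n, 0 <= w n)%R ->
  ((Num.sqrt (w n))%:E @[n --> \oo] --> 0)%classic <->
  (w n @[n --> \oo] --> (0 : R)%R)%classic.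
Proof.
move=> w0; split=> [/fine_cvgP[_ h]|h].
  have -> : w = fun n => (Num.sqrt (w n) * Num.sqrt (w n))%R.
    by apply/funext => n; rewrite -expr2 sqr_sqrtr.
  by rewrite -[X in _ --> X](mulr0 (0 : R)%R); exact: (cvgM h h).
apply: cvg_EFin; first by near=> n.
rewrite /= -[X in _ --> X](@sqrtr0 R).
exact: (cvg_comp _ _ h (@sqrt_continuous R 0%R)).
Unshelve. all: by end_near. Qed.

Lemma L2_cvgP (u : nat -> T -> R) (v : T -> R) (f : T -> \bar R) :
  (forall n, L2 (u n)) -> L2 v -> measurable_fun setT f ->
  (\forall x \ae m, f x = (v x)%:E) ->
  L2_cvg m (fun n => EFin \o u n) f <->
  (nsq (fun x => u n x - v x)%R @[n --> \oo] --> (0 : R)%R)%classic.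
Proof.
move=> Lu Lv mf fv; rewrite /L2_cvg -cvg_sqrt_nsq; last by move=> n; exact: nsq_ge0.
rewrite (_ : (fun _ => _) = fun n => (Num.sqrt (nsq (fun x => u n x - v x)%R))%:E)//.
apply/funext => n; apply: Lnorm2E.
- apply: emeasurable_funB => //; apply/measurable_EFinP; exact: (Lu n).1.
- exact: L2B.
- by apply: filterS fv => x /= ->.
Qed.

End square_integrable.

(** * Completeness of the space of square-integrable functions *)

Section completeness.
Context (R : realType) (d : measure_display) (T : measurableType d).
Context (m : {measure set T -> \bar R}).

(* A Cauchy-Schwarz bound whose constant does not depend on [n]. *)
Lemma sqr_sum_le (n : nat) (a : nat -> R) :
  ((\sum_(i < n) a i) ^+ 2 <= 2 * \sum_(i < n) 2 ^+ i * a i ^+ 2)%R.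
Proof.
elim: n a => [|n IH] a; first by rewrite !big_ord0 expr0n mulr0.
rewrite !big_ord_recl/= expr0 mul1r.
have := IH (fun i => a i.+1); set S := (\sum_(i < n) _)%R; set Q := (\sum_(i < n) _)%R => h.
have -> : (\sum_(i < n) 2 ^+ bump 0 i * a (bump 0 i) ^+ 2 = 2 * Q :> R)%R.
  by rewrite mulr_sumr; apply: eq_bigr => i _; rewrite /bump leq0n add1n exprS mulrA.
have := sqr_ge0 (a 0%N - S)%R; nra.
Qed.

(** The rate [8^-1 ^+ n] makes [W], the sum of [2 ^+ n * dd n ^+ 2], integrable, since the integrals
    of its terms are at most [4^-1 ^+ n]. Then [sqr_sum_le] bounds by [2 * W] both the squared
    partial sums of the [|dd n|], whence pointwise convergence, and the squared distances to the
    limit, whence dominated convergence. *)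
Lemma L2_complete (u : nat -> T -> R) : (forall n, L2 m (u n)) ->
  (forall n, (nsq m (fun x => u n.+1 x - u n x) <= 8^-1 ^+ n)%R) ->
  exists2 Y, L2 m Y & nsq m (fun x => u n x - Y x)%R @[n --> \oo] --> (0 : R)%R.
Proof.
move=> Lu h8.
pose dd n x := (u n.+1 x - u n x)%R.
have Ld n : L2 m (dd n) by exact: L2B.
have mdd n : measurable_fun setT (fun x => (2 ^+ n * dd n x ^+ 2)%:E).
  by apply/measurable_EFinP; apply: measurable_funM => //; apply: measurable_funX; exact: (Ld n).1.
pose W x := \sum_(n <oo) (2 ^+ n * dd n x ^+ 2)%:E.
have d0 n x : (0 <= 2 ^+ n * dd n x ^+ 2)%R by apply: mulr_ge0; [exact: exprn_ge0|exact: sqr_ge0].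
have W0 x : 0 <= W x by apply: nneseries_ge0 => n _ _; rewrite lee_fin.
have mW : measurable_fun setT W.
  by apply: ge0_emeasurable_sum => [n x _ _|n _]; [rewrite lee_fin|exact: mdd].
have iW : m.-integrable setT W.
  apply/integrableP; split => //.
  under eq_integral => x _ do rewrite gee0_abs//.
  rewrite integral_nneseries//; last by move=> n x _; rewrite lee_fin.
  apply: (@le_lt_trans _ _ (\sum_(n <oo) (4^-1 ^+ n)%:E)).
    apply: lee_nneseries => [n _ _|n _]; first by apply: integral_ge0 => x _; rewrite lee_fin.
    rewrite (rintE (rintegrableZ (2 ^+ n) (Ld n).2)) lee_fin rintZ; last exact: (Ld n).2.
    have -> : (4^-1 ^+ n = 2 ^+ n * 8^-1 ^+ n :> R)%R by rewrite -exprMn; congr (_ ^+ _)%R; field.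
    by rewrite ler_wpM2l ?exprn_ge0//; exact: h8.
  have geo n : (\sum_(i < n) 4^-1 ^+ i <= 2 - 2 * 4^-1 ^+ n :> R)%R.
    elim: n => [|n IH]; first by rewrite big_ord0 expr0 mulr1 subrr.
    rewrite big_ord_recr/= exprS; move: IH.
    have : (0 <= 4^-1 ^+ n :> R)%R by rewrite exprn_ge0.
    move: (4^-1 ^+ n)%R (\sum_(i < n) _)%R => q S; lra.
  apply: (@le_lt_trans _ _ 2%:E); last exact: ltry.
  apply: lime_le; first by apply: is_cvg_nneseries => n _ _; rewrite lee_fin exprn_ge0.
  near=> n; rewrite sumEFin lee_fin big_mkord (le_trans (geo n))//.
  by rewrite gerBl mulr_ge0// exprn_ge0.
have partial n M x : ((u (M + n)%N x - u M x) ^+ 2)%:E <= 2%:E * W x.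
  have -> : (u (M + n)%N x - u M x = \sum_(i < n) dd (M + i)%N x)%R.
    elim: n => [|n IH]; first by rewrite big_ord0 addn0 subrr.
    by rewrite big_ord_recr/= -IH addnS /dd addrC subrKA.
  apply: (@le_trans _ _ (2%:E * \sum_(0 <= i < (M + n)%N) (2 ^+ i * dd i x ^+ 2)%:E)); last first.
    by rewrite lee_wpmul2l//; apply: nneseries_lim_ge => i _ _; rewrite lee_fin.
  rewrite sumEFin -EFinM lee_fin (le_trans (sqr_sum_le n (fun i => dd (M + i)%N x)))//.
  rewrite ler_wpM2l// big_mkord big_split_ord/= -[leLHS]add0r lerD ?sumr_ge0//.
  apply: ler_sum => i _; rewrite ler_wpM2r ?sqr_ge0// ler_weXn2l ?leq_addl//.
  by rewrite ler1n.
have Woo : \forall x \ae m, W x < +oo.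
  have := integrable_ae measurableT iW; apply: filterS => x /(_ I).
  by rewrite ge0_fin_numE.
have cu : \forall x \ae m, cvgn (fun n => u n x).
  apply: filterS Woo => x Wx.
  have Wf : W x = (fine (W x))%:E by rewrite fineK// ge0_fin_numE.
  have w0 : (0 <= fine (W x))%R by rewrite fine_ge0.
  have cs : cvgn (series (fun n => dd n x)).
    apply: normed_cvg; apply: nondecreasing_is_cvgn.
      by apply: nondecreasing_series => i _ _ /=.
    exists (1 + 2 * fine (W x))%R => _ [n _ <-].
    change ((\sum_(0 <= i < n) `|dd i x|)%R <= 1 + 2 * fine (W x))%R; rewrite big_mkord.
    have h : ((\sum_(i < n) `|dd i x|) ^+ 2 <= 2 * fine (W x))%R.
      apply: (le_trans (sqr_sum_le n (fun i => `|dd i x|%R))); rewrite ler_wpM2l//.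
      rewrite -lee_fin -Wf -sumEFin -(big_mkord xpredT (fun i => (2 ^+ i * `|dd i x| ^+ 2)%:E)).
      rewrite (eq_bigr (fun i => (2 ^+ i * dd i x ^+ 2)%:E)); last first.
        by move=> i _; rewrite real_normK// num_real.
      by apply: nneseries_lim_ge => i _ _; rewrite lee_fin.
    move: h; set S := (\sum_(i < n) _)%R => h; nra.
  have -> : (fun n => u n x) = (fun n => u 0%N x + series (fun n => dd n x) n)%R.
    apply/funext => n; rewrite seriesEnat/=.
    by rewrite telescope_sumr// subrKC.
  by apply: is_cvgD => //; exact: is_cvg_cst.
(* The upper limit is measurable without any convergence, and is the limit almost everywhere. *)
pose Y x := fine (limn_esup (fun n => (u n x)%:E)).
have mY : measurable_fun setT Y.
  apply: measurableT_comp => //; apply: measurable_fun_limn_esup => n.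
  by apply/measurable_EFinP; exact: (Lu n).1.
have uY : \forall x \ae m, u n x @[n --> \oo] --> Y x.
  apply: filterS cu => x cx; rewrite /Y.
  have h : (u n x)%:E @[n --> \oo] --> (limn (fun n => u n x))%:E.
    by apply: cvg_EFin; [near=> n|exact: cx].
  by rewrite (cvg_limn_einf_sup h).2.
have bnd : \forall x \ae m, forall n, ((u n x - Y x) ^+ 2)%:E <= 2%:E * W x.
  apply: filterS2 uY Woo => x ux Wx n.
  have Wf : W x = (fine (W x))%:E by rewrite fineK// ge0_fin_numE.
  have c1 : ((u (n + M)%N x - u n x) ^+ 2)%R @[M --> \oo] --> ((Y x - u n x) ^+ 2)%R.
    have c2 : (u (n + M)%N x - u n x)%R @[M --> \oo] --> (Y x - u n x)%R.
      apply: cvgB; last exact: cvg_cst.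
      have -> : (fun M => u (n + M)%N x) = (fun M => u (M + n)%N x).
        by apply/funext => M; rewrite addnC.
      by rewrite (cvg_shiftn n (fun M => u M x)).
    exact: (cvgM c2 c2).
  have -> : ((u n x - Y x) ^+ 2 = (Y x - u n x) ^+ 2)%R by ring.
  rewrite Wf -EFinM lee_fin -(cvg_lim _ c1)//.
  apply: limr_le; first by apply/cvg_ex; eexists; exact: c1.
  by near=> M; rewrite -lee_fin [leRHS]EFinM -Wf; exact: partial.
have mD n : measurable_fun setT (fun x => (u n x - Y x) ^+ 2)%R.
  by apply: measurable_funX; exact: (measurable_funB (Lu n).1 mY).
have LD n : L2 m (fun x => u n x - Y x)%R.
  split; first exact: (measurable_funB (Lu n).1 mY).
  apply: rintegrableP => //.
  have i2W : m.-integrable setT (fun x => 2%:E * W x) by exact: integrableZl.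
  move/integrableP : (i2W) => [m2W]; apply: le_lt_trans.
  apply: ae_ge0_le_integral => //.
  - by apply/measurable_EFinP; exact: measurableT_comp.
  - exact: measurableT_comp.
  - apply: filterS bnd => x /(_ n) h _.
    by rewrite ger0_norm ?sqr_ge0// gee0_abs// mule_ge0.
exists Y.
  have := L2B (Lu 0%N) (LD 0%N); congr L2; apply/funext => x; ring.
have [] := @dominated_convergence _ _ _ m _ measurableT
    (fun n x => ((u n x - Y x) ^+ 2)%:E) (cst 0) (fun x => 2%:E * W x).
- by move=> n; apply/measurable_EFinP; exact: mD.
- exact: measurable_cst.
- apply: filterS uY => x ux _.
  have c2 : (u n x - Y x)%R @[n --> \oo] --> (Y x - Y x)%R by apply: cvgB => //; exact: cvg_cst.
  apply: cvg_EFin; first by near=> n.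
  rewrite subrr in c2; rewrite -[X in _ --> X](mulr0 (0 : R)%R); exact: (cvgM c2 c2).
- exact: integrableZl.
- apply: filterS bnd => x h n _; rewrite gee0_abs ?lee_fin ?sqr_ge0//.
by move=> _ _; rewrite integral0 => h; exact: (fine_cvg h).
Unshelve. all: by end_near. Qed.
End completeness.

(** * Symmetric step functions in both norms *)

Section density.
Context (R : realType) (dX : measure_display) (X : measurableType dX).
Context (mu : {sigma_finite_measure set X -> \bar R}).
Local Notation mun n := (power_measure mu n).

Definition good n (s : seq (bx R X n)) := [/\ fsides mu s, offdiag (ev s) & symfun (ev s)].

Definition aesym n (g : n.-tuple X -> R) := forall sigma : 'S_n,
  \forall x \ae mun n, g (permute_tuple sigma x) = g x.

Lemma rint_permute n (sigma : 'S_n) (g : n.-tuple X -> R) : measurable_fun setT g ->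
  (forall x, 0 <= g x)%R ->
  rint (mun n) (fun x => g (permute_tuple sigma x)) = rint (mun n) g.
Proof.
move=> mg g0; rewrite /rint /Rintegral; congr fine.
rewrite (ge0_integral_permute mu sigma (f := EFin \o g))//.
exact/measurable_EFinP.
Qed.

Lemma rintegrable_permute n (sigma : 'S_n) (g : n.-tuple X -> R) :
  rintegrable (mun n) g -> rintegrable (mun n) (fun x => g (permute_tuple sigma x)).
Proof.
move=> gi; have mg := rintegrable_meas gi; apply: rintegrableP.
  exact: (measurableT_comp mg (@measurable_permute _ _ _ sigma)).
rewrite (ge0_integral_permute mu sigma (f := fun x => `|g x|%:E)); first exact: rintegrable_lty.
- by apply/measurable_EFinP; exact: measurableT_comp.
- by [].
Qed.

(** [f] is almost everywhere its own average over permutations, and permutations preserve the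
    measure, so averaging the step function does not increase the distance. *)
Lemma sym_bx_L1 n (f : n.-tuple X -> R) (s : seq (bx R X n)) : rintegrable (mun n) f ->
  aesym f -> fsides mu s ->
  (rint (mun n) (fun x => `|f x - ev (sym_bx s) x|) <=
  rint (mun n) (fun x => `|f x - ev s x|))%R.
Proof.
move=> fi fs fss.
have fact0 : n`!%:R != 0%R :> R by rewrite pnatr_eq0 -lt0n fact_gt0.
pose h x := (`|f x - ev s x|)%R.
have hi0 : rintegrable (mun n) (fun x => f x - ev s x)%R.
  by apply: rintegrableB => //; exact: (rintegrable_ev fss).1.
have hi : rintegrable (mun n) h by exact: rintegrable_norm.
pose H x := (\sum_(sigma : 'S_n) (n`!%:R)^-1 * h (permute_tuple sigma x))%R.
have Hi : rintegrable (mun n) H.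
  exact: rintegrable_sum (fun sigma => rintegrable_permute sigma hi).
have <- : rint (mun n) H = rint (mun n) h.
  rewrite /H rint_sum; last by move=> sigma; exact: rintegrable_permute.
  rewrite (eq_bigr (fun=> (n`!%:R)^-1 * rint (mun n) h)%R); last first.
    move=> sigma _; congr (_ * _)%R; apply: rint_permute; first exact: rintegrable_meas hi.
    by move=> x; exact: normr_ge0.
  by rewrite sumr_const card_Sn -[LHS]mulr_natl mulrA divff// mul1r.
have gi : rintegrable (mun n) (fun x => f x - ev (sym_bx s) x)%R.
  by apply: rintegrableB => //; exact: (rintegrable_ev (fsides_sym_bx fss)).1.
rewrite -lee_fin -!rintE//; last exact: rintegrable_norm.
apply: ae_ge0_le_integral => //.
- by apply/measurable_EFinP; exact: rintegrable_meas (rintegrable_norm gi).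
- by move=> x _; rewrite lee_fin; apply: sumr_ge0 => sigma _; apply: mulr_ge0; [by rewrite invr_ge0|exact: normr_ge0].
- by apply/measurable_EFinP; exact: rintegrable_meas Hi.
have : \forall x \ae mun n, forall sigma : 'S_n, f (permute_tuple sigma x) = f x.
  exact: filter_forall.
apply: filterS => x fx _; rewrite lee_fin ev_sym_bx /H -mulr_sumr.
have -> : f x = ((n`!%:R)^-1 * \sum_(sigma : 'S_n) f (permute_tuple sigma x))%R.
  rewrite (eq_bigr (fun=> f x)) => [|sigma _]; last exact: fx.
  by rewrite sumr_const card_Sn -[X in (_ * X)%R]mulr_natl mulrA mulVf// mul1r.
rewrite -mulrBr -sumrB normrM ger0_norm ?invr_ge0// ler_wpM2l ?invr_ge0//.
exact: ler_norm_sum.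
Qed.

Definition clamp (M x : R) : R := Num.max (- M)%R (Num.min x M).

Lemma clamp_le M x : (0 <= M -> `|clamp M x| <= M)%R.
Proof.
move=> M0; rewrite /clamp ler_norml le_max lexx/= ge_max; apply/andP; split.
  by rewrite (le_trans _ M0)// oppr_le0.
by rewrite ge_min lexx orbT.
Qed.

Lemma clamp_id M x : (`|x| <= M -> clamp M x = x)%R.
Proof.
rewrite ler_norml => /andP[a b]; rewrite /clamp (min_idPl b).
by apply/max_idPr.
Qed.

Lemma clamp0 M : (0 <= M -> clamp M 0 = 0)%R.
Proof. by move=> M0; apply: clamp_id; rewrite normr0. Qed.

Lemma clamp_lip M x y : (0 <= M -> `|clamp M x - clamp M y| <= `|x - y|)%R.
Proof.
move=> M0; rewrite /clamp /Num.max /Num.min.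
by case: (ltP x M) => ?; case: (ltP y M) => ?; case: (ltP (- M)%R x) => ?;
  case: (ltP (- M)%R y) => ?; case: (ltP (- M)%R M) => ?;
  rewrite ler_norml; apply/andP; split;
  have := ler_norm (x - y)%R; have := ler_norm (- (x - y))%R; rewrite normrN; lra.
Qed.

Lemma clamp_norm M x : (0 <= M -> `|clamp M x| <= `|x|)%R.
Proof. by move=> M0; have := clamp_lip x 0%R M0; rewrite clamp0// !subr0. Qed.

Lemma clamp_sub M x : (0 <= M -> `|x - clamp M x| <= `|x|)%R.
Proof.
move=> M0; rewrite /clamp /Num.max /Num.min.
by case: (ltP x M) => ?; case: (ltP (- M)%R x) => ?; case: (ltP (- M)%R M) => ?;
  rewrite ler_norml; apply/andP; split;
  have := ler_norm x; have := ler_norm (- x)%R; rewrite normrN; lra.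
Qed.

Lemma measurable_clamp M : measurable_fun setT (clamp M).
Proof.
apply: measurable_maxr => //; exact: measurable_minr.
Qed.

(** Clamping fixes 0 and acts on the values over the atoms, so the result is again a step function
    over the same atoms. *)
Lemma clamp_bx n M (s : seq (bx R X n)) : (0 <= M)%R -> good s ->
  exists2 t : seq (bx R X n), good t & forall x, ev t x = clamp M (ev s x).
Proof.
move=> M0 [fs os ss]; have [K [C [aC sC]]] := exists_atoms_seq fs.
have se := simple_on_ev aC sC.
have sg : simple_on C (fun x => clamp M (ev s x)).
  exact: (simple_on_comp2 (G := fun a _ => clamp M a) (clamp0 M0) se se).
exists (aseq C (coef C (fun x => clamp M (ev s x)))); last first.
  by move=> x; rewrite -(simple_onE aC).
split; first exact: fsides_aseq.
  by move=> x nx; rewrite -(simple_onE aC)// os// clamp0.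
by move=> sigma x; rewrite -!(simple_onE aC)// ss.
Qed.

Hypothesis mu_nonatomic : nonatomic mu.
Context (B : nat -> set X).
Hypothesis sB : separating B.

Lemma L1_approx n (f : n.-tuple X -> R) e : rintegrable (mun n) f -> (0 < e)%R ->
  exists2 s, gseq mu s & (rint (mun n) (fun x => `|f x - ev s x|) <= e)%R.
Proof.
move=> fi e0; have [s gs cs] := appr_L1 mu_nonatomic sB fi e0.
exists s => //; apply: (cov_rint mu_nonatomic sB _ cs).2.
by apply: measurable_funB; [exact: rintegrable_meas fi|exact: measurable_ev (gseq_fsides gs)].
Qed.

Lemma gseq_good n (s : seq (bx R X n)) : gseq mu s -> good (sym_bx s).
Proof.
move=> gs; split; last exact: sym_bx_sym.
- by apply: fsides_sym_bx; exact: gseq_fsides gs.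
- by apply: sym_bx_offdiag; exact: gseq_offdiag gs.
Qed.

(** Clamping is 1-Lipschitz and leaves [g] unchanged, so it enforces the bound [M] at no cost. *)
Lemma good_approx_bounded n M (g : n.-tuple X -> R) e : rintegrable (mun n) g -> aesym g ->
  (0 <= M)%R -> (forall x, `|g x| <= M)%R -> (0 < e)%R ->
  exists t, [/\ good t, forall x, (`|ev t x| <= M)%R &
    (rint (mun n) (fun x => `|g x - ev t x|) <= e)%R].
Proof.
move=> gi sg M0 gM e0; have [s gs cs] := L1_approx gi e0.
have [t gt tE] := clamp_bx M0 (gseq_good gs); exists t; split => //.
  by move=> x; rewrite tE; exact: clamp_le.
apply: le_trans cs; apply: le_trans (sym_bx_L1 gi sg (gseq_fsides gs)).
have [ft _ _] := gt; have [fss _ _] := gseq_good gs.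
apply: le_rint.
- by apply/rintegrable_norm/rintegrableB => //; exact: (rintegrable_ev ft).1.
- by apply/rintegrable_norm/rintegrableB => //; exact: (rintegrable_ev fss).1.
- by move=> x; rewrite tE -{1}(clamp_id (gM x)); exact: clamp_lip.
Qed.

Lemma rint_clamp (d : measure_display) (T : measurableType d) (m : {measure set T -> \bar R})
    (p : nat) (G : T -> R) : (0 < p)%N -> measurable_fun setT G ->
  rintegrable m (fun x => `|G x| ^+ p)%R ->
  rint m (fun x => `|G x - clamp n%:R (G x)| ^+ p)%R @[n --> \oo] --> (0 : R)%R.
Proof.
move=> p0 mG iG.
have [] := @dominated_convergence _ _ _ m _ measurableT
    (fun n x => (`|G x - clamp n%:R (G x)| ^+ p)%:E) (cst 0) (fun x => (`|G x| ^+ p)%:E).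
- move=> n; apply/measurable_EFinP; apply: measurable_funX; apply: measurableT_comp => //.
  apply: measurable_funB => //; exact: (measurableT_comp (measurable_clamp _) mG).
- exact: measurable_cst.
- apply: aeW => x _; apply: cvg_near_cst.
  near=> n; rewrite clamp_id ?subrr ?normr0 ?expr0n ?gtn_eqF//.
  near: n; exact: nbhs_infty_ger.
- by [].
- apply: aeW => x n _; rewrite gee0_abs ?lee_fin ?exprn_ge0//.
  by rewrite lerXn2r ?nnegrE//; exact: clamp_sub.
by move=> _ _; rewrite integral0 => h; exact: (fine_cvg h).
Unshelve. all: by end_near. Qed.

Lemma L2_rintegrable_norm (d : measure_display) (T : measurableType d)
  (m : {measure set T -> \bar R}) (G : T -> R) :
  L2 m G -> rintegrable m (fun x => `|G x| ^+ 2)%R.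
Proof.
by move=> [_]; congr rintegrable; apply/funext => x; rewrite real_normK// num_real.
Qed.

Lemma nsqD_le (d : measure_display) (T : measurableType d)
  (m : {measure set T -> \bar R}) (G H : T -> R) : L2 m G -> L2 m H ->
  (nsq m (fun x => G x + H x) <= 2 * nsq m G + 2 * nsq m H)%R.
Proof.
move=> LG LH; rewrite nsqD//; have := nsq_ge0 m (fun x => G x - H x)%R.
by rewrite nsqB//; lra.
Qed.

Lemma good_L2 n (t : seq (bx R X n)) : fsides mu t -> L2 (mun n) (ev t).
Proof.
move=> ft; have [K [C [aC sC]]] := exists_atoms_seq ft.
have st := simple_on_ev aC sC.
split; first exact: measurable_ev ft.
have G0 : (0 ^+ 2 = 0 :> R)%R by rewrite expr0n.
have s2 : simple_on C (fun x => ev t x ^+ 2)%R.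
  exact: (simple_on_comp2 (G := fun a _ => (a ^+ 2)%R) G0 st st).
by have [] := rint_simple aC s2.
Qed.

(** The [L^2] norm is needed to define the multiple integral, the [L^1] norm to compare [g] with
    kernels of step approximations of [f]. After truncation at [N], both functions are bounded by
    [N], and the squared distance is at most [2 * N] times the [L^1] distance. *)
Lemma good_approx n (g : n.-tuple X -> R) e : rintegrable (mun n) g -> L2 (mun n) g ->
  aesym g -> (0 < e)%R ->
  exists t, [/\ good t, (rint (mun n) (fun x => `|g x - ev t x|) <= e)%R &
    (nsq (mun n) (fun x => g x - ev t x) <= e)%R].
Proof.
move=> gi Lg sg e0; have mg := Lg.1.
have e4 : (0 < e / 4)%R by rewrite divr_gt0.
have gi1 : rintegrable (mun n) (fun x => `|g x| ^+ 1)%R by exact: rintegrable_norm.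
have c1 := rint_clamp (ltn0Sn 0) mg gi1.
have c2 := rint_clamp (ltn0Sn 1) mg (L2_rintegrable_norm Lg).
move/cvgrPdist_le : c1 => /(_ _ e4) c1; move/cvgrPdist_le : c2 => /(_ _ e4) c2.
have [N [h1 h2]] := filter_ex (filterI c1 c2).
move: h1 h2; rewrite !sub0r !normrN => h1 h2.
pose gN x := clamp N%:R (g x).
have N0 : (0 <= N%:R :> R)%R by [].
have mgN : measurable_fun setT gN by exact: (measurableT_comp (measurable_clamp _) mg).
have giN : rintegrable (mun n) gN.
  apply: le_rintegrable mgN (rintegrable_norm gi) _ => x; exact: clamp_norm.
have LgN : L2 (mun n) gN.
  split => //; apply: le_rintegrable Lg.2 _; first exact: measurable_funX.
  move=> x; rewrite normrX -[leRHS]real_normK ?num_real// lerXn2r ?nnegrE//.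
  exact: clamp_norm.
have sgN : aesym gN by move=> sigma; apply: filterS (sg sigma) => x; rewrite /gN => ->.
(* Chosen so that [2 * N] times it is at most [e / 4]; the added 1 covers [N = 0]. *)
have d0 : (0 < e / (4 * (2 * N%:R + 1)))%R.
  by rewrite divr_gt0// mulr_gt0// ltr_wpDl// mulr_ge0.
have [t [gt tN ht]] := good_approx_bounded giN sgN N0 (fun x => clamp_le (g x) N0) d0.
have [ft _ _] := gt; have ti := (rintegrable_ev ft).1; have Lt := good_L2 ft.
have iB : rintegrable (mun n) (fun x => `|gN x - ev t x|)%R.
  by apply/rintegrable_norm/rintegrableB.
have r1 : (rint (mun n) (fun x => `|g x - gN x|) <= e / 4)%R.
  exact: le_trans (ler_norm _) h1.
have r2 : (nsq (mun n) (fun x => g x - gN x) <= e / 4)%R.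
  apply: le_trans h2; apply: le_trans (ler_norm _).
  rewrite le_eqVlt; apply/orP; left; apply/eqP; apply: eq_rint => x.
  by rewrite real_normK// num_real.
have r3 : (e / (4 * (2 * N%:R + 1)) <= e / 4)%R.
  by rewrite ler_pM2l// lef_pV2 ?posrE ?mulr_gt0 ?ltr_wpDl ?mulr_ge0// ler_peMr// lerDr mulr_ge0.
exists t; split => //.
  have : (rint (mun n) (fun x => `|g x - ev t x|) <=
     rint (mun n) (fun x => `|g x - gN x| + `|gN x - ev t x|))%R.
    apply: le_rint; first by apply/rintegrable_norm/rintegrableB.
      by apply: rintegrableD iB; apply/rintegrable_norm/rintegrableB.
    by move=> x; have := ler_normD (g x - gN x)%R (gN x - ev t x)%R; rewrite subrKA.
  by rewrite rintD//; [lra|apply/rintegrable_norm/rintegrableB].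
have r4 : (nsq (mun n) (fun x => gN x - ev t x) <= e / 4)%R.
  have : (nsq (mun n) (fun x => gN x - ev t x) <=
      rint (mun n) (fun x => 2 * N%:R * `|gN x - ev t x|))%R.
    apply: le_rint; [exact: (L2B LgN Lt).2|exact: rintegrableZ|move=> x].
    rewrite -[leLHS]real_normK ?num_real// expr2 ler_wpM2r//.
    apply: (le_trans (ler_normB _ _)); rewrite mulr2n mulrDl mul1r lerD//.
    exact: clamp_le.
  rewrite rintZ// => /le_trans -> //.
  apply: (@le_trans _ _ (2 * N%:R * (e / (4 * (2 * N%:R + 1)))))%R.
    by rewrite ler_wpM2l ?mulr_ge0.
  have N1 : (0 < 2 * N%:R + 1 :> R)%R by rewrite ltr_wpDl// mulr_ge0.
  rewrite mulrA ler_pdivrMr ?mulr_gt0//; move: N0 N1 e0; move: (N%:R : R)%R => q; nra.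
have := nsqD_le (L2B Lg LgN) (L2B LgN Lt).
have -> : nsq (mun n) (fun x => g x - gN x + (gN x - ev t x))%R =
   nsq (mun n) (fun x => g x - ev t x)%R by apply: eq_rint => x; rewrite subrKA.
lra.
Qed.

End density.

(** * The kernels *)

Section sections.
Context (R : realType) (dX : measure_display) (X : measurableType dX).
Context (mu : {sigma_finite_measure set X -> \bar R}).
Context (n m k : nat) (e : (n + m)%N = k).
Local Notation mun n := (power_measure mu n).
Implicit Types f : k.-tuple X -> R.

Definition sect f (y : n.-tuple X) : R := rint (mun m) (fun x => f (cat_cast e (y, x))).

Lemma sect_ae f : rintegrable (mun k) f ->
  \forall y \ae mun n, rintegrable (mun m) (fun x => f (cat_cast e (y, x))).
Proof. by move=> /(integral_cat e)[fi _]; exact: (ae_integrable1 fi). Qed.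

Lemma measurable_sect f : rintegrable (mun k) f -> measurable_fun setT (sect f).
Proof.
move=> /(integral_cat e)[fi _]; apply: measurableT_comp => //.
exact: (measurable_fubini_F fi).
Qed.

Lemma sect_le f : rintegrable (mun k) f ->
  rintegrable (mun n) (sect f) /\
  (rint (mun n) (fun y => `|sect f y|) <= rint (mun k) (fun x => `|f x|))%R.
Proof.
move=> fi; have ms := measurable_sect fi.
have ni := rintegrable_norm fi.
have le : \int[mun n]_y `|sect f y|%:E <= (rint (mun k) (fun x => `|f x|)%R)%:E.
  rewrite -(rintE ni) (ge0_integral_cat mu e); last 2 first.
  - by apply/measurable_EFinP; exact: rintegrable_meas ni.
  - by move=> x; rewrite lee_fin.
  have mn : measurable_fun setT (fun z : n.-tuple X * m.-tuple X => (`|f (cat_cast e z)|)%:E).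
    apply/measurable_EFinP; apply: (measurableT_comp (rintegrable_meas ni)).
    exact: measurable_cat_cast.
  rewrite fubini_tonelli1//.
  apply: ae_ge0_le_integral => //.
  - by apply/measurable_EFinP; exact: measurableT_comp.
  - by move=> y _; apply: integral_ge0 => x _; rewrite lee_fin.
  - by apply: (measurable_fun_fubini_tonelli_F _ mn) => x; rewrite lee_fin.
  apply: filterS (sect_ae fi) => y yi _; rewrite /fubini_F.
  rewrite (rintE (rintegrable_norm yi)) lee_fin; exact: ler_norm_rint.
have si : rintegrable (mun n) (sect f).
  by apply: rintegrableP ms _; exact: le_lt_trans le (ltry _).
by split => //; rewrite -lee_fin -rintE//; exact: rintegrable_norm.
Qed.

Lemma sect_part_L1 f (s : seq (bx R X k)) : rintegrable (mun k) f -> fsides mu s ->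
  (rint (mun n) (fun y => `|'C(k, n)%:R * sect f y - ev (part mu e s) y|) <=
  'C(k, n)%:R * rint (mun k) (fun x => `|f x - ev s x|))%R.
Proof.
move=> fi fs; have si := (rintegrable_ev fs).1.
have di := rintegrableB fi si; have [di' dl] := sect_le di.
have mp := measurable_ev (fsides_part (e := e) fs).
have -> : rint (mun n) (fun y => `|'C(k, n)%:R * sect f y - ev (part mu e s) y|)%R =
   rint (mun n) (fun y => 'C(k, n)%:R * `|sect (fun x => f x - ev s x) y|)%R.
  apply: rint_ae.
  - apply: measurableT_comp => //; apply: measurable_funB => //.
    by apply: measurable_funM => //; exact: measurable_sect.
  - by apply: measurable_funM => //; apply: measurableT_comp => //; exact: measurable_sect.
  apply: filterS2 (sect_ae fi) (sect_ae si) => y yf ys.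
  rewrite (ev_part e y fs).2 -mulrBr normrM ger0_norm//; congr (_ * `|_|)%R.
  by rewrite /sect rintB.
rewrite rintZ; last exact: rintegrable_norm.
by rewrite ler_wpM2l.
Qed.

End sections.

Lemma eq_dist_scale (R : realType) (a b K : R) :
  (forall e : R, 0 < e -> `|a - b| <= K * e)%R -> a = b.
Proof.
move=> h; apply/eqP; rewrite -subr_eq0 -normr_le0; apply/ler_addgt0Pr => e e0.
rewrite add0r; apply: (le_trans (h (e / (`|K| + 1))%R _)).
  by rewrite divr_gt0// ltr_wpDl.
rewrite mulrA ler_pdivrMr ?ltr_wpDl// mulrC ler_wpM2l ?ltW//.
by rewrite (le_lt_trans (ler_norm K))// ltrDl.
Qed.

(** * Testing the U-statistic against multiple integrals of step functions *)

Section kernels.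
Context (R : realType) (dX dO : measure_display) (X : measurableType dX).
Context (Omega : measurableType dO).
Context (mu : {sigma_finite_measure set X -> \bar R}).
Context (P : probability Omega R) (eta : {RV P >-> point_measure R X}).
Hypothesis eta_poisson : poisson_process mu eta.
Local Notation mun n := (power_measure mu n).
Local Notation TI := (step_chaos mu eta).
Local Notation UI := (step_count eta).

Lemma TI_L2 n (t : seq (bx R X n)) : good mu t ->
  L2 P (TI t) /\ nsq P (TI t) = (n`!%:R * nsq (mun n) (ev t))%R.
Proof.
move=> [ft ot st]; have [i e] := TI_isometry eta_poisson ft ft ot ot st.
by split => //; split => //; exact: measurable_TI.
Qed.

Lemma ev_bounded n (t : seq (bx R X n)) : exists M : R, forall x, (`|ev t x| <= M)%R.
Proof.
exists (\sum_(b <- t) `|b.1|)%R => x; rewrite /ev.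
apply: (le_trans (ler_norm_sum _ _ _)); apply: ler_sum => b _.
by rewrite normrM ler_piMr// indicE; case: (_ \in _); rewrite ?normr1 ?normr0.
Qed.

Hypothesis mu_nonatomic : nonatomic mu.
Context (B : nat -> set X).
Hypothesis sB : separating B.
Context (k : nat) (f : k.-tuple X -> R) (Y : Omega -> R).
Hypothesis fi : rintegrable (mun k) f.
Hypothesis sf : aesym mu f.
Hypothesis LY : L2 P Y.
Hypothesis YU : \forall w \ae P, (Y w)%:E = U_sum f (eta w).

Definition Ukernel (i : 'I_k.+1) (y : i.-tuple X) : R :=
  ('C(k, i)%:R * sect mu (subnKC (leq_ord i)) f y)%R.
Local Notation kern := Ukernel.

Local Notation pt s i := (part mu (subnKC (leq_ord i)) (sym_bx s)).

Lemma part_good (s : seq (bx R X k)) (i : 'I_k.+1) : gseq mu s -> good mu (pt s i).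
Proof.
move=> /gseq_good[fs os ss]; split; [exact: fsides_part|exact: part_offdiag|exact: part_sym].
Qed.

Lemma kern_part (s : seq (bx R X k)) (i : 'I_k.+1) : gseq mu s ->
  (rint (mun i) (fun y => `|kern y - ev (pt s i) y|) <=
   'C(k, i)%:R * rint (mun k) (fun x => `|f x - ev s x|))%R.
Proof.
move=> gs; have [fs os ss] := gseq_good gs.
apply: (le_trans (sect_part_L1 _ fi fs)); rewrite ler_wpM2l//.
exact: sym_bx_L1 fi sf (gseq_fsides gs).
Qed.

Lemma kern_rintegrable (i : 'I_k.+1) : rintegrable (mun i) (@Ukernel i).
Proof. by apply: rintegrableZ; exact: (sect_le _ fi).1. Qed.

Lemma UI_L2 (s : seq (bx R X k)) : gseq mu s -> L2 P (UI s).
Proof.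
move=> gs; rewrite (_ : UI s = fun w => \sum_(i < k.+1) TI (pt s i) w)%R; last first.
  by apply/funext => w; exact: UI_decomp.
by apply: L2_sum => i; exact: (TI_L2 (part_good i gs)).1.
Qed.

Lemma rint_UI_TI n (t : seq (bx R X n)) (s : seq (bx R X k)) : gseq mu s -> good mu t ->
  rint P (fun w => UI s w * TI t w)%R =
  (\sum_(i < k.+1) rint P (fun w => TI (pt s i) w * TI t w))%R.
Proof.
move=> gs gt; have Lt := (TI_L2 gt).1.
rewrite (eq_rint _ (g := fun w => \sum_(i < k.+1) 1 * (TI (pt s i) w * TI t w))%R).
  rewrite rint_sum; first by apply: eq_bigr => i _; rewrite mul1r.
  by move=> i; exact: L2M (TI_L2 (part_good i gs)).1 Lt.
by move=> w; rewrite (UI_decomp mu) mulr_suml; apply: eq_bigr => i _; rewrite mul1r.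
Qed.

(** [TI t] is unbounded but at most a multiple of [expR (num B0)], so the weighted estimate [U_L1]
    applies. As [K] depends on [t] only, [s] may vary afterwards. *)
Lemma Y_TI_approx n (t : seq (bx R X n)) : good mu t -> exists K : R, forall s e,
  gseq mu s -> (rint (mun k) (fun x => `|f x - ev s x|) <= e)%R ->
  (`|rint P (fun w => Y w * TI t w) - rint P (fun w => UI s w * TI t w)| <= K * e)%R.
Proof.
move=> gt; have Lt := (TI_L2 gt).1; have [ft _ _] := gt.
have [B0 [c [fB0 hc]]] := TI_expR_bound eta_poisson ft.
pose K0 := (expR 1 ^+ k * expR (fine (mu B0) * (expR 1 - 1)))%R : R.
have K00 : (0 <= K0)%R by rewrite mulr_ge0 ?exprn_ge0 ?expR_ge0.
exists (`|c| * K0)%R => s e gs se.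
have Ls := UI_L2 gs; have iYt := L2M LY Lt; have ist := L2M Ls Lt.
rewrite -rintB//; apply: (le_trans (ler_norm_rint (rintegrableB iYt ist))).
rewrite -lee_fin -rintE; last exact/rintegrable_norm/rintegrableB.
apply: (@le_trans _ _ (`|c|%:E * \int[P]_w (`|Y w - UI s w| * expR (count_in eta B0 w))%:E)).
  have mE : measurable_fun setT (fun w => expR (count_in eta B0 w)).
    by apply: measurableT_comp => //; exact: (measurable_num eta fB0.1).
  have mN := measurableT_comp (@normr_measurable R setT) (measurable_funB LY.1 Ls.1).
  have mG : measurable_fun setT (fun w => (`|Y w - UI s w| * expR (count_in eta B0 w))%:E).
    by apply/measurable_EFinP; exact: measurable_funM mN mE.
  rewrite -ge0_integralZl//.
  apply: ae_ge0_le_integral => //.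
  - by apply/measurable_EFinP/measurableT_comp => //; apply: measurable_funB;
      [exact: rintegrable_meas iYt|exact: rintegrable_meas ist].
  - exact: measurable_funeM.
  apply: filterS hc => w hw _; rewrite -EFinM lee_fin -mulrBl normrM mulrCA ler_wpM2l//.
  by rewrite (le_trans hw)// ler_wpM2r ?expR_ge0// ler_norm.
rewrite -mulrA EFinM lee_wpmul2l//.
apply: (le_trans (U_L1 eta_poisson mu_nonatomic sB fi gs fB0 LY.1 YU)).
by rewrite lee_fin -/K0 ler_wpM2l.
Qed.

(** For a step function [s] near [f], the decomposition and orthogonality keep only the order [i].
    Both sides pass to the limit: the left by [Y_TI_approx], the right because the kernels converge
    in [L^1] and [ev t] is bounded. *)
Lemma Y_TI (i : 'I_k.+1) (t : seq (bx R X i)) : good mu t ->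
  rint P (fun w => Y w * TI t w)%R = (i`!%:R * rint (mun i) (fun y => kern y * ev t y))%R.
Proof.
move=> gt; have [K hK] := Y_TI_approx gt; have [M hM] := ev_bounded t.
have [ft ot st] := gt; have mt := measurable_ev ft.
have M0 : (0 <= M)%R by exact: le_trans (normr_ge0 _) (hM point).
have boundi (h : i.-tuple X -> R) : rintegrable (mun i) h ->
    rintegrable (mun i) (fun y => h y * ev t y)%R.
  move=> hi; apply: (le_rintegrable (g := fun y => M * `|h y|)%R).
  - by apply: measurable_funM mt; exact: rintegrable_meas hi.
  - exact/rintegrableZ/rintegrable_norm.
  - by move=> y; rewrite normrM mulrC ler_wpM2r.
apply: (eq_dist_scale (K := (K + i`!%:R * (M * 'C(k, i)%:R))%R)) => e e0.
have [s gs se] := L1_approx mu_nonatomic sB fi e0.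
have gp := part_good i gs; have [fp op sp] := gp.
have E : rint P (fun w => UI s w * TI t w)%R =
    (i`!%:R * rint (mun i) (fun y => ev (pt s i) y * ev t y))%R.
  rewrite rint_UI_TI// (bigD1 i)//= big1 ?addr0.
    by have [_ ->] := TI_isometry eta_poisson fp ft op ot st.
  move=> j ji; have [fj oj sj] := part_good j gs.
  by apply: (TI_orthogonal eta_poisson fj ft oj ot); rewrite (inj_eq val_inj).
have -> : (rint P (fun w => Y w * TI t w) - i`!%:R * rint (mun i) (fun y => kern y * ev t y) =
  (rint P (fun w => Y w * TI t w) - rint P (fun w => UI s w * TI t w)) +
  i`!%:R * (rint (mun i) (fun y => ev (pt s i) y * ev t y) -
     rint (mun i) (fun y => kern y * ev t y)))%R by rewrite E; ring.
apply: (le_trans (ler_normD _ _)); rewrite mulrDl lerD//; first exact: hK.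
rewrite normrM ger0_norm// -!mulrA ler_wpM2l//.
have ki := kern_rintegrable i; have pi := (rintegrable_ev fp).1.
rewrite -rintB; [|exact: boundi..].
have di : rintegrable (mun i) (fun y => kern y - ev (pt s i) y)%R by exact: rintegrableB.
apply: (le_trans (ler_norm_rint (rintegrableB (boundi _ pi) (boundi _ ki)))).
apply: (@le_trans _ _ (rint (mun i) (fun y => M * `|kern y - ev (pt s i) y|))%R).
  apply: le_rint; [exact: rintegrable_norm (rintegrableB (boundi _ pi) (boundi _ ki))|exact: rintegrableZ (rintegrable_norm di)|].
  by move=> y; rewrite -mulrBl normrM mulrC distrC ler_wpM2r.
rewrite rintZ; last exact: rintegrable_norm.
rewrite ler_wpM2l// (le_trans (kern_part i gs))// ler_wpM2l//.
Qed.

End kernels.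

Lemma clamp_clamp (R : realType) (a b x : R) : (0 <= a -> a <= b ->
  clamp a (clamp b x) = clamp a x)%R.
Proof.
move=> a0 ab; have Na : (- a <= a)%R by lra.
have hi (c y : R) : (0 <= c -> c <= y -> clamp c y = c)%R.
  by move=> c0 cy; rewrite /clamp min_r// max_r//; lra.
have lo (c y : R) : (0 <= c -> y <= - c -> clamp c y = - c)%R.
  by move=> c0 cy; rewrite /clamp min_l ?max_l//; lra.
have b0 : (0 <= b)%R by exact: le_trans ab.
case: (leP b x) => xb; first by rewrite (hi b)// !hi// (le_trans ab).
case: (leP x (- b)%R) => xNb; first by rewrite (lo b)// !lo//; lra.
by rewrite (@clamp_id _ b)// ler_norml !ltW.
Qed.

Lemma clamp_sqr_le (R : realType) (a x : R) : (0 <= a -> clamp a x ^+ 2 <= x * clamp a x)%R.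
Proof.
move=> a0; rewrite /clamp /Num.max /Num.min.
by case: (ltP x a) => ?; case: (ltP (- a)%R x) => ?; case: (ltP (- a)%R a) => ?; nra.
Qed.

(** Monotone convergence: the squares of the truncations increase to [g ^+ 2], and their integrals
    are bounded by [A]. *)
Lemma L2_clamp_bound (R : realType) (d : measure_display) (T : measurableType d)
  (m : {measure set T -> \bar R}) (g : T -> R) (A : R) : measurable_fun setT g ->
  (forall n : nat, L2 m (fun x => clamp n%:R (g x)) /\
     (nsq m (fun x => clamp n%:R (g x)) <= A)%R) -> L2 m g.
Proof.
move=> mg h; split => //; apply: rintegrableP; first exact: measurable_funX.
pose u n x := (clamp n%:R (g x) ^+ 2)%:E.
have lim x : limn (fun n => u n x) = `|g x ^+ 2|%:E.
  apply: cvg_lim => //; apply: cvg_near_cst; near=> n.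
  rewrite /u clamp_id; first by rewrite [in RHS]ger0_norm// sqr_ge0.
  near: n; exact: nbhs_infty_ger.
under eq_integral => x _ do rewrite -lim.
rewrite monotone_convergence//.
- apply: (@le_lt_trans _ _ A%:E); last exact: ltry.
  apply: lime_le.
    apply: ereal_nondecreasing_is_cvgn => a b ab; apply: ge0_le_integral => //.
    + by move=> x _; rewrite lee_fin sqr_ge0.
    + by apply/measurable_EFinP; exact: rintegrable_meas (h a).1.2.
    + by apply/measurable_EFinP; exact: rintegrable_meas (h b).1.2.
    + move=> x _; rewrite lee_fin -real_normK ?num_real// -[leRHS]real_normK ?num_real//.
      rewrite lerXn2r ?nnegrE// -(@clamp_clamp _ a%:R b%:R) ?ler_nat//.
      exact: clamp_norm.
  by near=> n; rewrite (rintE (h n).1.2) lee_fin; exact: (h n).2.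
- by move=> n; apply/measurable_EFinP; exact: rintegrable_meas (h n).1.2.
- by move=> n x _; rewrite lee_fin sqr_ge0.
- move=> x _ a b ab; rewrite lee_fin -real_normK ?num_real// -[leRHS]real_normK ?num_real//.
  rewrite lerXn2r ?nnegrE// -(@clamp_clamp _ a%:R b%:R) ?ler_nat//.
  exact: clamp_norm.
Unshelve. all: by end_near. Qed.

Lemma rint_norm_sqrt (R : realType) (d : measure_display) (T : measurableType d)
  (P : probability T R) (Z : T -> R) : L2 P Z ->
  (rint P (fun w => `|Z w|) <= Num.sqrt (nsq P Z))%R.
Proof.
move=> LZ.
have L1 : L2 P (fun=> 1%R).
  by split => //; rewrite expr1n; exact: rintegrable_cst.
have LN : L2 P (fun w => `|Z w|)%R.
  by split; [exact: measurableT_comp LZ.1|exact: L2_rintegrable_norm].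
have := cauchy_schwarz LN L1.
have -> : nsq P (fun=> 1%R) = 1%R by rewrite /nsq expr1n rint_cst.
rewrite sqrtr1 mulr1 (eq_rint _ (g := fun w => `|Z w|%R)); last by move=> w; rewrite mulr1.
have -> : nsq P (fun w => `|Z w|%R) = nsq P Z.
  by apply: eq_rint => w; rewrite real_normK// num_real.
by rewrite ger0_norm// rint_ge0.
Qed.

(** * Existence of multiple integrals *)

Section kernels.
Context (R : realType) (dX dO : measure_display) (X : measurableType dX).
Context (Omega : measurableType dO).
Context (mu : {sigma_finite_measure set X -> \bar R}).
Context (P : probability Omega R) (eta : {RV P >-> point_measure R X}).
Hypothesis eta_poisson : poisson_process mu eta.
Local Notation mun n := (power_measure mu n).
Local Notation TI := (step_chaos mu eta).
Local Notation UI := (step_count eta).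

Lemma good_sub n (s t : seq (bx R X n)) : good mu s -> good mu t ->
  exists u, [/\ good mu u, forall x, ev u x = (ev s x - ev t x)%R &
    forall w, TI u w = (TI s w - TI t w)%R].
Proof.
move=> [fs os ss] [ft ot st]; exists (s ++ scale_bx (-1) t).
have E x : ev (s ++ scale_bx (-1) t) x = (ev s x - ev t x)%R.
  by rewrite ev_cat ev_scale mulN1r.
split => //; last by move=> w; rewrite /step_chaos Zint_cat Zint_scale mulN1r.
split; first by apply: fsides_cat => //; exact: fsides_scale.
  by move=> x nx; rewrite E os// ot// subrr.
by move=> sigma x; rewrite !E ss st.
Qed.

(* [Z] is the multiple integral of [g], computed along the step functions [t]. *)
Definition WI n (g : n.-tuple X -> R) (Z : Omega -> R) (t : nat -> seq (bx R X n)) :=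
  [/\ forall m, good mu (t m), L2 (mun n) g, L2 P Z,
    nsq (mun n) (fun x => ev (t m) x - g x)%R @[m --> \oo] --> (0 : R)%R &
    nsq P (fun w => TI (t m) w - Z w)%R @[m --> \oo] --> (0 : R)%R].

Hypothesis mu_nonatomic : nonatomic mu.
Context (B : nat -> set X).
Hypothesis sB : separating B.

Lemma exists_WI n (g : n.-tuple X -> R) : rintegrable (mun n) g -> L2 (mun n) g ->
  aesym mu g -> exists Z t, WI g Z t /\
    rint (mun n) (fun x => `|ev (t m) x - g x|)%R @[m --> \oo] --> (0 : R)%R.
Proof.
move=> gi Lg sg.
have f0 : (0 < n`!%:R :> R)%R by rewrite ltr0n fact_gt0.
(* Two consecutive approximants are within [4 * e m] in squared norm, and the isometry multiplies
   this by [n!]: the result is the rate [8^-1 ^+ m] of [L2_complete]. *)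
pose e m : R := (8^-1 ^+ m / (4 * n`!%:R))%R.
have e0 m : (0 < e m)%R by rewrite divr_gt0 ?mulr_gt0 ?exprn_gt0.
have /choice[t ht] : forall m, exists t, [/\ good mu t,
    (rint (mun n) (fun x => `|g x - ev t x|) <= e m)%R &
    (nsq (mun n) (fun x => g x - ev t x) <= e m)%R].
  by move=> m; exact: (good_approx mu_nonatomic sB gi Lg sg (e0 m)).
have gt m : good mu (t m) by have [] := ht m.
have Lt m := good_L2 (let: And3 h _ _ := gt m in h).
have e_to0 : e m @[m --> \oo] --> (0 : R)%R.
  rewrite -[X in _ --> X](mul0r (4 * n`!%:R)^-1%R).
  apply: cvgM; last exact: cvg_cst.
  by apply: cvg_expr; rewrite ger0_norm// invf_lt1// ltr1n.
have sqz (u : nat -> R) : (forall m, 0 <= u m)%R -> (forall m, u m <= e m)%R ->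
    (u m @[m --> \oo] --> (0 : R)%R)%classic.
  move=> u0 ue; apply: (squeeze_cvgr _ (cvg_cst (0 : R)%R) e_to0).
  by near=> m; rewrite u0 ue.
have nsq_sym m : nsq (mun n) (fun x => ev (t m) x - g x)%R = nsq (mun n) (fun x => g x - ev (t m) x)%R.
  by apply: eq_rint => x; ring.
have LT m := (TI_L2 eta_poisson (gt m)).1.
have [|Z LZ hZ] := L2_complete LT.
  move=> m; have [u [gu uE uT]] := good_sub (gt m.+1) (gt m).
  have -> : nsq P (fun w => TI (t m.+1) w - TI (t m) w)%R = nsq P (TI u).
    by apply: eq_rint => w; rewrite uT.
  rewrite (TI_L2 eta_poisson gu).2.
  have : (nsq (mun n) (ev u) <= 4 * e m)%R.
    have [_ _ h1] := ht m.+1; have [_ _ h2] := ht m.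
    have := nsqD_le (L2B (Lt m.+1) Lg) (L2B Lg (Lt m)).
    rewrite nsq_sym.
    have -> : nsq (mun n) (fun x => ev (t m.+1) x - g x + (g x - ev (t m) x))%R =
      nsq (mun n) (ev u) by apply: eq_rint => x; rewrite subrKA uE.
    have : (e m.+1 <= e m)%R.
      rewrite /e exprS ler_wpM2r ?invr_ge0 ?mulr_ge0// ler_piMl ?exprn_ge0//.
      by rewrite invf_le1// ler1n.
    by move: h1 h2; lra.
  have -> : (8^-1 ^+ m = n`!%:R * (4 * e m) :> R)%R by rewrite /e; field; rewrite gt_eqF.
  by rewrite ler_pM2l.
exists Z, t; split; first split => //.
- by apply: sqz => m; [exact: nsq_ge0|rewrite nsq_sym; have [] := ht m].
- apply: sqz => m; first by apply: rint_ge0 => x.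
  have [_ h _] := ht m; apply: le_trans h.
  by rewrite (eq_rint _ (g := fun x => `|g x - ev (t m) x|%R))// => x; rewrite distrC.
Unshelve. all: by end_near. Qed.

End kernels.

(** The inequality of arithmetic and geometric means; [kern_L2] uses it to absorb half of [q]. *)
Lemma le_half_of_sqr (R : realType) (a b q : R) : (0 <= a -> 0 <= q ->
  b ^+ 2 <= a * q -> 2 * b <= a + q)%R.
Proof.
move=> a0 q0 h; rewrite leNgt; apply/negP => hlt.
have : (0 < (2 * b - (a + q)) * (2 * b + (a + q)))%R by apply: mulr_gt0; lra.
by have := sqr_ge0 (a - q)%R; nra.
Qed.

(** * Square integrability of the kernels and the expansion *)

Section expansion.
Context (R : realType) (dX dO : measure_display) (X : measurableType dX).
Context (Omega : measurableType dO).
Context (mu : {sigma_finite_measure set X -> \bar R}).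
Context (P : probability Omega R) (eta : {RV P >-> point_measure R X}).
Hypothesis eta_poisson : poisson_process mu eta.
Local Notation mun n := (power_measure mu n).
Local Notation TI := (step_chaos mu eta).
Local Notation UI := (step_count eta).
Hypothesis mu_nonatomic : nonatomic mu.
Context (B : nat -> set X).
Hypothesis sB : separating B.
Context (k : nat) (f : k.-tuple X -> R) (Y : Omega -> R).
Hypothesis fi : rintegrable (mun k) f.
Hypothesis sf : aesym mu f.
Hypothesis LY : L2 P Y.
Hypothesis YU : \forall w \ae P, (Y w)%:E = U_sum f (eta w).
Local Notation kern := (Ukernel mu f).
Local Notation pt s i := (part mu (subnKC (leq_ord i)) (sym_bx s)).

Lemma kern_approx (i : 'I_k.+1) (e : R) : (0 < e)%R -> exists2 s, good mu s &
  (rint (mun i) (fun y : i.-tuple X => `|kern y - ev s y|) <= 'C(k, i)%:R * e)%R.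
Proof.
move=> e0; have [s gs se] := L1_approx mu_nonatomic sB fi e0.
exists (pt s i); first exact: part_good.
by apply: (le_trans (kern_part fi sf i gs)); rewrite ler_wpM2l.
Qed.

(** Symmetry passes to the [L^1] limit from the kernels of step functions; permuting the variables
    preserves the distance to [ev s]. *)
Lemma kern_aesym (i : 'I_k.+1) : aesym mu (@Ukernel _ _ _ mu k f i).
Proof.
move=> sigma; have ki := kern_rintegrable fi i.
have kpi := rintegrable_permute sigma ki.
suff n0 : rint (mun i) (fun y : i.-tuple X => `|kern (permute_tuple sigma y) - kern y|)%R = 0%R.
  have := rint_norm_eq0 (rintegrableB kpi ki) n0; apply: filterS => y /eqP.
  by rewrite subr_eq0 => /eqP.
apply: (eq_dist_scale (K := (2 * 'C(k, i)%:R)%R)) => e e0.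
rewrite subr0 ger0_norm; last by apply: rint_ge0 => y.
have [s [fs os ss] se] := kern_approx i e0; have si := (rintegrable_ev fs).1.
have ni : rintegrable (mun i) (fun y : i.-tuple X => `|kern y - ev s y|)%R.
  exact/rintegrable_norm/rintegrableB.
have npi := rintegrable_permute sigma ni.
apply: (@le_trans _ _ (rint (mun i) (fun y : i.-tuple X => `|kern (permute_tuple sigma y) -
     ev s (permute_tuple sigma y)| + `|kern y - ev s y|)))%R.
  apply: le_rint; [exact/rintegrable_norm/rintegrableB|exact: rintegrableD|move=> y].
  by rewrite ss (distrC (kern y) (ev s y)); exact: ler_distD.
have E := rint_permute mu sigma (rintegrable_meas ni) (fun y => normr_ge0 (kern y - ev s y)%R).
by rewrite rintD// E -mulrA mulr_natl mulr2n lerD.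
Qed.

(* A step function [s] close to [Ukernel] in [L^1] is clamped to [t]. Then
   [nsq t <= <s, t>] is close to [<Ukernel, t> = E (Y T(t)) / i!], which is at most
   [sqrt (nsq Y * nsq t / i!)], so that [nsq t] is bounded by about [nsq Y / i!]. *)
Lemma kern_L2 (i : 'I_k.+1) : L2 (mun i) (@Ukernel _ _ _ mu k f i).
Proof.
have ki := kern_rintegrable fi i; have mk := rintegrable_meas ki.
have f0 : (0 < i`!%:R :> R)%R by rewrite ltr0n fact_gt0.
apply: (L2_clamp_bound (A := (nsq P Y / i`!%:R)%R) mk) => n.
have N0 : (0 <= n%:R :> R)%R by [].
have mh : measurable_fun setT (fun y : i.-tuple X => clamp n%:R (kern y)).
  exact: (measurableT_comp (measurable_clamp _) mk).
have Lh : L2 (mun i) (fun y : i.-tuple X => clamp n%:R (kern y)).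
  split => //; apply: (le_rintegrable (g := fun y => n%:R * `|kern y|)%R).
  - exact: measurable_funX.
  - exact/rintegrableZ/rintegrable_norm.
  - by move=> y; rewrite normrX expr2 ler_pM//; [exact: clamp_le|exact: clamp_norm].
split => //.
set c := 'C(k, i)%:R%R : R.
(* Of the four errors [n%:R * c * e], two come from the bound on [nsq (ev t)], after half of it is
   absorbed, and two from replacing the clamped kernel by [ev t]. *)
suff h e : (0 < e)%R -> (nsq (mun i) (fun y : i.-tuple X => clamp n%:R (kern y)) <=
    nsq P Y / i`!%:R + 4 * n%:R * c * e)%R.
  apply/ler_addgt0Pr => e e0.
  have q0 : (0 < 4 * n%:R * c + 1)%R by rewrite ltr_wpDl// !mulr_ge0.
  apply: (le_trans (h (e / (4 * n%:R * c + 1))%R _)); first by rewrite divr_gt0.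
  rewrite lerD2l mulrA ler_pdivrMr// mulrC ler_wpM2l ?lerDl//; exact: ltW.
move=> e0; have [s gs se] := kern_approx i e0.
have [t gt tE] := clamp_bx N0 gs.
have [fs os ss] := gs; have [ft ot st] := gt.
have si := (rintegrable_ev fs).1; have Lt := good_L2 ft; have Ls := good_L2 fs.
have di : rintegrable (mun i) (fun y : i.-tuple X => `|kern y - ev s y|)%R.
  exact/rintegrable_norm/rintegrableB.
have tn y : (`|ev t y| <= n%:R)%R by rewrite tE; exact: clamp_le.
have kti : rintegrable (mun i) (fun y : i.-tuple X => kern y * ev t y)%R.
  apply: (le_rintegrable (g := fun y => n%:R * `|kern y|)%R).
  - by apply: measurable_funM mk _; exact: measurable_ev ft.
  - exact/rintegrableZ/rintegrable_norm.
  - by move=> y; rewrite normrM mulrC ler_wpM2r.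
have i2 : rintegrable (mun i) (fun y : i.-tuple X => n%:R * `|kern y - ev s y|)%R by exact: rintegrableZ.
have h1 : (nsq (mun i) (ev t) <= rint (mun i) (fun y : i.-tuple X => kern y * ev t y) + n%:R * (c * e))%R.
  apply: (@le_trans _ _ (rint (mun i) (fun y : i.-tuple X => kern y * ev t y + n%:R * `|kern y - ev s y|)))%R.
    apply: le_rint; [exact: Lt.2|exact: rintegrableD|move=> y].
    have := clamp_sqr_le (ev s y) N0; rewrite -tE => h; apply: (le_trans h).
    rewrite -lerBlDl -mulrBl (le_trans (ler_norm _))// normrM distrC mulrC.
    by rewrite ler_wpM2r.
  by rewrite rintD// lerD2l rintZ// ler_wpM2l.
have h2 : (nsq (mun i) (fun y : i.-tuple X => clamp n%:R (kern y)) <=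
    nsq (mun i) (ev t) + 2 * n%:R * (c * e))%R.
  have i3 : rintegrable (mun i) (fun y => 2 * n%:R * `|kern y - ev s y|)%R.
    exact: rintegrableZ.
  apply: (@le_trans _ _ (rint (mun i) (fun y => ev t y ^+ 2 + 2 * n%:R * `|kern y - ev s y|)))%R.
    apply: le_rint; [exact: Lh.2|exact: rintegrableD Lt.2 i3|move=> y].
    rewrite -lerBlDl subr_sqr mulrC tE.
    apply: (le_trans (ler_norm _)); rewrite normrM ler_pM//; last exact: clamp_lip.
    apply: (le_trans (ler_normD _ _)); rewrite mulr2n mulrDl mul1r lerD//; exact: clamp_le.
  by rewrite rintD//; [rewrite lerD2l rintZ// ler_wpM2l// mulr_ge0|exact: Lt.2].
have [LT nT] := TI_L2 eta_poisson gt.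
have := cauchy_schwarz LY LT.
rewrite (Y_TI eta_poisson mu_nonatomic sB fi sf LY YU gt) nT.
set b := rint _ _ in h1 *; set q := nsq (mun i) (ev t) in h1 h2 *; set A := nsq P Y.
have A0 : (0 <= A)%R := nsq_ge0 P Y.
have q0 : (0 <= q)%R := nsq_ge0 (mun i) (ev t).
move=> cs.
have cs2 : (i`!%:R * b ^+ 2 <= A * q)%R.
  have := cs; rewrite -sqrtrM//.
  have := cs; rewrite -sqrtrM// -sqrtr_sqr ler_sqrt; last by rewrite mulr_ge0// mulr_ge0// ltW.
  move=> h _; rewrite -(ler_pM2l f0); move: h; congr (_ <= _)%R; ring.
have c0 : (0 <= c)%R by [].
pose a := (A / i`!%:R)%R.
have Aa : A = (a * i`!%:R)%R by rewrite /a divfK// gt_eqF.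
have a0 : (0 <= a)%R by rewrite divr_ge0// ltW.
have cs3 : (b ^+ 2 <= a * q)%R.
  by rewrite -(ler_pM2l f0) (le_trans cs2)// [X in (X * _)%R]Aa; rewrite le_eqVlt; apply/orP; left; apply/eqP; ring.
have b1 := le_half_of_sqr a0 q0 cs3.
by rewrite -/a; move: h1 h2 b1; lra.
Qed.

(** [2 ^+ i] is the constant of [TI_L1], applied to the difference of [pt s i] and a late [t m];
    these lie within ['C(k, i)%:R * e] and [e] of the kernel. The final 1 accounts for the distance
    from [TI (t m)] to its limit [Z]. *)
Lemma WI_kern_dist (i : 'I_k.+1) Z t : WI mu eta (@Ukernel _ _ _ mu k f i) Z t ->
  rint (mun i) (fun x => `|ev (t m) x - kern x|)%R @[m --> \oo] --> (0 : R)%R ->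
  forall s e, gseq mu s -> (0 < e)%R -> (rint (mun k) (fun x => `|f x - ev s x|) <= e)%R ->
  (rint P (fun w => `|TI (pt s i) w - Z w|) <= (2 ^+ i * ('C(k, i)%:R + 1) + 1) * e)%R.
Proof.
move=> [gt Lk LZ _ tZ] tk s e gs e0 se.
have [m [h1 h2]] : exists m, (rint (mun i) (fun x => `|ev (t m) x - kern x|) <= e)%R /\
    (nsq P (fun w => TI (t m) w - Z w) <= e ^+ 2)%R.
  move/cvgrPdist_le : tk => /(_ _ e0) c1.
  have e20 : (0 < e ^+ 2)%R by rewrite exprn_gt0.
  move/cvgrPdist_le : tZ => /(_ _ e20) c2.
  have [N [h1 h2]] := filter_ex (filterI c1 c2); exists N.
  by move: h1 h2; rewrite !sub0r !normrN => h1 h2; split;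
    [apply: le_trans h1|apply: le_trans h2]; exact: ler_norm.
have gp := part_good i gs; have [fp op sp] := gp; have [ft ot st] := gt m.
have [u [gu uE uT]] := good_sub eta gp (gt m); have [fu ou su] := gu.
have LD : L2 P (fun w => TI (t m) w - Z w)%R.
  by apply: L2B => //; exact: (TI_L2 eta_poisson (gt m)).1.
have iT := (TI_L1 eta_poisson fu ou).1; have := (TI_L1 eta_poisson fu ou).2 => hT.
have iD : rintegrable P (fun w => `|TI (t m) w - Z w|)%R.
  rewrite (_ : (fun _ => _) = fun w => `|(TI (t m) w - Z w) * 1|)%R; last first.
    by apply/funext => w; rewrite mulr1.
  apply/rintegrable_norm; apply: L2M LD _; split => //; rewrite expr1n; exact: rintegrable_cst.
have LpZ : rintegrable P (fun w => `|TI (pt s i) w - Z w|)%R.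
  apply: (le_rintegrable (g := fun w => `|TI u w| + `|TI (t m) w - Z w|)%R).
  - apply: measurableT_comp => //; apply: measurable_funB; first exact: measurable_TI.
    exact: LZ.1.
  - by apply: rintegrableD => //; exact: rintegrable_norm.
  - by move=> w; rewrite normr_id uT (le_trans _ (ler_normD _ _))// subrKA.
apply: (@le_trans _ _ (rint P (fun w => `|TI u w| + `|TI (t m) w - Z w|)))%R.
  apply: le_rint => //; first by apply: rintegrableD => //; exact: rintegrable_norm.
  by move=> w; rewrite uT (le_trans _ (ler_normD _ _))// subrKA.
rewrite rintD//; last exact: rintegrable_norm.
rewrite mulrDl mul1r lerD//.
  apply: (le_trans hT); rewrite -mulrA ler_wpM2l ?exprn_ge0//.
  have ki := kern_rintegrable fi i.
  have pi := (rintegrable_ev fp).1; have ti := (rintegrable_ev ft).1.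
  have i1 : rintegrable (mun i) (fun x : i.-tuple X => `|kern x - ev (pt s i) x|)%R.
    exact/rintegrable_norm/rintegrableB.
  have i2 : rintegrable (mun i) (fun x => `|ev (t m) x - kern x|)%R.
    exact/rintegrable_norm/rintegrableB.
  apply: (@le_trans _ _ (rint (mun i) (fun x : i.-tuple X => `|kern x - ev (pt s i) x| +
     `|ev (t m) x - kern x|)))%R.
    apply: le_rint; [exact: rintegrable_norm (rintegrable_ev fu).1|exact: rintegrableD|].
    by move=> x; rewrite uE distrC [leRHS]addrC; exact: ler_distD.
  rewrite rintD// mulrDl mul1r lerD//.
  by apply: (le_trans (kern_part fi sf i gs)); rewrite ler_wpM2l.
apply: (le_trans (rint_norm_sqrt LD)).
have <- : Num.sqrt (e ^+ 2)%R = e by rewrite sqrtr_sqr ger0_norm// ltW.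
exact: ler_wsqrtr.
Qed.

(** In [L^1] both sides are within a multiple of [e] of [UI s], for a step function [s] within [e]
    of [f]: the left by [U_L1], the right order by order. *)
Lemma Y_eq_sum (Z : 'I_k.+1 -> Omega -> R) t :
  (forall i, WI mu eta (@Ukernel _ _ _ mu k f i) (Z i) (t i)) ->
  (forall i : 'I_k.+1, rint (mun i) (fun x : i.-tuple X => `|ev (t i m) x - kern x|)%R @[m --> \oo] --> (0 : R)%R) ->
  \forall w \ae P, Y w = (\sum_(i < k.+1) Z i w)%R.
Proof.
move=> hW ht; have LZ i : L2 P (Z i) by have [] := hW i.
have Li (h : Omega -> R) : L2 P h -> rintegrable P h.
  move=> Lh; rewrite (_ : h = fun w => h w * 1)%R; last first.
    by apply/funext => w; rewrite mulr1.
  by apply: L2M Lh _; split => //; rewrite expr1n; exact: rintegrable_cst.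
have LS : L2 P (fun w => \sum_(i < k.+1) Z i w)%R by exact: L2_sum.
have iD : rintegrable P (fun w => Y w - \sum_(i < k.+1) Z i w)%R by exact/Li/L2B.
suff n0 : rint P (fun w => `|Y w - \sum_(i < k.+1) Z i w|)%R = 0%R.
  have := rint_norm_eq0 iD n0; apply: filterS => w /eqP.
  by rewrite subr_eq0 => /eqP.
pose K := (expR 1 ^+ k + \sum_(i < k.+1) (2 ^+ i * ('C(k, i)%:R + 1) + 1))%R : R.
apply: (eq_dist_scale (K := K)) => e e0.
rewrite subr0 ger0_norm; last by apply: rint_ge0 => w.
have [s gs se] := L1_approx mu_nonatomic sB fi e0.
have Ls := UI_L2 eta_poisson gs.
have iY : rintegrable P (fun w => `|Y w - UI s w|)%R by exact/rintegrable_norm/Li/L2B.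
have iT i : rintegrable P (fun w => `|TI (pt s i) w - Z i w|)%R.
  by apply/rintegrable_norm/Li/L2B => //; exact: (TI_L2 eta_poisson (part_good i gs)).1.
have iS : rintegrable P (fun w => \sum_(i < k.+1) 1 * `|TI (pt s i) w - Z i w|)%R.
  exact: rintegrable_sum.
apply: (@le_trans _ _ (rint P (fun w => `|Y w - UI s w| +
    \sum_(i < k.+1) 1 * `|TI (pt s i) w - Z i w|)))%R.
  apply: le_rint; [exact: rintegrable_norm|exact: rintegrableD|move=> w].
  rewrite -(subrKA (UI s w)); apply: (le_trans (ler_normD _ _)); rewrite lerD2l.
  rewrite (UI_decomp mu) -sumrB; apply: (le_trans (ler_norm_sum _ _ _)).
  by apply: ler_sum => i _; rewrite mul1r.
rewrite rintD// rint_sum// mulrDl lerD//; last first.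
  rewrite mulr_suml; apply: ler_sum => i _; rewrite mul1r.
  exact: WI_kern_dist (hW i) (ht i) _ _ gs e0 se.
(* The empty set has count 0, so the weight in [U_L1] is 1. *)
have f0 : fmeas mu set0 by split; [exact: measurable0|rewrite measure0].
have := U_L1 eta_poisson mu_nonatomic sB fi gs f0 LY.1 YU.
rewrite measure0/= mul0r expR0 mulr1 -lee_fin => h.
apply: (@le_trans _ _ (expR 1 ^+ k * rint (mun k) (fun x => `|f x - ev s x|))%:E)%R.
  rewrite -rintE//; apply: le_trans h; rewrite le_eqVlt; apply/orP; left; apply/eqP.
  by apply: eq_integral => w _; rewrite /count_in measure0/= expR0 mulr1.
by rewrite lee_fin ler_wpM2l// exprn_ge0// expR_ge0.
Qed.

End expansion.

(** * Chaos expansions *)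

Section steps.
Context (R : realType) (dX dO : measure_display) (X : measurableType dX).
Context (Omega : measurableType dO).
Context (mu : {sigma_finite_measure set X -> \bar R}).
Context (P : probability Omega R) (eta : {RV P >-> point_measure R X}).
Hypothesis eta_poisson : poisson_process mu eta.
Local Notation mun n := (power_measure mu n).
Local Notation TI := (step_chaos mu eta).
Local Notation WI := (WI mu eta).

Definition seq_of_step n (s : step_function R X n) : seq (bx R X n) :=
  [seq (step_value j, step_side (s := s) j) | j <- enum 'I_(step_size s)].

Lemma ev_step n (s : step_function R X n) : ev (seq_of_step s) = step_fun s.
Proof. by apply/funext => x; rewrite /ev big_map big_enum. Qed.

Lemma TI_step n (s : step_function R X n) w :
  TI (seq_of_step s) w = step_integral mu s (eta w).
Proof. by rewrite /step_chaos /Zint big_map big_enum. Qed.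

Lemma good_step n (s : step_function R X n) : simple_step mu s -> good mu (seq_of_step s).
Proof.
move=> [fs _ ss os _]; split; rewrite ?ev_step//.
by move=> b /mapP[j _ ->] i; exact: fs.
Qed.

(** [simple_step] asks for disjoint boxes, which those of [t] need not be; the cells over the atoms
    are disjoint. [TI_ext] shows that the integral does not change. *)
Lemma exists_step n (t : seq (bx R X n)) : good mu t ->
  exists s : step_function R X n, [/\ simple_step mu s, step_fun s = ev t &
    \forall w \ae P, step_integral mu s (eta w) = TI t w].
Proof.
move=> gt; have [ft ot st] := gt; have [K [C [aC tC]]] := exists_atoms_seq ft.
have se := simple_on_ev aC tC.
pose a := coef C (ev t).
pose J := {ffun 'I_n -> K}.
pose s := @StepFunction R _ X n #|J| (fun j => a (enum_val j)) (fun j i => C (enum_val j i)).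
have sE : step_fun s = ev t.
  apply/funext => x; rewrite (simple_onE aC x se) ev_aseq /step_fun /=.
  by rewrite [RHS](reindex (@enum_val _ (mem J)))//; apply: onW_bij; exact: enum_val_bij.
have ai : ev (aseq C a) = ev t by apply/funext => x; rewrite -(simple_onE aC x se).
exists s; split => //.
- split.
  + by move=> j i; exact: aC.1.
  + apply/trivIsetP => i j _ _ ij; apply/eqP/negP => /negP/set0P[x [xi xj]].
    by move/eqP: ij; apply; apply: enum_val_inj; exact: (cell_inj aC xi xj).
  + by move=> sigma x; rewrite sE; exact: st.
  + by rewrite sE.
  + by rewrite sE; apply/Lfun2P; exact: good_L2.
- have fa : fsides mu (aseq C a) by exact: fsides_aseq.
  have := TI_ext eta_poisson fa ft ai; apply: filterS => w <-.
  rewrite /step_chaos Zint_aseq /step_integral /=.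
  by rewrite [RHS](reindex (@enum_val _ (mem J)))//; apply: onW_bij; exact: enum_val_bij.
Qed.

Lemma WI_of_integral n (g : n.-tuple X -> R) (Z : Omega -> R) : L2 (mun n) g ->
  wiener_ito_integral mu eta g Z -> exists t, WI g Z t.
Proof.
move=> Lg [/Lfun2P LZ [s [ss sg sZ]]]; exists (fun m => seq_of_step (s m)).
have gs m : good mu (seq_of_step (s m)) by exact: good_step.
have Ls m : L2 (mun n) (ev (seq_of_step (s m))) by apply: good_L2; have [] := gs m.
split => //.
- apply/(L2_cvgP Ls Lg (f := EFin \o g)).
  + by apply/measurable_EFinP; exact: Lg.1.
  + exact: aeW.
  by move: sg; congr L2_cvg; apply/funext => m; rewrite ev_step.
- have LT m := (TI_L2 eta_poisson (gs m)).1.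
  apply/(L2_cvgP LT LZ (f := EFin \o Z)).
  + by apply/measurable_EFinP; exact: LZ.1.
  + exact: aeW.
  by move: sZ; congr L2_cvg; apply/funext => m; apply/funext => w /=; rewrite TI_step.
Qed.

Lemma integral_of_WI n (g : n.-tuple X -> R) (Z : Omega -> R) t : WI g Z t ->
  wiener_ito_integral mu eta g Z.
Proof.
move=> [gt Lg LZ tg tZ]; split; first exact/Lfun2P.
have /choice[s hs] := fun m => exists_step (gt m).
have Lt m : L2 (mun n) (ev (t m)) by apply: good_L2; have [] := gt m.
have sE m : step_fun (s m) = ev (t m) by have [] := hs m.
have ss m : simple_step mu (s m) by have [] := hs m.
have LT m := (TI_L2 eta_poisson (gt m)).1.
have mS m : measurable_fun setT (fun w => step_integral mu (s m) (eta w)).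
  rewrite (_ : (fun _ => _) = TI (seq_of_step (s m))).
    by have [fs _ _] := good_step (ss m); exact: measurable_TI.
  by apply/funext => w; rewrite TI_step.
have sT m : \forall w \ae P, TI (t m) w = step_integral mu (s m) (eta w).
  by have [_ _ h] := hs m; apply: filterS h.
have LS m : L2 P (fun w => step_integral mu (s m) (eta w)).
  exact: L2_ae (mS m) (LT m) (sT m).
exists s; split => //.
- apply/(L2_cvgP (u := fun m => step_fun (s m)) _ Lg (f := EFin \o g)).
  + by move=> m; rewrite sE.
  + by apply/measurable_EFinP; exact: Lg.1.
  + exact: aeW.
  have -> // : (fun m => nsq (mun n) (fun x => step_fun (s m) x - g x)%R) =
    (fun m => nsq (mun n) (fun x => ev (t m) x - g x)%R) by apply/funext => m; rewrite sE.
- apply/(L2_cvgP LS LZ (f := EFin \o Z)).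
  + by apply/measurable_EFinP; exact: LZ.1.
  + exact: aeW.
  have -> // : (fun m => nsq P (fun w => step_integral mu (s m) (eta w) - Z w)%R) =
    (fun m => nsq P (fun w => TI (t m) w - Z w)%R).
  apply/funext => m; apply/esym/nsq_ae.
  + exact: (measurable_funB (LT m).1 LZ.1).
  + exact: (measurable_funB (mS m) LZ.1).
  + by apply: filterS (sT m) => w ->.
Qed.

Lemma WI_orth n m (g : n.-tuple X -> R) (h : m.-tuple X -> R) Z Z' t t' :
  WI g Z t -> WI h Z' t' -> n != m -> rint P (fun w => Z w * Z' w)%R = 0%R.
Proof.
move=> [gt Lg LZ tg tZ] [gt' Lh LZ' tg' tZ'] nm.
have LT j := (TI_L2 eta_poisson (gt j)).1.
have LT' j := (TI_L2 eta_poisson (gt' j)).1.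
have := cvg_rintM LT LT' LZ LZ' tZ tZ'.
rewrite (_ : (fun _ => _) = fun=> 0%R); last first.
  apply/funext => j; have [ft ot st] := gt j; have [ft' ot' st'] := gt' j.
  exact: (TI_orthogonal eta_poisson ft ft' ot ot').
by move=> c; apply/esym; apply: (cvg_unique _ (cvg_cst (0 : R)%R) c).
Qed.

(** The approximating sequences [t] and [t'] are unrelated, so integrals obtained in different ways
    can be compared; the uniqueness of kernels relies on this. *)
Lemma WI_isometry n (g h : n.-tuple X -> R) Z Z' t t' : WI g Z t -> WI h Z' t' ->
  rint P (fun w => Z w * Z' w)%R = (n`!%:R * rint (mun n) (fun x => g x * h x))%R.
Proof.
move=> [gt Lg LZ tg tZ] [gt' Lh LZ' tg' tZ'].
have LT j := (TI_L2 eta_poisson (gt j)).1.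
have LT' j := (TI_L2 eta_poisson (gt' j)).1.
have Lt j : L2 (mun n) (ev (t j)) by apply: good_L2; have [] := gt j.
have Lt' j : L2 (mun n) (ev (t' j)) by apply: good_L2; have [] := gt' j.
have c1 := cvg_rintM LT LT' LZ LZ' tZ tZ'.
have c2 := cvg_rintM Lt Lt' Lg Lh tg tg'.
have E : (fun j => rint P (fun w => TI (t j) w * TI (t' j) w)%R) =
    (fun j => n`!%:R * rint (mun n) (fun x => ev (t j) x * ev (t' j) x))%R.
  apply/funext => j; have [ft ot st] := gt j; have [ft' ot' st'] := gt' j.
  by have [_ ->] := TI_isometry eta_poisson ft ft' ot ot' st'.
rewrite E in c1; apply: (cvg_unique _ c1) => //.
by apply: cvgM => //; exact: cvg_cst.
Qed.

End steps.

(** * Uniqueness of the expansion *)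

Section chaos.
Context (R : realType) (dX dO : measure_display) (X : measurableType dX).
Context (Omega : measurableType dO).
Context (mu : {sigma_finite_measure set X -> \bar R}).
Context (P : probability Omega R) (eta : {RV P >-> point_measure R X}).
Hypothesis eta_poisson : poisson_process mu eta.
Local Notation mun n := (power_measure mu n).
Local Notation WI := (WI mu eta).

Section uniqueness.
Context (F : point_measure R X -> \bar R) (Y : Omega -> R).
Hypothesis mF : measurable_fun setT F.
Hypothesis LY : L2 P Y.
Hypothesis FY : \forall w \ae P, F (eta w) = (Y w)%:E.

Lemma chaos_L2_cvg (I : nat -> Omega -> R) : (forall i, L2 P (I i)) ->
  L2_cvg P (fun m w => (\sum_(i < m) I i w)%R%:E) (F \o eta) <->
  nsq P (fun w => \sum_(i < m) I i w - Y w)%R @[m --> \oo] --> (0 : R)%R.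
Proof.
move=> LI; apply: L2_cvgP => //; first by move=> m; exact: L2_sum.
by apply: measurableT_comp => //; exact: measurable_funPT.
Qed.

(** The inner product of [Z] with a partial sum no longer changes once the sum contains the term
    [n], so its limit is this value. *)
Lemma rint_chaos (I : nat -> Omega -> R) (Z : Omega -> R) n : (forall i, L2 P (I i)) ->
  L2_cvg P (fun m w => (\sum_(i < m) I i w)%R%:E) (F \o eta) -> L2 P Z ->
  (forall i, i != n -> rint P (fun w => I i w * Z w)%R = 0%R) ->
  rint P (fun w => Y w * Z w)%R = rint P (fun w => I n w * Z w)%R.
Proof.
move=> LI hI LZ h0; have LS m : L2 P (fun w => \sum_(i < m) I i w)%R by exact: L2_sum.
have c0 : nsq P (fun w => Z w - Z w)%R @[_ --> \oo] --> (0 : R)%R.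
  have -> : (fun _ : nat => nsq P (fun w => Z w - Z w)%R) = fun=> 0%R; last exact: cvg_cst.
  apply/funext => _; rewrite -[RHS](rint0 P); apply: eq_rint => w.
  by rewrite subrr expr0n.
have c := cvg_rintM LS (fun=> LZ) LY LZ ((chaos_L2_cvg LI).1 hI) c0.
apply: (cvg_unique _ c) => //; apply: cvg_near_cst; near=> m.
have nm : (n < m)%N by near: m; exact: nbhs_infty_gt.
rewrite (eq_rint _ (g := fun w => \sum_(i < m) 1 * (I i w * Z w))%R); last first.
  by move=> w; rewrite mulr_suml; apply: eq_bigr => i _; rewrite mul1r.
rewrite rint_sum; last by move=> i; exact: L2M.
rewrite (bigD1 (Ordinal nm))//= mul1r big1 ?addr0// => i ni.
by rewrite h0 ?mulr0//; rewrite -(inj_eq val_inj) in ni.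
Unshelve. all: by end_near. Qed.

(** Pairing both expansions with the difference of [I n] and [I' n] gives the same number, so this
    difference has second moment 0; by the isometry that moment is [n!] times the squared distance
    of [g n] and [g' n]. *)
Lemma chaos_unique g g' : chaos_kernels mu eta F g -> chaos_kernels mu eta F g' ->
  forall n, \forall y \ae mun n, g n y = g' n y.
Proof.
move=> [hg _ [I [WI1 cI]]] [hg' _ [I' [WI2 cI']]] n.
have Lg i : L2 (mun i) (g i) by apply/Lfun2P; exact: (hg i).1.
have Lg' i : L2 (mun i) (g' i) by apply/Lfun2P; exact: (hg' i).1.
have LI i : L2 P (I i) by apply/Lfun2P; exact: (WI1 i).1.
have LI' i : L2 P (I' i) by apply/Lfun2P; exact: (WI2 i).1.
have W i : exists t, WI (g i) (I i) t by exact: WI_of_integral.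
have W' i : exists t, WI (g' i) (I' i) t by exact: WI_of_integral.
have [t ht] := W n; have [t' ht'] := W' n.
have LZ : L2 P (fun w => I n w - I' n w)%R by exact: L2B.
have orth (J : nat -> Omega -> R) i (u : i.-tuple X -> R) : L2 P (J i) ->
    (exists t, WI u (J i) t) -> i != n ->
    rint P (fun w => J i w * (I n w - I' n w))%R = 0%R.
  move=> LJ [s hs] ni.
  rewrite (eq_rint _ (g := fun w => J i w * I n w - J i w * I' n w)%R); last first.
    by move=> w; rewrite mulrBr.
  rewrite rintB; [|exact: L2M..].
  by rewrite (WI_orth eta_poisson hs ht ni) (WI_orth eta_poisson hs ht' ni) subrr.
have e1 := rint_chaos LI cI LZ (fun i ni => orth I i (g i) (LI i) (W i) ni).
have e2 := rint_chaos LI' cI' LZ (fun i ni => orth I' i (g' i) (LI' i) (W' i) ni).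
have nZ : nsq P (fun w => I n w - I' n w)%R = 0%R.
  rewrite /nsq (eq_rint _ (g := fun w => I n w * (I n w - I' n w) -
     I' n w * (I n w - I' n w))%R); last by move=> w; rewrite expr2 mulrBl.
  rewrite rintB; [|exact: L2M..].
  by rewrite -e1 -e2 subrr.
have f0 : n`!%:R != 0%R :> R by rewrite pnatr_eq0 -lt0n fact_gt0.
have ng : nsq (mun n) (fun x => g n x - g' n x)%R = 0%R.
  apply: (mulfI f0); rewrite mulr0 -nZ nsqB// nsqB// /nsq.
  have := WI_isometry eta_poisson ht ht; have := WI_isometry eta_poisson ht' ht'.
  have := WI_isometry eta_poisson ht ht'.
  rewrite /= => -> -> ->; ring.
have := nsq_eq0 (L2B (Lg n) (Lg' n)) ng; apply: filterS => y /eqP.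
by rewrite subr_eq0 => /eqP.
Qed.

End uniqueness.
End chaos.

(** * Expansion and second moment of the U-statistic *)

Section final.
Context (R : realType) (dX dO : measure_display) (X : measurableType dX).
Context (Omega : measurableType dO).
Context (mu : {sigma_finite_measure set X -> \bar R}).
Context (P : probability Omega R) (eta : {RV P >-> point_measure R X}).
Hypothesis eta_poisson : poisson_process mu eta.
Local Notation mun n := (power_measure mu n).
Local Notation WI := (WI mu eta).
Local Notation TI := (step_chaos mu eta).
Hypothesis mu_nonatomic : nonatomic mu.
Context (B : nat -> set X).
Hypothesis sB : separating B.
Context (k : nat) (f : k.-tuple X -> R) (F : point_measure R X -> \bar R) (Y : Omega -> R).
Hypothesis fi : rintegrable (mun k) f.
Hypothesis sf : aesym mu f.
Hypothesis mF : measurable_fun setT F.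
Hypothesis LY : L2 P Y.
Hypothesis FY : \forall w \ae P, F (eta w) = (Y w)%:E.
Hypothesis YU : \forall w \ae P, (Y w)%:E = U_sum f (eta w).
Local Notation kern i := (@Ukernel _ _ _ mu k f i).

(** Extended by 0 above order [k]. The match on [idP] provides the proof of [i < k.+1] that the
    ordinal requires. *)
Definition ukern (i : nat) : i.-tuple X -> R :=
  match @idP (i < k.+1)%N with
  | ReflectT h => kern (Ordinal h)
  | ReflectF _ => fun=> 0%R
  end.

Lemma ukernE (i : 'I_k.+1) : @ukern i = kern i.
Proof.
case: i => i hi /=; rewrite /ukern; case: {-}_ / idP => [h|/(_ hi)//].
by rewrite (bool_irrelevance h hi).
Qed.

Lemma ukern0 i : (k < i)%N -> @ukern i = fun=> 0%R.
Proof.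
move=> ki; rewrite /ukern; case: {-}_ / idP => [h|//].
by exfalso; move: h; rewrite ltnS leqNgt ki.
Qed.

Lemma ukern_WI i : exists Z, (exists t, WI (@ukern i) Z t /\
    rint (mun i) (fun x => `|ev (t m) x - ukern x|)%R @[m --> \oo] --> (0 : R)%R) /\
  ((k < i)%N -> Z = fun=> 0%R).
Proof.
case: (ltnP i k.+1) => hi.
  have [Z [t ht]] := exists_WI eta_poisson mu_nonatomic sB (kern_rintegrable fi (Ordinal hi))
    (kern_L2 eta_poisson mu_nonatomic sB fi sf LY YU (Ordinal hi))
    (kern_aesym mu_nonatomic sB fi sf (i := Ordinal hi)).
  exists Z; split => //.
  by exists t; rewrite (ukernE (Ordinal hi)).
(* Above order [k] the empty list represents the zero kernel and the zero integral. *)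
exists (fun=> 0%R); split => //; exists (fun=> [::]); rewrite ukern0//.
have evn x : ev ([::] : seq (bx R X i)) x = 0%R by rewrite /ev big_nil.
have TIn w : TI ([::] : seq (bx R X i)) w = 0%R by rewrite /step_chaos /Zint big_nil.
split.
  split.
  - by move=> _; split => //; move=> ? *; rewrite !evn.
  - exact: L2_0.
  - exact: L2_0.
  - rewrite (_ : (fun _ => _) = fun=> 0%R); first exact: cvg_cst.
    apply/funext => _; rewrite -[RHS](rint0 (mun i)); apply: eq_rint => x.
    by rewrite evn subr0 expr0n.
  - rewrite (_ : (fun _ => _) = fun=> 0%R); first exact: cvg_cst.
    apply/funext => _; rewrite -[RHS](rint0 P); apply: eq_rint => x.
    by rewrite TIn subr0 expr0n.
rewrite (_ : (fun _ => _) = fun=> 0%R); first exact: cvg_cst.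
apply/funext => _; rewrite -[RHS](rint0 (mun i)); apply: eq_rint => x.
by rewrite evn subr0 normr0.
Qed.

Lemma Y_WI : exists I : nat -> Omega -> R, [/\ forall i, exists t, WI (@ukern i) (I i) t,
  forall i, (k < i)%N -> I i = fun=> 0%R &
  \forall w \ae P, Y w = (\sum_(i < k.+1) I i w)%R].
Proof.
have /choice[I hI] := ukern_WI.
exists I; split.
- by move=> i; have [[t [ht _]] _] := hI i; exists t.
- by move=> i; have [_] := hI i.
have h (i : 'I_k.+1) : exists t, WI (kern i) (I i) t /\
    rint (mun i) (fun x => `|ev (t m) x - kern i x|)%R @[m --> \oo] --> (0 : R)%R.
  by rewrite -ukernE; exact: (hI i).1.
pose t (i : 'I_k.+1) := projT1 (cid (h i)).
have ht i : _ := projT2 (cid (h i)).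
exact: (Y_eq_sum eta_poisson mu_nonatomic sB fi sf LY YU (t := t) (fun i => (ht i).1)
  (fun i => (ht i).2)).
Qed.

Lemma rint_power0 (h : 0.-tuple X -> R) : rint (mun 0) h = h [tuple].
Proof.
have -> : h = fun=> h [tuple] by apply/funext => x; rewrite (tuple0 x).
by rewrite /rint /Rintegral integral_dirac// diracT mul1e.
Qed.

(** [Y_TI] at order 0, with the constant 1 as test function. *)
Lemma rint_Y : rint P Y = ukern [tuple].
Proof.
(* At order 0 a box has no sides and is the whole one-point space, whatever set is written. *)
pose t : seq (bx R X 0) := [:: (1%R, fun=> set0)].
have evt x : ev t x = 1%R.
  by rewrite /ev big_seq1 mul1r indicE mem_set// => -[].
have TIt w : TI t w = 1%R by rewrite /step_chaos /Zint big_seq1 big_ord0 mulr1.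
have gt : good mu t.
  split.
  - by move=> b; rewrite mem_seq1 => /eqP -> [].
  - by move=> x; rewrite (tuple0 x).
  - by move=> sigma x; rewrite !evt.
have := Y_TI eta_poisson mu_nonatomic sB fi sf LY YU (i := ord0) gt.
rewrite (eq_rint _ (g := Y)); last by move=> w; rewrite TIt mulr1.
move=> ->; rewrite fact0 mul1r rint_power0 evt mulr1.
by rewrite (ukernE ord0).
Qed.

(** The partial sums with at least [k.+1] terms equal [Y] almost surely, so the convergence is that
    of an eventually constant sequence. *)
Lemma ukern_chaos : chaos_kernels mu eta F (@ukern).
Proof.
have [I [hW I0 YI]] := Y_WI.
have LI i : L2 P (I i) by have [t [_ _]] := hW i.
split.
- move=> i; have [t [_ Lg _ _ _]] := hW i; split; first exact/Lfun2P.
  case: (ltnP i k.+1) => hi; last by rewrite ukern0//; move=> s; exact: aeW.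
  by rewrite (ukernE (Ordinal hi)); exact: (kern_aesym mu_nonatomic sB fi sf (i := Ordinal hi)).
- rewrite -rint_Y -rintE.
    apply: ae_eq_integral => //.
    + by apply: measurableT_comp => //; exact: measurable_funPT.
    + by apply/measurable_EFinP; exact: LY.1.
    + by apply: filterS FY.
  have L1 : L2 P (fun=> 1%R) by split => //; rewrite expr1n; exact: rintegrable_cst.
  by have := L2M LY L1; congr rintegrable; apply/funext => w; rewrite mulr1.
exists I; split; first by move=> i; have [t ht] := hW i; exact: integral_of_WI ht.
apply/(chaos_L2_cvg mF LY FY LI); apply: cvg_near_cst; near=> m.
have km : (k.+1 <= m)%N by near: m; exact: nbhs_infty_ge.
rewrite -[RHS](rint0 P); apply: rint_ae => //.
- apply: measurable_funX; apply: measurable_funB LY.1.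
  by have [] : L2 P (fun w => \sum_(i < m) I i w)%R by exact: L2_sum.
- apply: filterS YI => w ->.
  rewrite -(subnKC km) big_split_ord/= addrAC subrr add0r big1 ?expr0n// => i _.
  by rewrite I0// leq_addr.
Unshelve. all: by end_near. Qed.

(** The factors [Y] are expanded one after the other; orthogonality removes the mixed terms and the
    isometry evaluates the others. *)
Lemma nsq_Y : nsq P Y = (\sum_(i < k.+1) i`!%:R * nsq (mun i) (kern i))%R.
Proof.
have [I [hW I0 YI]] := Y_WI.
have LI i : L2 P (I i) by have [t [_ _]] := hW i.
have LS : L2 P (fun w => \sum_(i < k.+1) I i w)%R by exact: L2_sum.
have -> : nsq P Y = rint P (fun w => Y w * \sum_(i < k.+1) I i w)%R.
  apply: rint_ae; [exact: measurable_funX LY.1|exact: measurable_funM LY.1 LS.1|].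
  by apply: filterS YI => w h; rewrite expr2 {2}h.
have [_ _ [J [hJ cJ]]] := ukern_chaos.
rewrite (eq_rint _ (g := fun w => \sum_(i < k.+1) 1 * (Y w * I i w))%R); last first.
  by move=> w; rewrite mulr_sumr; apply: eq_bigr => i _; rewrite mul1r.
rewrite rint_sum; last by move=> i; exact: L2M.
apply: eq_bigr => i _; rewrite mul1r.
have [t ht] := hW i.
have -> : rint P (fun w => Y w * I i w)%R = rint P (fun w => \sum_(j < k.+1) 1 * (I j w * I i w))%R.
  apply: rint_ae; first exact: measurable_funM LY.1 (LI i).1.
    by apply: rintegrable_meas; apply: rintegrable_sum => j; exact: L2M.
  apply: filterS YI => w ->; rewrite mulr_suml; apply: eq_bigr => j _; rewrite mul1r//.
rewrite rint_sum; last by move=> j; exact: L2M.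
rewrite (bigD1 i)//= big1 ?addr0 ?mul1r.
  by rewrite (WI_isometry eta_poisson ht ht) ukernE.
move=> j ji; have [s hs] := hW j.
by rewrite (WI_orth eta_poisson hs ht) ?mulr0//; rewrite (inj_eq val_inj).
Qed.

End final.

(** Only almost everywhere: [partial_integral] may be infinite where the section of [f] is not
    integrable, whereas [sect] is real. *)
Lemma partial_integral_ae (R : realType) (d : measure_display) (X : measurableType d)
    (mu : {sigma_finite_measure set X -> \bar R}) (k : nat) (f : k.-tuple X -> R)
    (i : 'I_k.+1) : rintegrable (power_measure mu k) f ->
  \forall y \ae power_measure mu i,
    partial_integral mu f y = (sect mu (subnKC (leq_ord i)) f y)%:E.
Proof.
move=> fi; apply: filterS (sect_ae (subnKC (leq_ord i)) fi) => y yi.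
by rewrite -[RHS](rintE yi).
Qed.

Lemma measurable_partial_integral (R : realType) (d : measure_display)
    (X : measurableType d) (mu : {sigma_finite_measure set X -> \bar R}) (k : nat)
    (f : k.-tuple X -> R) (i : 'I_k.+1) : rintegrable (power_measure mu k) f ->
  measurable_fun setT (@partial_integral _ _ _ mu k f i).
Proof.
by move=> /(integral_cat (subnKC (leq_ord i)))[fi _]; exact: (measurable_fubini_F fi).
Qed.

(** A finite second moment excludes infinite values up to a null event, so [fine] loses nothing. *)
Lemma in_L2P_fine (R : realType) (dX dO : measure_display) (X : measurableType dX)
    (Omega : measurableType dO) (P : probability Omega R)
    (eta : {RV P >-> point_measure R X}) (F : point_measure R X -> \bar R) :
  in_L2P eta F -> L2 P (fun w => fine (F (eta w))) /\
  \forall w \ae P, F (eta w) = (fine (F (eta w)))%:E.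
Proof.
move=> [mF F2]; have mFe : measurable_fun setT (F \o eta).
  by apply: measurableT_comp => //; exact: measurable_funPT.
have mA : measurable_fun setT (fun w => `|F (eta w)|) by exact: measurableT_comp.
have m2 : measurable_fun setT (fun w => `|F (eta w)| ^+ 2) by exact: (emeasurable_funM mA mA).
have i2 : P.-integrable setT (fun w => `|F (eta w)| ^+ 2).
  apply/integrableP; split => //; apply: le_lt_trans F2.
  rewrite le_eqVlt; apply/orP; left; apply/eqP; apply: eq_integral => w _.
  by rewrite gee0_abs// mule_ge0.
have fin : \forall w \ae P, F (eta w) = (fine (F (eta w)))%:E.
  have := integrable_ae measurableT i2; apply: filterS => w /(_ I).
  by case: (F (eta w)) => [r| |].
have mY : measurable_fun setT (fun w => fine (F (eta w))) by exact: measurableT_comp.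
split => //; split => //; apply: rintegrableP; first exact: measurable_funX.
apply: le_lt_trans F2; apply: ge0_le_integral => //.
- by apply/measurable_EFinP; apply: measurableT_comp => //; exact: measurable_funX.
- by move=> w _; case: (F (eta w)) => [r| |] //=; rewrite ?lee_fin ?normrX ?leey//.
Qed.

Lemma sum_ord_recl_pos (R : realType) (k : nat) (h : 'I_k.+1 -> R) :
  (\sum_(i < k.+1) h i = h ord0 + \sum_(i < k.+1 | (1 <= i)%N) h i)%R.
Proof. by rewrite (bigD1 ord0)//; congr (_ + _)%R; apply: eq_bigl => i; rewrite lt0n. Qed.

Theorem lemma3p5 (R : realType) (dX dO : measure_display)
    (X : measurableType dX) (Omega : measurableType dO)
    (mu : {sigma_finite_measure set X -> \bar R})
    (P : probability Omega R) (eta : {RV P >-> point_measure R X})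
    (k : nat) (f : k.-tuple X -> R) (F : point_measure R X -> \bar R)
    (X_borel : borel_space R X) (mu_nonatomic : nonatomic mu)
    (eta_poisson : poisson_process mu eta) (k_gt0 : (1 <= k)%N)
    (f_L1s : in_Lps mu 1 f)
    (F_Ustat : \forall w \ae P, F (eta w) = U_sum f (eta w))
    (F_L2 : in_L2P eta F) :
  [/\
      exists g, chaos_kernels mu eta F g,
      forall g, chaos_kernels mu eta F g ->
        (forall i : 'I_k.+1, \forall y \ae power_measure mu i,
           (g i y)%:E = ('C(k, i))%:R%:E * partial_integral mu f y) /\
        (forall i : nat, (k < i)%N -> \forall y \ae power_measure mu i,
           g i y = 0%R) &
      'V_P[fun w => fine (F (eta w))] =
        \sum_(i < k.+1 | (1 <= i)%N)
          (i`! * 'C(k, i) ^ 2)%:R%:E *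
          \int[power_measure mu i]_y (partial_integral mu f y) ^+ 2].
Proof.
have [B sB] := borel_separating X_borel.
have [f1 sf] := f_L1s; have fi : rintegrable (power_measure mu k) f by exact/Lfun1_integrable.
have [LY FY] := in_L2P_fine F_L2; have [mF _] := F_L2.
set Y := fun w => fine (F (eta w)) in LY FY *.
have YU : \forall w \ae P, (Y w)%:E = U_sum f (eta w).
  by apply: filterS2 FY F_Ustat => w <-.
have ch := ukern_chaos eta_poisson mu_nonatomic sB fi sf mF LY FY YU.
split.
- by exists (fun i => @ukern _ _ _ mu k f i).
- move=> g hg; split=> i.
    have := chaos_unique eta_poisson mF LY FY hg ch i.
    apply: filterS2 (partial_integral_ae i fi) => y -> ->.
    by rewrite ukernE -EFinM.
  move=> ki; have := chaos_unique eta_poisson mF LY FY hg ch i.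
  by apply: filterS => y ->; rewrite ukern0.
have fY : Y \in Lfun P 2%:E by exact/Lfun2P.
rewrite varianceE// unlock.
have -> : \int[P]_w ((Y ^+ 2)%R w)%:E = (nsq P Y)%:E by rewrite -(rintE LY.2).
have iY : rintegrable P Y.
  have L1 : L2 P (fun=> 1%R) by split => //; rewrite expr1n; exact: rintegrable_cst.
  by have := L2M LY L1; congr rintegrable; apply/funext => w; rewrite mulr1.
rewrite (rintE iY) (rint_Y eta_poisson mu_nonatomic sB fi sf LY YU).
rewrite (nsq_Y eta_poisson mu_nonatomic sB fi sf mF LY FY YU) sum_ord_recl_pos.
(* The order 0 term of the second moment is the square of the mean, which the variance subtracts. *)
have -> : nsq (power_measure mu (@ord0 k)) (@Ukernel _ _ _ mu k f ord0) =
    (@ukern _ _ _ mu k f 0 [tuple] ^+ 2)%R.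
  by rewrite /nsq rint_power0 (ukernE mu f ord0).
rewrite -EFin_expe -EFinB fact0 mul1r addrAC subrr add0r -sumEFin.
apply: eq_bigr => i _.
have Lk := kern_L2 eta_poisson mu_nonatomic sB fi sf LY YU i.
(* As [i <= k], the binomial coefficient can be divided out, and square integrability passes from
   the kernel to the section integral. *)
have C0 : 'C(k, i)%:R != 0%R :> R by rewrite pnatr_eq0 -lt0n bin_gt0 -ltnS.
have Ls : L2 (power_measure mu i) (sect mu (subnKC (leq_ord i)) f).
  have := L2Z ('C(k, i)%:R^-1)%R Lk; congr L2; apply/funext => y.
  by rewrite /Ukernel mulKf.
have -> : \int[power_measure mu i]_y (partial_integral mu f y) ^+ 2 =
    (nsq (power_measure mu i) (sect mu (subnKC (leq_ord i)) f))%:E.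
  rewrite -(rintE Ls.2); apply: ae_eq_integral => //.
  - have mp := measurable_partial_integral (i := i) fi; exact: (emeasurable_funM mp mp).
  - by apply/measurable_EFinP; exact: measurable_funX Ls.1.
  - by apply: filterS (partial_integral_ae i fi) => y -> _.
rewrite -EFinM /Ukernel nsqZ// natrM natrX mulrA//.
Qed.
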